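(* Let $D>0$, let $P$ be a probability distribution on $\mathbb R^p\times\mathbb R$ whose support is contained in the Euclidean ball of diameter $D$ centered at $0$, and let $\Xi$ be the closed Euclidean ball of $\mathbb R^p\times\mathbb R$ of diameter $3D$ centered at $0$, with $d$ the Euclidean distance. Let $\Theta\subset\mathbb R^p$ be compact, $f(\theta,(x,y))=(\langle\theta,x\rangle-y)^2$, $\mathcal F=\{f(\theta,\cdot):\theta\in\Theta\}$ (functions on $\Xi$), and $c(\xi,\zeta)=\|\xi-\zeta\|^2$. Assume there exists $\omega>0$ such that $\inf_{\theta\in\Theta}\|(\theta,-1)\|^2\ge\omega$. Then $\rho_{\mathrm{crit}}\ge D^2$, and there exists $\lambda_{\mathrm{low}}\ge\frac{\omega}{2}$ such that for every $\delta\in(0,1)$, with $$\alpha = 48\Big(\|\mathcal F\|_\infty+\frac1{\lambda_{\mathrm{low}}}\Big)\Big(\mathcal I_{\mathcal F}+\frac{2}{\lambda_{\mathrm{low}}}\Big)+\frac{2\|\mathcal F\|_\infty}{\lambda_{\mathrm{low}}}\sqrt{2\log\frac2\delta},\qquad \beta=\frac{96\,\mathcal I_{\mathcal F}}{\lambda_{\mathrm{low}}}+\frac{4\|\mathcal F\|_\infty}{\lambda_{\mathrm{low}}}\sqrt{2\log\frac4\delta},$$ the following two statements hold: (a) if $n>\frac{16(\alpha+\beta)^2}{\rho_{\mathrm{crit}}^2}$ and $\rho>\frac{\alpha}{\sqrt n}$, then with probability at least $1-\delta$, $\widehat R_\rho(g)\ge\mathbb E_{\xi\sim P}[g(\xi)]$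 for all $g\in\mathcal F$; (b) if $n>\frac{16\alpha^2}{\rho_{\mathrm{crit}}^2}$ and $0<\rho\le\frac{\rho_{\mathrm{crit}}}{4}-\frac{\alpha}{\sqrt n}$, then with probability at least $1-\delta$, $\widehat R_\rho(g)\le R_{\rho+\frac{\alpha}{\sqrt n}}(g)$ for all $g\in\mathcal F$; in particular, if every $g\in\mathcal F$ is $\mathrm{Lip}_{\mathcal F}$-Lipschitz on $\Xi$, then $\widehat R_\rho(g)\le\mathbb E_{\xi\sim P}[g(\xi)]+\mathrm{Lip}_{\mathcal F}\big(\rho+\frac{\alpha}{\sqrt n}\big)^{1/2}$ for all $g\in\mathcal F$.
   Context: Notation: $\|\mathcal F\|_\infty=\sup_{g\in\mathcal F}\sup_\Xi|g|$. $\mathcal I_{\mathcal F}=\int_0^\infty\sqrt{\log N(t,\mathcal F,\|\cdot\|_\infty)}\,dt$, where $N(t,\mathcal F,\|\cdot\|_\infty)$ is the $t$-packing number of $\mathcal F$ (maximal number of functions in $\mathcal F$ that are pairwise at sup-norm distance at least $t$). $\mathcal P(\Xi)$ is the set of Borel probability measures on $\Xi$. $W_c(Q,Q')=\inf\{\mathbb E_{(\xi,\zeta)\sim\pi}[c(\xi,\zeta)]:\pi\in\mathcal P(\Xi\times\Xi),[\pi]_1=Q,[\pi]_2=Q'\}$, with $[\pi]_i$ the marginals. For $\rho>0$, $R_{\rho,Q}(g)=\sup\{\mathbb E_{\xi\sim Q'}[g(\xi)]:Q'\in\mathcal P(\Xi),W_c(Q,Q')\le\rho\}$. With $\xi_1,\dots,\xi_n$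 i.i.d. from $P$ and $\widehat P_n=\frac1n\sum_{i=1}^n\delta_{\xi_i}$: $\widehat R_\rho=R_{\rho,\widehat P_n}$ and $R_\rho=R_{\rho,P}$. The critical radius is $\rho_{\mathrm{crit}}=\inf_{g\in\mathcal F}\mathbb E_{\xi\sim P}[\min\{c(\xi,\zeta):\zeta\in\operatorname{arg\,max}_\Xi g\}]$. *)

(* Defs.v *)
From HB Require Import structures.
From mathcomp Require Import all_boot all_order all_algebra.
From mathcomp Require Import all_classical all_reals all_analysis.

Set Implicit Arguments.
Unset Strict Implicit.
Unset Printing Implicit Defensive.

Import Order.TTheory GRing.Theory Num.Theory numFieldNormedType.Exports.

Local Open Scope classical_set_scope.
Local Open Scope ring_scope.
Local Open Scope ereal_scope.

(* Quantities that are suprema, infima or integrals are extended reals, so that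
   no junk value is introduced when their finiteness is not yet known. *)

Section FunctionFamilies.
Context {T : Type} {R : realType}.
Implicit Types (Xi : set T) (g : T -> R) (F : set (T -> R)).

Definition sup_norm Xi g : \bar R := ereal_sup [set `|g x|%:E | x in Xi].

Definition family_norm Xi F : \bar R := ereal_sup [set sup_norm Xi g | g in F].

(* For t > 0 the functions h i of a packing are automatically distinct on Xi. *)
Definition packing Xi F (t : R) (k : nat) (h : 'I_k -> T -> R) : Prop :=
  (forall i, F (h i)) /\
  (forall i j, i != j -> t%:E <= sup_norm Xi (h i \- h j)%R).

Definition packing_number Xi F (t : R) : \bar R :=
  ereal_sup [set k%:R%:E | k in [set k : nat |
    exists h : 'I_k -> T -> R, packing Xi F t h]].

Definition dudley_integral Xi F : \bar R :=
  \int[lebesgue_measure]_(t in `]0%R, +oo[) sqrte (lne (packing_number Xi F t)).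

Definition argmax_on Xi g : set T :=
  [set z | Xi z /\ forall x, Xi x -> (g x <= g z)%R].

End FunctionFamilies.

Section EmpiricalMeasure.
Context {d : measure_display} {T : measurableType d} {R : realType}.
Variables (n : nat) (x : 'I_n -> T).

Definition empirical (A : set T) : \bar R :=
  (n%:R^-1)%:E * \sum_(i < n) \d_(x i) A.

Let empirical0 : empirical set0 = 0.
Proof. by rewrite /empirical big1 ?mule0// => i _; rewrite measure0. Qed.

Let empirical_ge0 A : 0 <= empirical A.
Proof.
by rewrite /empirical mule_ge0 ?lee_fin ?invr_ge0// sume_ge0// => i _.
Qed.

Let empirical_sigma_additive : semi_sigma_additive empirical.
Proof.
pose m (k : nat) : {measure set T -> \bar R} :=
  if insub k is Some i then \d_(x i) else mzero.
have n_ge0 : (0 <= n%:R^-1 :> R)%R by rewrite invr_ge0.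
have -> : empirical = mscale (NngNum n_ge0) (msum m n).
  apply/funext => A; rewrite /empirical /mscale /msum /=; congr (_ * _).
  by apply: eq_bigr => i _; rewrite /m valK.
exact: measure_semi_sigma_additive.
Qed.

HB.instance Definition _ := isMeasure.Build _ _ _ empirical
  empirical0 empirical_ge0 empirical_sigma_additive.

End EmpiricalMeasure.

Section DistributionalRobustness.
Context {d : measure_display} {T : measurableType d} {R : realType}.
Implicit Types (Xi : set T) (c : T -> T -> R) (g : T -> R).
Implicit Types (Q : {measure set T -> \bar R}).

(* T * T carries the product sigma-algebra, which for a second countable
   topology is the Borel sigma-algebra of the product. *)
Definition coupling Q Q' (pi : probability (T * T)%type R) : Prop :=
  forall A, measurable A ->
    pi (fst @^-1` A) = Q A /\ pi (snd @^-1` A) = Q' A.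

(* A coupling of two measures carried by Xi is carried by Xi `*` Xi, so the
   couplings need not be restricted to Xi explicitly. *)
Definition transport_cost c Q Q' : \bar R :=
  ereal_inf [set \int[pi]_z (c z.1 z.2)%:E | pi in
    [set pi : probability (T * T)%type R | coupling Q Q' pi]].

(* The probability measures on Xi are those on T giving mass 1 to Xi. *)
Definition robust_risk Xi c (rho : \bar R) Q g : \bar R :=
  ereal_sup ((fun Q' : probability T R => 'E_Q'[g]) @`
    [set Q' : probability T R | Q' Xi = 1 /\ transport_cost c Q Q' <= rho]).

(* The inner infimum is a minimum when argmax_on Xi g is compact and nonempty
   and c is continuous. *)
Definition critical_radius Xi c (F : set (T -> R)) (P : probability T R) :
    \bar R :=
  ereal_inf [set \int[P]_x ereal_inf [set (c x z)%:E | z in argmax_on Xi g]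
            | g in F].

End DistributionalRobustness.

Section Sampling.
Context {d d' : measure_display} {T : measurableType d}
  {Omega : measurableType d'} {R : realType}.

Definition iid_sample (Pr : probability Omega R) (P : probability T R)
    (n : nat) (X : 'I_n -> {RV Pr >-> T}) : Prop :=
  (forall i A, measurable A -> distribution Pr (X i) A = P A) /\
  (forall (J : {set 'I_n}) (A : 'I_n -> set T),
    (forall i, measurable (A i)) ->
    Pr (\bigcap_(i in [set` J]) (X i @^-1` A i)) =
    \prod_(i in J) Pr (X i @^-1` A i)).

(* Inner probability: E is an event over an uncountable family of functions,
   whose measurability is not assumed. *)
Definition with_probability_at_least (Pr : probability Omega R) (q : R)
    (E : set Omega) : Prop :=
  exists A : set Omega, [/\ measurable A, A `<=` E & q%:E <= Pr A].

End Sampling.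

Section LinearRegression.
Context (R : realType) (p : nat).
Local Open Scope ring_scope.

Definition borel_data := g_sigma_algebraType (@open ('rV[R]_p * R)%type).

Definition dotv (u v : 'rV[R]_p) : R := \sum_(i < p) u 0 i * v 0 i.

(* The canonical norm of the library on 'rV[R]_p * R is the maximum norm; it
   induces the same topology as this one. *)
Definition enorm (xi : 'rV[R]_p * R) : R :=
  Num.sqrt (dotv xi.1 xi.1 + xi.2 ^+ 2).

Definition eball_diam (delta : R) : set ('rV[R]_p * R) :=
  [set xi | enorm xi <= delta / 2].

Definition sq_cost (xi zeta : 'rV[R]_p * R) : R := enorm (xi - zeta) ^+ 2.

Definition sq_loss (theta : 'rV[R]_p) (xi : 'rV[R]_p * R) : R :=
  (dotv theta xi.1 - xi.2) ^+ 2.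

Definition elipschitz_on (Xi : set ('rV[R]_p * R)) (L : R)
    (g : 'rV[R]_p * R -> R) : Prop :=
  forall xi zeta, Xi xi -> Xi zeta -> `|g xi - g zeta| <= L * enorm (xi - zeta).

Definition support_of (P : probability borel_data R) : set ('rV[R]_p * R) :=
  [set xi | forall U : set ('rV[R]_p * R), open_nbhs xi U -> (0 < P U)%E].

End LinearRegression.

(* Main.v *)
Require Import Defs.
From HB Require Import structures.
From mathcomp Require Import all_boot all_order all_algebra.
From mathcomp Require Import all_classical all_reals all_analysis.
From mathcomp Require Import measurable_realfun ring lra.
Set Implicit Arguments.
Unset Strict Implicit.
Unset Printing Implicit Defensive.
Import Order.TTheory GRing.Theory Num.Theory numFieldNormedType.Exports.
Local Open Scope classical_set_scope.
Local Open Scope ring_scope.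

(** Write [v = (theta, -1)] and [u = v / |v|]: every loss is [|v|^2 <u, .>^2].
    With [lambda_low = omega / 2] and [L = sqrt (2 ln (2 / delta))], the bound
    [normF / lambda_low >= 9/2 D^2] gives [alpha >= D^2 (432 + 9 L)], and the
    uniform deviations needed below are at most [D^2 (431 + 9 L) / sqrt n] with
    no dependence on the dimension, so that the entropy integral only matters
    through its sign.

    Lower bound: when the empirical second moments along all [u] miss those of
    [P] by at most [alpha / sqrt n], moving each sample point by
    [sqrt (alpha / sqrt n)] along [u] or [- u] costs [alpha / sqrt n] and raises
    the second moment along [u] by at least as much.

    Upper bound: the value of the transport problem for [P] is concave in the
    radius; let [l] be a supergradient at [rho + alpha / sqrt n]. For the
    multiplier 1 there are optimal plans into the sphere of radius [3 D / 2], of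
    cost at least [D^2 > rho + alpha / sqrt n], hence [l >= 1]. Weak duality with
    the multiplier [l] for the empirical measure, together with a uniform
    deviation bound for the dual functions [lagr_sup (1 / l) u], concludes.

    Deviations: [P] is discretized on finitely many small cells; symmetrization
    and contraction replace the dual functions by linear features in a Euclidean
    space, whose random sums are controlled by the potential
    [exp (|z|^2 / (2 U))], with [U] decreasing at each step. *)

(** * Exponential inequalities *)

(** Why [l >= 1] matters. Up to discretization, the empirical value at radius [rho] is at most
    [l rho] plus [l] times the sample mean of [lagr_sup (1 / l) u], and the value for [P] at radius
    [rho + alpha / sqrt n] is at least [l (rho + alpha / sqrt n)] plus [l] times the mean under [P].
    The factor [l] cancels, so a deviation of [alpha / sqrt n] is affordable however large [l] is,
    and [1 / l] in [[0, 1]] keeps the dual functions in one bounded family. Since [l] varies with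
    the loss, the deviation bound has to be uniform in [1 / l] as well as in [u].

    Discretization is what makes the good event measurable: it depends only on the tuple of cells
    hit by the sample, whereas the family of dual functions is uncountable. The dimension stays out
    because a dual function varies with [u] only through the scalar [<u, x>]; linear functionals of
    bounded norm take the place of a covering of the sphere. *)

Section ExpInequalities.
Context {R : realType}.
Implicit Types x y : R.

Lemma is_derive_le0_le (f df : R -> R) x :
  (forall y, is_derive y 1 f (df y)) -> (forall y, 0 <= y -> df y <= 0) ->
  0 <= x -> f x <= f 0.
Proof.
move=> fdf df0 x0.
have cf : {within `[0, x], continuous f}.
  apply: continuous_subspaceT => y.
  by apply/differentiable_continuous/derivable1_diffP; have [] := fdf y.
have [c] := MVT_segment x0 (fun y _ => fdf y) cf.
rewrite in_itv /= => /andP[c0 _] fE.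
by rewrite -subr_le0 fE subr0 mulr_le0_ge0 // df0.
Qed.

(** The quotient of [cosh x] by [exp (x^2 / 2)] decreases on the half line: its derivative has the
    sign of [sinh x - x cosh x], which starts at 0 and has derivative [- x sinh x]. *)
Lemma cosh_le_expR_sqr x : expR x + expR (- x) <= 2 * expR (x ^+ 2 / 2).
Proof.
wlog x0 : x / 0 <= x => [hw|].
  have [/hw //|/ltW x0] := leP 0 x.
  by rewrite -sqrrN addrC -{2}(opprK x) hw // oppr_ge0.
have sinh0 y : 0 <= y -> 0 <= expR y - expR (- y).
  by move=> y0; rewrite subr_ge0 ler_expR; lra.
have mle0 y : 0 <= y ->
    expR y - expR (- y) - y * (expR y + expR (- y)) <= 0.
  move=> y0.
  have -> : 0 = expR 0 - expR (- 0) - 0 * (expR 0 + expR (- 0)) :> R.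
    by rewrite oppr0; ring.
  apply: (@is_derive_le0_le (fun y => expR y - expR (- y) - y * (expR y + expR (- y)))
     (fun y => - (y * (expR y - expR (- y))))) => // z.
    by apply: is_derive_eq; rewrite /GRing.scale /=; ring.
  by move=> z0; rewrite oppr_le0 mulr_ge0 // sinh0.
have := @is_derive_le0_le (fun y => (expR y + expR (- y)) * expR (- (y * y / 2)))
  (fun y => expR (- (y * y / 2)) * (expR y - expR (- y) - y * (expR y + expR (- y)))) x.
rewrite oppr0 mul0r mul0r oppr0 expR0 mulr1 => h.
have : (expR x + expR (- x)) * expR (- (x * x / 2)) <= 1 + 1.
  apply: h => //.
  - by move=> y; apply: is_derive_eq; rewrite /GRing.scale /=; field.
  - by move=> y y0; rewrite mulr_ge0_le0 ?expR_ge0 // mle0.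
by rewrite (expRN (x * x / 2)) ler_pdivrMr ?expR_gt0 // expr2.
Qed.

Lemma expR_tangent x y : expR y * (1 + (x - y)) <= expR x.
Proof.
rewrite -[leRHS](_ : expR y * expR (x - y) = _); last by rewrite -expRD; congr expR; ring.
by rewrite ler_pM2l ?expR_gt0 // expR_ge1Dx.
Qed.

(** Jensen's inequality, by averaging the tangent bound at the mean [zbar]. *)
Lemma expR_weighted_sum (I : finType) (q z : I -> R) :
  (forall i, 0 <= q i) -> \sum_i q i = 1 ->
  expR (\sum_i q i * z i) <= \sum_i q i * expR (z i).
Proof.
move=> q0 q1; set zbar := \sum_i _.
apply: (@le_trans _ _ (\sum_i q i * (expR zbar * (1 + (z i - zbar))))); last first.
  by apply: ler_sum => i _; rewrite ler_wpM2l // expR_tangent.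
have -> : \sum_i q i * (expR zbar * (1 + (z i - zbar))) =
    expR zbar * (1 - zbar) * (\sum_i q i) + expR zbar * zbar.
  rewrite /zbar !mulr_sumr -big_split /=; apply: eq_bigr => i _.
  by rewrite -/zbar; ring.
by rewrite q1 le_eqVlt; apply/orP; left; apply/eqP; ring.
Qed.

(* Weak majorization of [(x, y)] by an average of pairs, for the convex
   increasing function [expR]. *)
Lemma expR_majorization (I : finType) (q u v : I -> R) x y :
  (forall i, 0 <= q i) -> \sum_i q i = 1 ->
  x + y <= \sum_i q i * (u i + v i) ->
  x <= \sum_i q i * Num.max (u i) (v i) ->
  y <= \sum_i q i * Num.max (u i) (v i) ->
  expR x + expR y <= \sum_i q i * (expR (u i) + expR (v i)).
Proof.
move=> q0 q1.
wlog yx : x y / y <= x => [hw|].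
  have [/hw //|/ltW /hw h] := leP y x.
  by rewrite [x + y]addrC [expR x + _]addrC => ? ? ?; exact: h.
move=> hsum hx _.
set ux := \sum_i q i * Num.max (u i) (v i) in hx.
set s := \sum_i q i * (u i + v i) in hsum.
(* Tangents at [x] for the maxima and at [y] for the minima. What remains is the Abel sum [(exp x -
   exp y) (ux - x) + exp y (s - x - y)], nonnegative because [y <= x]. *)
apply: (@le_trans _ _ (\sum_i q i *
   (expR x * (1 + (Num.max (u i) (v i) - x)) +
    expR y * (1 + (Num.min (u i) (v i) - y))))); last first.
  apply: ler_sum => i _; rewrite ler_wpM2l //.
  have -> : expR (u i) + expR (v i) =
     expR (Num.max (u i) (v i)) + expR (Num.min (u i) (v i)).
    by case: (leP (u i) (v i)) => _ //; rewrite addrC.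
  by rewrite lerD // expR_tangent.
have -> : \sum_i q i * (expR x * (1 + (Num.max (u i) (v i) - x)) +
    expR y * (1 + (Num.min (u i) (v i) - y))) =
   (expR x * (1 - x) + expR y * (1 - y)) * (\sum_i q i) + expR x * ux + expR y * (s - ux).
  rewrite /ux /s mulr_sumr -sumrB !mulr_sumr -!big_split /=; apply: eq_bigr => i _.
  have -> : u i + v i = Num.max (u i) (v i) + Num.min (u i) (v i).
    by rewrite addr_max_min.
  by ring.
rewrite q1.
have exy : expR y <= expR x by rewrite ler_expR.
have := expR_gt0 y; move: exy hx hsum.
set a := expR x; set b := expR y => ab hx hs b0.
suff : 0 <= (a - b) * (ux - x) + b * (s - x - y) by lra.
by rewrite addr_ge0 // mulr_ge0 //; lra.
Qed.

End ExpInequalities.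

(** * Contraction and symmetrization *)

Section Contraction.
Context {R : realType} {K : finType} (k0 : K).
Implicit Types (A B : K -> R).

(** The index type is finite, inhabited by [k0], so that the maximum is attained; [iid_tail] reduces
    an arbitrary family to this case. *)
Definition finsup A : R := A [arg max_(k > k0) A k]%O.

Lemma finsup_ge A k : A k <= finsup A.
Proof. by rewrite /finsup; case: arg_maxP => // i _; exact. Qed.

Lemma finsup_attained A : exists k, finsup A = A k.
Proof. by exists [arg max_(k > k0) A k]%O. Qed.

(* Ledoux-Talagrand contraction: a symmetrized increment [D] is dominated by
   an average of symmetrized features. *)
Lemma expR_finsup_contraction (I : finType) (q : I -> R) A D (l : I -> K -> R) :
  (forall i, 0 <= q i) -> \sum_i q i = 1 ->
  (forall a, `|D a| <= \sum_i q i * `|l i a|) ->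
  (forall a b, `|D a - D b| <= \sum_i q i * `|l i a - l i b|) ->
  expR (finsup (A \+ D)) + expR (finsup (A \- D)) <=
  \sum_i q i * (expR (finsup (A \+ l i)) + expR (finsup (A \- l i))).
Proof.
move=> q0 q1 D1 D2.
have [a ->] := finsup_attained (A \+ D); have [b ->] := finsup_attained (A \- D).
have sum_const c : c = \sum_i q i * c by rewrite -mulr_suml q1 mul1r.
apply: expR_majorization => //=.
- apply: (@le_trans _ _ (\sum_i q i * (A a + A b + `|l i a - l i b|))).
    have := D2 a b; rewrite ler_norml => /andP[_].
    have -> : \sum_i q i * (A a + A b + `|l i a - l i b|) =
       A a + A b + \sum_i q i * `|l i a - l i b|.
      rewrite [X in _ = X + _]sum_const -big_split /=.
      by apply: eq_bigr => i _; rewrite mulrDr.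
    by lra.
  apply: ler_sum => i _; rewrite ler_wpM2l //.
  have := finsup_ge (A \+ l i) a; have := finsup_ge (A \- l i) b.
  have := finsup_ge (A \+ l i) b; have := finsup_ge (A \- l i) a.
  by move=> /= *; case: ler0P => _; lra.
- have := D1 a; rewrite ler_norml => /andP[_ h].
  apply: (@le_trans _ _ (A a + \sum_i q i * `|l i a|)); first by rewrite lerD2l.
  rewrite [X in X + _]sum_const -big_split /=; apply: ler_sum => i _.
  rewrite -mulrDr ler_wpM2l // le_max; have := finsup_ge (A \+ l i) a.
  have /= := finsup_ge (A \- l i) a.
  by case: ler0P => _ /= ? ?; apply/orP; [right|left]; lra.
- have := D1 b; rewrite ler_norml => /andP[h _].
  apply: (@le_trans _ _ (A b + \sum_i q i * `|l i b|)); first by rewrite lerD2l; lra.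
  rewrite [X in X + _]sum_const -big_split /=; apply: ler_sum => i _.
  rewrite -mulrDr ler_wpM2l // le_max; have := finsup_ge (A \+ l i) b.
  have /= := finsup_ge (A \- l i) b.
  by case: ler0P => _ /= ? ?; apply/orP; [right|left]; lra.
Qed.

End Contraction.

Section Symmetrization.
Context {R : realType} {K J I : finType} (k0 : K).
Variables (p : J -> R) (q : I -> R).
Hypotheses (p_ge0 : forall j, 0 <= p j) (p_sum1 : \sum_j p j = 1).
Hypotheses (q_ge0 : forall i, 0 <= q i) (q_sum1 : \sum_i q i = 1).
Variables (f : K -> J -> R) (l : I -> J -> J -> K -> R).
Hypothesis f_le : forall j j' a,
  `|f a j - f a j'| <= \sum_i q i * `|l i j j' a|.
Hypothesis f_lip : forall j j' a b,
  `|(f a j - f a j') - (f b j - f b j')| <=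
  \sum_i q i * `|l i j j' a - l i j j' b|.

(** Jensen's inequality replaces the mean by an independent copy [j']. Exchanging [j] and [j'] flips
    the sign of [f a j - f a j'], so no random signs have to be adjoined, and the contraction
    applies pair by pair. [A] holds the contribution of the other draws. *)
Lemma expR_finsup_symmetrization (A : K -> R) :
  \sum_j p j * expR (finsup k0 (fun a => A a + (f a j - \sum_j' p j' * f a j'))) <=
  \sum_j \sum_j' p j * p j' * \sum_i q i *
    ((expR (finsup k0 (A \+ l i j j')) + expR (finsup k0 (A \- l i j j'))) / 2).
Proof.
pose D j j' a := f a j - f a j'.
apply: (@le_trans _ _ (\sum_j \sum_j' p j * p j' * expR (finsup k0 (A \+ D j j')))).
  apply: ler_sum => j _.
  under [leRHS]eq_bigr do rewrite -mulrA.
  rewrite -mulr_sumr ler_wpM2l //.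
  have [a ->] := finsup_attained k0 (fun a => A a + (f a j - \sum_j' p j' * f a j')).
  have -> : A a + (f a j - \sum_j' p j' * f a j') = \sum_j' p j' * (A a + D j j' a).
    have -> : A a + (f a j - \sum_j' p j' * f a j') =
       (A a + f a j) * (\sum_j' p j') - \sum_j' p j' * f a j' by rewrite p_sum1; ring.
    rewrite mulr_sumr -sumrB; apply: eq_bigr => j' _; rewrite /D; ring.
  apply: le_trans (expR_weighted_sum _ p_ge0 p_sum1) _.
  apply: ler_sum => j' _; rewrite ler_wpM2l // ler_expR.
  exact: (finsup_ge k0 (A \+ D j j')).
have -> : \sum_j \sum_j' p j * p j' * expR (finsup k0 (A \+ D j j')) =
   \sum_j \sum_j' p j * p j' *
     ((expR (finsup k0 (A \+ D j j')) + expR (finsup k0 (A \- D j j'))) / 2).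
  have sw : \sum_j \sum_j' p j * p j' * expR (finsup k0 (A \+ D j j')) =
     \sum_j \sum_j' p j * p j' * expR (finsup k0 (A \- D j j')).
    rewrite exchange_big /=; apply: eq_bigr => j _; apply: eq_bigr => j' _.
    rewrite [p j' * _]mulrC; congr (_ * expR (finsup _ _)).
    by apply/funext => a; rewrite /= /D; ring.
  transitivity ((\sum_j \sum_j' p j * p j' * expR (finsup k0 (A \+ D j j')) +
     \sum_j \sum_j' p j * p j' * expR (finsup k0 (A \- D j j'))) / 2).
    by rewrite -sw; field.
  rewrite -big_split mulr_suml; apply: eq_bigr => j _.
  rewrite -big_split mulr_suml; apply: eq_bigr => j' _ /=; ring.
apply: ler_sum => j _; apply: ler_sum => j' _.
rewrite ler_wpM2l ?mulr_ge0 //.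
under [leRHS]eq_bigr do rewrite mulrA.
rewrite -mulr_suml ler_wpM2r ?invr_ge0 //.
by apply: expR_finsup_contraction => //; [exact: f_le|exact: f_lip].
Qed.

End Symmetrization.

(** * Concentration for finite i.i.d. samples *)

Section IteratedExpectation.
Context {R : realType} {J : finType}.
Variable p : J -> R.
Hypotheses (p_ge0 : forall j, 0 <= p j) (p_sum1 : \sum_j p j = 1).

(** Expectation over [n] independent draws from [p], as nested sums so that an induction can peel
    off one draw. *)
Fixpoint iid_expectation (n : nat) (G : seq J -> R) : R :=
  if n is m.+1 then \sum_j p j * iid_expectation m (fun s => G (j :: s)) else G [::].

Lemma ler_iid_expectation n G H : (forall s, G s <= H s) ->
  iid_expectation n G <= iid_expectation n H.
Proof.
elim: n G H => [|n IH] G H GH //=.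
by apply: ler_sum => j _; rewrite ler_wpM2l // IH.
Qed.

Lemma iid_expectation_sum n (I : finType) (c : I -> R) (G : I -> seq J -> R) :
  iid_expectation n (fun s => \sum_i c i * G i s) =
  \sum_i c i * iid_expectation n (G i).
Proof.
elim: n G => [|n IH] G //=.
under eq_bigr do rewrite IH mulr_sumr.
rewrite exchange_big /=; apply: eq_bigr => i _; rewrite mulr_sumr.
by apply: eq_bigr => j _; ring.
Qed.

Lemma iid_expectation_cst n c : iid_expectation n (fun=> c) = c.
Proof. by elim: n => //= n ->; rewrite -mulr_suml p_sum1 mul1r. Qed.

Lemma iid_expectation_tuple n (G : seq J -> R) :
  iid_expectation n G = \sum_(t : n.-tuple J) (\prod_(i < n) p (tnth t i)) * G t.
Proof.
elim: n G => [|n IH] G /=.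
  rewrite (big_pred1 [tuple]) => [|t]; last by apply/esym/eqP; exact: tuple0.
  by rewrite big_ord0 mul1r.
rewrite (reindex (fun x : J * n.-tuple J => [tuple of x.1 :: x.2])); last first.
  exists (fun t => (thead t, [tuple of behead t])) => [[j t] _ /=|t _].
    by congr pair; apply: val_inj.
  by rewrite [RHS]tuple_eta.
rewrite -(pair_bigA _ (fun j (t : n.-tuple J) =>
  \prod_(i < n.+1) p (tnth [tuple of j :: t] i) * G (j :: t))) /=.
apply: eq_bigr => j _; rewrite IH mulr_sumr; apply: eq_bigr => t _.
rewrite big_ord_recl tnth0 mulrA; congr (_ * _ * _).
by apply: eq_bigr => i _; rewrite tnthS.
Qed.

End IteratedExpectation.

Section Concentration.
Context {R : realType} {K J I : finType} (k0 : K) {E : zmodType}.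
Variables (p : J -> R) (q : I -> R).
Hypotheses (p_ge0 : forall j, 0 <= p j) (p_sum1 : \sum_j p j = 1).
Hypotheses (q_ge0 : forall i, 0 <= q i) (q_sum1 : \sum_i q i = 1).
Variable dot : E -> E -> R.
Hypotheses (dotC : forall x y, dot x y = dot y x)
  (dotDr : forall x y z, dot x (y + z) = dot x y + dot x z)
  (dot_ge0 : forall x, 0 <= dot x x)
  (dot_cauchy : forall x y, dot x y ^+ 2 <= dot x x * dot y y).
Variables (f : K -> J -> R) (w : K -> E) (y : I -> J -> J -> E) (beta b : R).
Hypotheses (w_le : forall a, dot (w a) (w a) <= beta)
  (y_le : forall i j j', dot (y i j j') (y i j j') <= b) (b_gt0 : 0 < b).
Hypothesis f_le : forall j j' a,
  `|f a j - f a j'| <= \sum_i q i * `|dot (w a) (y i j j')|.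
Hypothesis f_lip : forall j j' a a',
  `|(f a j - f a j') - (f a' j - f a' j')| <=
  \sum_i q i * `|dot (w a) (y i j j') - dot (w a') (y i j j')|.

Let mean (a : K) := \sum_j p j * f a j.

Let dot0r x : dot x 0 = 0.
Proof. by have := dotDr x 0 0; rewrite addr0; lra. Qed.

Let dotNr x z : dot x (- z) = - dot x z.
Proof. by have := dotDr x z (- z); rewrite subrr dot0r; lra. Qed.

Let dotD x z : dot (x + z) (x + z) = dot x x + 2 * dot x z + dot z z.
Proof. by rewrite dotDr ![dot (x + z) _]dotC !dotDr [dot z x]dotC; ring. Qed.

Let amgm (c d x : R) : 0 <= c -> 0 <= d -> x ^+ 2 <= c * d -> x <= (c + d) / 2.
Proof.
move=> c0 d0 xcd; rewrite leNgt; apply/negP => h.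
have : (c + d) ^+ 2 < (2 * x) ^+ 2 by rewrite ltr_pXn2r ?nnegrE //; lra.
by have := sqr_ge0 (c - d); rewrite !expr2 in xcd *; lra.
Qed.

(* One step of the potential [exp (|z|^2 / (2 U))]: a symmetric increment of
   squared norm at most [b] is paid for by lowering [U + b] to [U]. *)
Lemma expR_gaussian_average (U : R) (z e : E) : 0 < U -> dot e e <= b ->
  (expR (dot (z + e) (z + e) / (2 * (U + b))) +
   expR (dot (z - e) (z - e) / (2 * (U + b)))) / 2 <=
  expR (b / (2 * U) + dot z z / (2 * U)).
Proof.
move=> U0 eb.
set V := U + b; have V0 : 0 < V by rewrite addr_gt0.
have V20 : 0 < 2 * V by rewrite mulr_gt0.
rewrite !dotD !dotNr [dot (- e) _]dotC dotNr opprK.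
set S := dot z z; set c := dot z e; set N := dot e e.
have -> : (S + 2 * c + N) / (2 * V) = (S + N) / (2 * V) + c / V by field; rewrite gt_eqF.
have -> : (S + 2 * - c + N) / (2 * V) = (S + N) / (2 * V) + - (c / V) by field; rewrite gt_eqF.
rewrite !expRD -mulrDr -mulrA.
(* The average over the two signs is a hyperbolic cosine. Cauchy-Schwarz bounds [c^2] by [S b], and
   the gain [S b / (2 U V)] from lowering [V] to [U] absorbs [S b / (2 V^2)]. *)
apply: (@le_trans _ _ (expR ((S + N) / (2 * V)) * expR ((c / V) ^+ 2 / 2))).
  rewrite ler_pM2l ?expR_gt0 // ler_pdivrMr // [_ * 2]mulrC.
  exact: cosh_le_expR_sqr.
rewrite -!expRD ler_expR.
have c2 : c ^+ 2 <= S * b.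
  by apply: (le_trans (dot_cauchy z e)); rewrite ler_wpM2l.
have S0 : 0 <= S by exact: dot_ge0.
apply: (@le_trans _ _ ((S + b) / (2 * V) + S * b / V ^+ 2 / 2)).
  apply: lerD; first by rewrite ler_pM2r ?invr_gt0 // lerD2l.
  by rewrite ler_pM2r ?invr_gt0 // exprMn exprVn ler_pM2r // invr_gt0 exprn_gt0.
rewrite -subr_ge0.
have -> : b / (2 * U) + S / (2 * U) - ((S + b) / (2 * V) + S * b / V ^+ 2 / 2) =
  (b * V * b + S * b ^+ 2) / (2 * U * V ^+ 2).
  rewrite /V; field; rewrite -/V; apply/andP; split; rewrite gt_eqF //.
by rewrite divr_ge0 ?mulr_ge0 ?addr_ge0 ?mulr_ge0 ?sqr_ge0 // ltW // ?exprn_gt0.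
Qed.

(** Induction on the number of draws, for all [U] and [z]: a draw moves [z] by plus or minus a
    feature and raises [U] by [b]. With no draw left, Young's inequality bounds [dot (w a) z] by
    [beta U / 2 + |z|^2 / (2 U)] uniformly in [a]. Every [U] met is at least [U0], so each draw
    costs at most [b / (2 U0)]. *)
Lemma iid_expectation_expR_finsup n (U0 U : R) (z : E) :
  0 < U0 -> U0 <= U ->
  iid_expectation p n (fun s => expR (finsup k0 (fun a =>
    \sum_(j <- s) (f a j - mean a) + dot (w a) z))) <=
  expR (beta * (U + n%:R * b) / 2 + n%:R * b / (2 * U0) + dot z z / (2 * U)).
Proof.
move=> U00; elim: n U z => [|n IH] U z U0U.
  have U_gt0 : 0 < U by exact: lt_le_trans U0U.
  rewrite /= ler_expR; set F := fun a => _.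
  have [a ->] := finsup_attained k0 F; rewrite /F big_nil add0r !mul0r !addr0.
  have -> : beta * U / 2 + dot z z / (2 * U) = (beta * U + dot z z / U) / 2.
    by field; rewrite gt_eqF.
  apply: amgm; first by rewrite mulr_ge0 ?(le_trans _ (w_le a)) // ltW.
    by rewrite divr_ge0 // ltW.
  have -> : beta * U * (dot z z / U) = beta * dot z z by field; rewrite gt_eqF.
  by apply: (le_trans (dot_cauchy _ _)); rewrite ler_wpM2r.
have U_gt0 : 0 < U by exact: lt_le_trans U0U.
rewrite [iid_expectation _ _ _]/=.
pose A s a := \sum_(j <- s) (f a j - mean a) + dot (w a) z.
pose W a i j j' := dot (w a) (y i j j').
apply: (@le_trans _ _ (iid_expectation p n (fun s =>
  \sum_j p j * expR (finsup k0 (fun a => A s a + (f a j - mean a)))))).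
  rewrite (iid_expectation_sum p n p) le_eqVlt; apply/orP; left; apply/eqP.
  apply: eq_bigr => j _; congr (_ * iid_expectation _ _ _).
  apply/funext => s; congr (expR (finsup _ _)); apply/funext => a.
  by rewrite big_cons /A; ring.
pose G i j j' s := (expR (finsup k0 (A s \+ (fun a => W a i j j'))) +
   expR (finsup k0 (A s \- (fun a => W a i j j')))) / 2.
apply: (@le_trans _ _ (iid_expectation p n (fun s =>
  \sum_j p j * (\sum_j' p j' * (\sum_i q i * G i j j' s))))).
  apply: ler_iid_expectation => // s.
  apply: le_trans (expR_finsup_symmetrization (l := fun i j j' a => W a i j j') k0
    p_ge0 p_sum1 q_ge0 q_sum1 f_le f_lip _) _.
  rewrite le_eqVlt; apply/orP; left; apply/eqP.
  apply: eq_bigr => j _; rewrite mulr_sumr; apply: eq_bigr => j' _.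
  by rewrite mulrA.
set c := expR _.
rewrite iid_expectation_sum -[leRHS]mul1r -p_sum1 mulr_suml.
apply: ler_sum => j _; rewrite ler_wpM2l //.
rewrite iid_expectation_sum -[leRHS]mul1r -p_sum1 mulr_suml.
apply: ler_sum => j' _; rewrite ler_wpM2l //.
rewrite iid_expectation_sum -[leRHS]mul1r -q_sum1 mulr_suml.
apply: ler_sum => i _; rewrite ler_wpM2l //.
(* The signed feature enters through its product with [w a], so it can be absorbed into [z], and the
   induction hypothesis applies. *)
pose G' (e : bool) s := expR (finsup k0 (fun a =>
  \sum_(j <- s) (f a j - mean a) + dot (w a) (z + (if e then y i j j' else - y i j j')))).
have -> : G i j j' = (fun s => \sum_(e : bool) 2^-1 * G' e s).
  apply/funext => s; transitivity ((G' true s + G' false s) / 2).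
    2: by rewrite big_bool /=; ring.
  rewrite /G /G'; congr (_ * _); congr (_ + _); congr (expR (finsup k0 _)).
    by apply/funext => a /=; rewrite dotDr /A /W addrA.
  by apply/funext => a /=; rewrite dotDr dotNr /A /W addrA.
rewrite (iid_expectation_sum p n (fun=> 2^-1)) big_bool /= -mulrDr.
have U0' : U0 <= U + b by rewrite (le_trans U0U) // lerDl ltW.
have h1 : iid_expectation p n (G' true) <= _ := IH (U + b) (z + y i j j') U0'.
have h2 : iid_expectation p n (G' false) <= _ := IH (U + b) (z - y i j j') U0'.
rewrite expRD in h1; rewrite expRD in h2.
have h3 := expR_gaussian_average z U_gt0 (y_le i j j').
set P := expR _ in h1 h2.
have hc : P * expR (b / (2 * U) + dot z z / (2 * U)) <= c.
  rewrite /c -expRD ler_expR -(natr1 n).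
  have : b / (2 * U) <= b / (2 * U0).
    by rewrite ler_pM2l // lef_pV2 ?posrE ?mulr_gt0 // ler_pM2l.
  by lra.
have : P * ((expR (dot (z + y i j j') (z + y i j j') / (2 * (U + b))) +
   expR (dot (z - y i j j') (z - y i j j') / (2 * (U + b)))) / 2) <=
   P * expR (b / (2 * U) + dot z z / (2 * U)) by rewrite ler_pM2l ?expR_gt0.
by move: h1 h2 hc; rewrite -/P; lra.
Qed.

End Concentration.

Section TailBound.
Context {R : realType} {H : Type} {J I : finType} {E : lmodType R}.
Variables (p : J -> R) (q : I -> R).
Hypotheses (p_ge0 : forall j, 0 <= p j) (p_sum1 : \sum_j p j = 1).
Hypotheses (q_ge0 : forall i, 0 <= q i) (q_sum1 : \sum_i q i = 1).
Variable dot : E -> E -> R.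
Hypotheses (dotC : forall x y, dot x y = dot y x)
  (dotDr : forall x y z, dot x (y + z) = dot x y + dot x z)
  (dotZr : forall c x y, dot x (c *: y) = c * dot x y)
  (dot_ge0 : forall x, 0 <= dot x x)
  (dot_cauchy : forall x y, dot x y ^+ 2 <= dot x x * dot y y).
Variables (f : H -> J -> R) (w : H -> E) (y : I -> J -> J -> E) (B b : R).
Hypotheses (w_le : forall a, dot (w a) (w a) <= B)
  (y_le : forall i j j', dot (y i j j') (y i j j') <= b) (b_gt0 : 0 < b).
Hypothesis f_le : forall j j' a,
  `|f a j - f a j'| <= \sum_i q i * `|dot (w a) (y i j j')|.
Hypothesis f_lip : forall j j' a a',
  `|(f a j - f a j') - (f a' j - f a' j')| <=
  \sum_i q i * `|dot (w a) (y i j j') - dot (w a') (y i j j')|.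

(** Chernoff's bound with parameter [s], applied to [s f] and [s w]. Choosing one violating index
    [sel t] for each bad tuple [t] turns an arbitrary index type into the finite type of tuples: on
    a bad [t] the maximum already exceeds [s c] at the index [t] itself, weakly if [s = 0]. *)
Lemma iid_tail (n : nat) (c U s : R) : 0 < U -> 0 <= s ->
  \sum_(t : n.-tuple J |
     `[< exists a, c < \sum_(j <- t) (f a j - \sum_j' p j' * f a j') >])
     \prod_(i < n) p (tnth t i) <=
  expR (s ^+ 2 * B * (U + n%:R * b) / 2 + n%:R * b / (2 * U) - s * c).
Proof.
move=> U0 s0.
pose bad (t : n.-tuple J) :=
  `[< exists a, c < \sum_(j <- t) (f a j - \sum_j' p j' * f a j') >].
rewrite -[leLHS]/(\sum_(t | bad t) _).
have [t0 bad0|nobad] := pickP bad; last by rewrite big_pred0 // expR_ge0.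
have [a0 _] : exists a, c < \sum_(j <- t0) (f a j - \sum_j' p j' * f a j').
  by move: bad0; rewrite /bad => /asboolP.
have /choice[sel selP] : forall t : n.-tuple J, exists a, bad t ->
    c < \sum_(j <- t) (f a j - \sum_j' p j' * f a j').
  move=> t; case bt: (bad t); last by exists a0.
  by move: bt; rewrite /bad => /asboolP[a ha]; exists a.
pose f' (k : n.-tuple J) j := s * f (sel k) j.
pose w' k := s *: w (sel k).
have dotZl d x z : dot (d *: x) z = d * dot x z by rewrite dotC dotZr dotC.
have normM (x : R) : `|s * x| = s * `|x| by rewrite normrM ger0_norm.
have main := @iid_expectation_expR_finsup R _ _ _ t0 E p q p_ge0 p_sum1 q_ge0
  q_sum1 dot dotC dotDr dot_ge0 dot_cauchy f' w' y (s ^+ 2 * B) b.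
have {main} : iid_expectation p n (fun u => expR (finsup t0 (fun k =>
    \sum_(j <- u) (f' k j - \sum_j p j * f' k j) + dot (w' k) 0))) <=
  expR (s ^+ 2 * B * (U + n%:R * b) / 2 + n%:R * b / (2 * U) + dot 0 0 / (2 * U)).
  apply: main => //.
  - move=> k; rewrite dotZl dotZr mulrA -expr2 ler_wpM2l ?sqr_ge0 //.
  - move=> j j' k; rewrite /f' -mulrBr normM.
    apply: le_trans (ler_wpM2l s0 (f_le j j' (sel k))) _.
    rewrite mulr_sumr; apply: ler_sum => i _.
    by rewrite dotZl normM mulrCA.
  - move=> j j' k k'; rewrite /f' -!mulrBr normM.
    apply: le_trans (ler_wpM2l s0 (f_lip j j' (sel k) (sel k'))) _.
    rewrite mulr_sumr; apply: ler_sum => i _.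
    by rewrite !dotZl -mulrBr normM mulrCA.
have dot0 x : dot x 0 = 0 by rewrite -[0](scale0r (0 : E)) dotZr mul0r.
rewrite dot0 mul0r addr0 => main.
rewrite expRB ler_pdivlMr ?expR_gt0 // (le_trans _ main) //.
rewrite iid_expectation_tuple mulr_suml big_mkcond /=.
apply: ler_sum => t _; case: ifPn => [bt|_]; last first.
  by rewrite mulr_ge0 ?expR_ge0 // prodr_ge0.
rewrite ler_wpM2l ?prodr_ge0 // ler_expR.
set F := fun k => _.
apply: le_trans (finsup_ge t0 F t); rewrite /F dot0 addr0.
under eq_bigr => j _.
  rewrite /f' (_ : _ - _ = s * (f (sel t) j - \sum_j' p j' * f (sel t) j')); last first.
    by rewrite mulrBr mulr_sumr; congr (_ - _); apply: eq_bigr => j' _; rewrite mulrCA.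
  over.
by rewrite -mulr_sumr ler_wpM2l // ltW // selP.
Qed.

End TailBound.

(** * The Lagrangian in Euclidean space *)

(** The square of [x + c y] is a nonnegative quadratic in [c]. The form is only semidefinite, so a
    null [y] is treated apart. *)
Lemma psd_cauchy (R : realFieldType) (E : lmodType R) (dot : E -> E -> R) :
  (forall x y, dot x y = dot y x) ->
  (forall x y z, dot x (y + z) = dot x y + dot x z) ->
  (forall c x y, dot x (c *: y) = c * dot x y) ->
  (forall x, 0 <= dot x x) ->
  forall x y, dot x y ^+ 2 <= dot x x * dot y y.
Proof.
move=> dC dD dZ d0 x y.
have quad c : 0 <= dot x x + 2 * c * dot x y + c ^+ 2 * dot y y.
  have := d0 (x + c *: y).
  by rewrite dD dZ ![dot (x + _) _]dC !dD !dZ [dot y x]dC expr2; lra.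
have [y0|y_neq0] := eqVneq (dot y y) 0.
  have [->|xy0] := eqVneq (dot x y) 0; first by rewrite y0 expr0n mulr0.
  (* For a null [y] the quadratic is affine in [c], and this [c] gives it the value -1. *)
  have := quad (- (dot x x + 1) / (2 * dot x y)).
  rewrite y0 mulr0 addr0.
  have -> : dot x x + 2 * (- (dot x x + 1) / (2 * dot x y)) * dot x y = -1.
    by field.
  by rewrite oppr_ge0 ler10.
have y_gt0 : 0 < dot y y by rewrite lt_neqAle eq_sym y_neq0 d0.
have := quad (- (dot x y / dot y y)).
have -> : dot x x + 2 * - (dot x y / dot y y) * dot x y +
   (- (dot x y / dot y y)) ^+ 2 * dot y y = dot x x - dot x y ^+ 2 / dot y y by field.
by rewrite subr_ge0 ler_pdivrMr.
Qed.

Section EuclideanGeometry.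
Context {R : realType} {p : nat}.
Local Notation T := ('rV[R]_p * R)%type.
Implicit Types (x y z u : T) (a b c : R).

Definition dotp x y : R := dotv x.1 y.1 + x.2 * y.2.

Lemma dotpC x y : dotp x y = dotp y x.
Proof.
by rewrite /dotp mulrC; congr (_ + _); apply: eq_bigr => i _; rewrite mulrC.
Qed.

Lemma dotpDr x y z : dotp x (y + z) = dotp x y + dotp x z.
Proof.
rewrite /dotp /= mulrDr addrACA -big_split /=; congr (_ + _).
by apply: eq_bigr => i _; rewrite mxE mulrDr.
Qed.

Lemma dotpZr c x y : dotp x (c *: y) = c * dotp x y.
Proof.
rewrite /dotp /= mulrDr mulr_sumr /GRing.scale /= mulrCA; congr (_ + _).
by apply: eq_bigr => i _; rewrite mxE mulrCA.
Qed.

Lemma dotp_ge0 x : 0 <= dotp x x.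
Proof. by rewrite addr_ge0 ?sumr_ge0 // => [i _|]; rewrite -expr2 sqr_ge0. Qed.

Lemma dotpNr x y : dotp x (- y) = - dotp x y.
Proof. by rewrite -scaleN1r dotpZr mulN1r. Qed.

Lemma dotp0r x : dotp x 0 = 0.
Proof. by rewrite -(subrr x) dotpDr dotpNr subrr. Qed.

Lemma dotpBr x y z : dotp x (y - z) = dotp x y - dotp x z.
Proof. by rewrite dotpDr dotpNr. Qed.

Lemma dotpDl x y z : dotp (x + y) z = dotp x z + dotp y z.
Proof. by rewrite dotpC dotpDr !(dotpC z). Qed.

Lemma dotpNl x y : dotp (- x) y = - dotp x y.
Proof. by rewrite dotpC dotpNr dotpC. Qed.

Lemma dotpZl c x y : dotp (c *: x) y = c * dotp x y.
Proof. by rewrite dotpC dotpZr dotpC. Qed.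

Definition dotpE := (dotpDl, dotpDr, dotpNl, dotpNr, dotpZl, dotpZr).

Lemma dotp_cauchy x y : dotp x y ^+ 2 <= dotp x x * dotp y y.
Proof. exact: (psd_cauchy dotpC dotpDr dotpZr dotp_ge0). Qed.

Lemma normr_dotp_le x y a b : 0 <= a -> 0 <= b ->
  dotp x x <= a ^+ 2 -> dotp y y <= b ^+ 2 -> `|dotp x y| <= a * b.
Proof.
move=> a0 b0 xa yb; rewrite -ler_sqr ?nnegrE ?mulr_ge0 // real_normK ?num_real //.
rewrite (le_trans (dotp_cauchy x y)) // exprMn ler_pM ?dotp_ge0 //.
Qed.

Lemma dotp_add_le x y a b : 0 <= a -> 0 <= b ->
  dotp x x <= a ^+ 2 -> dotp y y <= b ^+ 2 -> dotp (x + y) (x + y) <= (a + b) ^+ 2.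
Proof.
move=> a0 b0 xa yb; have := normr_dotp_le a0 b0 xa yb.
rewrite ler_norml => /andP[_ h]; rewrite !dotpE [dotp y x]dotpC.
by rewrite sqrrD mulr2n; lra.
Qed.

Lemma dotp_sub_le x y a b : 0 <= a -> 0 <= b ->
  dotp x x <= a ^+ 2 -> dotp y y <= b ^+ 2 -> dotp (x - y) (x - y) <= (a + b) ^+ 2.
Proof.
move=> a0 b0 xa yb; apply: dotp_add_le => //.
by rewrite dotpNr dotpC dotpNr opprK.
Qed.

Lemma enorm_sqr x : enorm x ^+ 2 = dotp x x.
Proof.
have -> : enorm x = Num.sqrt (dotp x x) by rewrite /enorm expr2.
by rewrite sqr_sqrtr // dotp_ge0.
Qed.

Lemma enorm_ge0 x : 0 <= enorm x. Proof. exact: sqrtr_ge0. Qed.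

Lemma enorm_le x a : 0 <= a -> (enorm x <= a) = (dotp x x <= a ^+ 2).
Proof.
by move=> a0; rewrite -enorm_sqr ler_pXn2r // nnegrE // enorm_ge0.
Qed.

Lemma eball_diamE x a : 0 <= a -> eball_diam a x <-> dotp x x <= (a / 2) ^+ 2.
Proof. by move=> a0; rewrite /eball_diam /= enorm_le // divr_ge0. Qed.

End EuclideanGeometry.

(** [(t, q)] and [(t', q')] are the components of one point along and across two unit vectors,
    [(tau, sigma)] those of a competitor. The witness is [min sigma q']. If [t' <= t], the sum of
    squares grows by at most [2 tau (t - t')]; otherwise by at most
    [q^2 - q'^2 = (t' - t) (t' + t)], which is at most [D (t' - t)]. *)
Lemma quadratic_profile (R : realFieldType) (D t t' q q' tau sigma : R) :
  0 <= t -> 0 <= t' -> 0 <= q -> 0 <= q' -> 0 <= tau -> 0 <= sigma ->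
  t <= D / 2 -> t' <= D / 2 -> tau <= 3 * D / 2 -> sigma <= q ->
  t ^+ 2 + q ^+ 2 = t' ^+ 2 + q' ^+ 2 ->
  exists s, [/\ 0 <= s, s <= sigma, s <= q' &
    (tau - t') ^+ 2 + (q' - s) ^+ 2 <=
    (tau - t) ^+ 2 + (q - sigma) ^+ 2 + 3 * D * `|t - t'|].
Proof.
move=> t0 t'0 q0 q'0 tau0 s0 tD t'D tauD sq tq.
have [sq'|q's] := leP sigma q'.
  exists sigma; split => //.
  have -> : (tau - t') ^+ 2 + (q' - sigma) ^+ 2 = (tau - t) ^+ 2 + (q - sigma) ^+ 2 +
      (2 * tau * (t - t') + 2 * sigma * (q - q')).
    by have := tq; rewrite !expr2 => ?; lra.
  rewrite lerD2l; have [t't|tt'] := leP t' t.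
    have qq' : q <= q' by rewrite -ler_sqr ?nnegrE //; nra.
    rewrite ger0_norm ?subr_ge0 //.
    by have : 2 * sigma * (q - q') <= 0; nra.
  have qq' : q' <= q by rewrite -ler_sqr ?nnegrE //; nra.
  rewrite ltr0_norm ?subr_lt0 //.
  have h1 : 2 * sigma * (q - q') <= 2 * q' * (q - q') by nra.
  have h2 : 2 * q' * (q - q') <= q ^+ 2 - q' ^+ 2 by nra.
  have h3 : q ^+ 2 - q' ^+ 2 = (t' - t) * (t' + t) by have := tq; rewrite !expr2; lra.
  have h4 : (t' - t) * (t' + t) <= (t' - t) * D by rewrite ler_pM2l ?subr_gt0 //; lra.
  have h5 : 2 * tau * (t - t') <= 0 by nra.
  have h6 : (t' - t) * D >= 0 by rewrite mulr_ge0; lra.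
  rewrite h3 in h2; lra.
exists q'; split => //; first exact: ltW.
have tt' : t <= t' by rewrite -ler_sqr ?nnegrE //; nra.
rewrite subrr expr0n addr0 ler0_norm ?subr_le0 //.
have h1 : 0 <= (q - sigma) ^+ 2 by rewrite sqr_ge0.
have h2 : (tau - t') ^+ 2 = (tau - t) ^+ 2 - 2 * tau * (t' - t) + (t' - t) * (t' + t) by ring.
have h4 : (t' - t) * (t' + t) <= (t' - t) * D by rewrite ler_wpM2l ?subr_ge0 //; lra.
have h6 : (t' - t) * D >= 0 by rewrite mulr_ge0; lra.
have h5 : 2 * tau * (t' - t) >= 0 by rewrite mulr_ge0 ?mulr_ge0 ?subr_ge0.
lra.
Qed.

Section LagrangianProfile.
Context {R : realType} {p : nat}.
Local Notation T := ('rV[R]_p * R)%type.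
Variable D : R.
Hypothesis D_gt0 : 0 < D.
Implicit Types (x y z u : T) (a b c mu : R).

Let r0 : 0 <= 3 * D / 2. Proof. by rewrite divr_ge0 ?mulr_ge0 // ltW. Qed.
Let d0 : 0 <= D / 2. Proof. by rewrite divr_ge0 ?ltW. Qed.

(* For the loss [|v|^2 <u, z>^2], [u = v / |v|], the Lagrangian with multiplier
   [lambda] is [lambda * lagr (|v|^2 / lambda) u]. *)
Definition lagr mu u x z : R := mu * dotp u z ^+ 2 - dotp (x - z) (x - z).

Definition lagr_sup mu u x : R :=
  sup [set lagr mu u x z | z in [set z | dotp z z <= (3 * D / 2) ^+ 2]].

Local Notation inner x := (dotp x x <= (D / 2) ^+ 2).
Local Notation outer z := (dotp z z <= (3 * D / 2) ^+ 2).

Lemma inner_outer x : inner x -> outer x.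
Proof.
move=> /le_trans; apply; rewrite ler_pXn2r ?nnegrE //; move: D_gt0; lra.
Qed.

Lemma sqr_dotp_le u z : dotp u u = 1 -> outer z -> dotp u z ^+ 2 <= (3 * D / 2) ^+ 2.
Proof. by move=> u1 hz; have := dotp_cauchy u z; rewrite u1 mul1r => /le_trans; exact. Qed.

Lemma dotp_inner_le u x : dotp u u = 1 -> inner x -> `|dotp u x| <= D / 2.
Proof.
by move=> u1 hx; rewrite -[leRHS]mul1r normr_dotp_le // u1 expr1n.
Qed.

Lemma lagr_le mu u x z : 0 <= mu -> dotp u u = 1 -> outer z ->
  lagr mu u x z <= mu * (3 * D / 2) ^+ 2.
Proof.
move=> mu0 u1 hz; rewrite /lagr.
have := ler_wpM2l mu0 (sqr_dotp_le u1 hz); have := dotp_ge0 (x - z); lra.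
Qed.

Section Unit.
Variables (mu : R) (u : T).
Hypotheses (mu_ge0 : 0 <= mu) (u1 : dotp u u = 1).

Let hs x : has_sup [set lagr mu u x z | z in [set z | outer z]].
Proof.
split; first by exists (lagr mu u x 0); exists 0 => //=; rewrite dotp0r sqr_ge0.
by exists (mu * (3 * D / 2) ^+ 2) => _ [z /= hz <-]; exact: lagr_le.
Qed.

Lemma lagr_sup_ge x z : outer z -> lagr mu u x z <= lagr_sup mu u x.
Proof. by move=> hz; apply: sup_upper_bound; [exact: hs|exists z]. Qed.

Lemma lagr_sup_approx x e : 0 < e -> exists2 z, outer z & lagr_sup mu u x - e < lagr mu u x z.
Proof.
by move=> e0; have [_ [z /= hz <-] h] := sup_adherent e0 (hs x); exists z.
Qed.

Lemma lagr_sup_le x c : (forall z, outer z -> lagr mu u x z <= c) -> lagr_sup mu u x <= c.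
Proof.
move=> h; apply: ge_sup; first by case: (hs x).
by move=> _ [z /= hz <-]; exact: h.
Qed.

Lemma lagr_sup_ge0 x : inner x -> 0 <= lagr_sup mu u x.
Proof.
move=> /inner_outer hx; apply: le_trans (lagr_sup_ge _ hx).
by rewrite /lagr subrr dotp0r subr0 mulr_ge0 ?sqr_ge0.
Qed.

End Unit.

Lemma lagr_sup_mu mu mu' u x : 0 <= mu -> mu <= mu' -> dotp u u = 1 ->
  lagr_sup mu u x <= lagr_sup mu' u x <= lagr_sup mu u x + (mu' - mu) * (3 * D / 2) ^+ 2.
Proof.
move=> mu0 mumu u1; have mu'0 : 0 <= mu' by exact: le_trans mumu.
apply/andP; split; apply: lagr_sup_le => // z hz.
  apply: le_trans (lagr_sup_ge mu'0 u1 _ hz); rewrite /lagr lerD2r.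
  by rewrite ler_wpM2r ?sqr_ge0.
have := lagr_sup_ge mu0 u1 x hz; rewrite /lagr.
have : (mu' - mu) * dotp u z ^+ 2 <= (mu' - mu) * (3 * D / 2) ^+ 2.
  by rewrite ler_wpM2l ?subr_ge0 // sqr_dotp_le.
lra.
Qed.

(** The point is taken in the plane of [u] and [x]: along [u] it has the sign of [<u, x>], and
    across [u] it is parallel to the part of [x]. *)
Lemma profile_realization u x tau sigma : dotp u u = 1 -> 0 <= sigma ->
  sigma ^+ 2 <= dotp x x - dotp u x ^+ 2 ->
  exists z, [/\ dotp z z = tau ^+ 2 + sigma ^+ 2, dotp u z ^+ 2 = tau ^+ 2 &
    dotp (x - z) (x - z) = (tau - `|dotp u x|) ^+ 2 +
      (Num.sqrt (dotp x x - dotp u x ^+ 2) - sigma) ^+ 2].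
Proof.
move=> u1 s0 sx; set t := dotp u x; set Q := dotp x x - t ^+ 2.
have Q0 : 0 <= Q by exact: le_trans (sqr_ge0 _) sx.
set q := Num.sqrt Q; have q0 : 0 <= q by exact: sqrtr_ge0.
have q2 : q ^+ 2 = Q by rewrite sqr_sqrtr.
have sq : sigma <= q by rewrite -ler_sqr ?nnegrE // q2.
(* When [q = 0] the quotient is 0, the right value since [sigma <= q] forces [sigma = 0]. *)
pose a := sigma / q.
have aq : a * q = sigma.
  rewrite /a; have [q_eq0|q_neq0] := eqVneq q 0; last by rewrite divfK.
  by apply/esym/eqP; rewrite q_eq0 mulr0 eq_le s0 -q_eq0 sq.
have [e [xE ue ee]] : exists e, [/\ x = t *: u + e, dotp u e = 0 & dotp e e = q ^+ 2].
  exists (x - t *: u); split; first by rewrite addrC subrK.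
    by rewrite !dotpE u1 mulr1 subrr.
  by rewrite q2 /Q !dotpE [dotp x u]dotpC u1 -/t; ring.
have N c d : dotp (c *: u + d *: e) (c *: u + d *: e) = c ^+ 2 + (d * q) ^+ 2.
  by rewrite !dotpE [dotp e u]dotpC ue u1 ee; ring.
pose s := if 0 <= t then 1 else -1 : R.
have s2 : s ^+ 2 = 1 by rewrite /s; case: ifP => _; rewrite ?expr1n ?sqrrN ?expr1n.
have st : t = s * `|t|.
  by rewrite /s; case: ger0P => [|] _; rewrite ?mul1r // mulN1r opprK.
exists ((s * tau) *: u + a *: e); split.
- by rewrite N exprMn s2 mul1r aq.
- by rewrite !dotpE ue u1 mulr0 addr0 mulr1 exprMn s2 mul1r.
- have -> : x - ((s * tau) *: u + a *: e) = (t - s * tau) *: u + (1 - a) *: e.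
    by rewrite {1}xE opprD addrACA !scalerBl scale1r.
  rewrite N mulrBl mul1r aq; congr (_ + _).
  by rewrite {1}st -mulrBr exprMn s2 mul1r -sqrrN opprB.
Qed.

(** Cauchy-Schwarz on the parts across [u] bounds the distance below by that of the component pairs.
    The part of [z] is then cut at that of [x], which can only shorten the distance. *)
Lemma dotp_sub_ge u x z : dotp u u = 1 ->
  exists2 s, 0 <= s /\ s ^+ 2 <= dotp z z - dotp u z ^+ 2 &
  s <= Num.sqrt (dotp x x - dotp u x ^+ 2) /\
  (`|dotp u z| - `|dotp u x|) ^+ 2 +
      (Num.sqrt (dotp x x - dotp u x ^+ 2) - s) ^+ 2 <= dotp (x - z) (x - z).
Proof.
move=> u1; set t := dotp u x; set t' := dotp u z.
set q := Num.sqrt _; pose q' := Num.sqrt (dotp z z - t' ^+ 2).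
have Qge y : 0 <= dotp y y - dotp u y ^+ 2.
  by rewrite subr_ge0; have := dotp_cauchy u y; rewrite u1 mul1r.
have q0 : 0 <= q by exact: sqrtr_ge0.
have q'0 : 0 <= q' by exact: sqrtr_ge0.
have q2 : q ^+ 2 = dotp x x - t ^+ 2 by rewrite sqr_sqrtr.
have q'2 : q' ^+ 2 = dotp z z - t' ^+ 2 by rewrite sqr_sqrtr.
have cross : dotp x z - t * t' <= q * q'.
  have h := @normr_dotp_le _ _ (x - t *: u) (z - t' *: u) q q' q0 q'0.
  have sub y : dotp (y - dotp u y *: u) (y - dotp u y *: u) = dotp y y - dotp u y ^+ 2.
    by rewrite !dotpE [dotp y u]dotpC u1; ring.
  have := h; rewrite q2 q'2 !sub !lexx => /(_ isT isT).
  rewrite ler_norml => /andP[_]; rewrite !dotpE [dotp x u]dotpC u1 -/t -/t'.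
  by lra.
have dist : (`|t'| - `|t|) ^+ 2 + (q - q') ^+ 2 <= dotp (x - z) (x - z).
  rewrite !dotpE [dotp z x]dotpC.
  have t2 (c : R) : `|c| ^+ 2 = c ^+ 2 by rewrite real_normK ?num_real.
  have : t * t' <= `|t'| * `|t| by rewrite mulrC -normrM ler_norm.
  by rewrite !sqrrB !t2 !mulr2n q2 q'2; lra.
have [q'q|qq'] := leP q' q.
  by exists q'; rewrite ?q'2 ?lexx; split.
exists q; split => //.
  by rewrite -q'2 ler_pXn2r ?nnegrE // ltW.
rewrite subrr expr0n addr0; apply: le_trans dist; rewrite lerDl sqr_ge0 //.
Qed.

(** A competitor [z] for [u] becomes one for [u'] with the same gain, no larger norm, and a squared
    distance larger by at most [3 D] times the change of [|<u, x>|]. Only the scalar [<u, x>]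
    matters and the constant is free of [mu], which is what lets linear features dominate the dual
    functions. *)
Lemma lagr_sup_lip mu u u' x : 0 <= mu -> dotp u u = 1 -> dotp u' u' = 1 -> inner x ->
  `|lagr_sup mu u x - lagr_sup mu u' x| <= 3 * D * `|dotp u x - dotp u' x|.
Proof.
move=> mu0; wlog suff h : u u' / dotp u u = 1 -> dotp u' u' = 1 -> inner x ->
    lagr_sup mu u x <= lagr_sup mu u' x + 3 * D * `|dotp u x - dotp u' x|.
  move=> u1 u'1 hx; rewrite ler_norml; have := h _ _ u1 u'1 hx; have := h _ _ u'1 u1 hx.
  by rewrite [`|dotp u' x - _|]distrC; lra.
move=> u1 u'1 hx; apply: lagr_sup_le => // z hz.
have [s [s0 sz] [sq dist]] := dotp_sub_ge x z u1.
have Qge v : dotp v v = 1 -> 0 <= dotp x x - dotp v x ^+ 2.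
  by move=> v1; rewrite subr_ge0; have := dotp_cauchy v x; rewrite v1 mul1r.
have t2 (c : R) : `|c| ^+ 2 = c ^+ 2 by rewrite real_normK ?num_real.
have tauD : `|dotp u z| <= 3 * D / 2.
  by rewrite -[leRHS]mul1r normr_dotp_le // u1 expr1n.
have tq : `|dotp u x| ^+ 2 + Num.sqrt (dotp x x - dotp u x ^+ 2) ^+ 2 =
    `|dotp u' x| ^+ 2 + Num.sqrt (dotp x x - dotp u' x ^+ 2) ^+ 2.
  by rewrite !sqr_sqrtr ?Qge // !t2; ring.
have [s' [s'0 s's s'q' h]] := quadratic_profile (normr_ge0 _) (normr_ge0 _)
  (sqrtr_ge0 _) (sqrtr_ge0 _) (normr_ge0 _) s0 (dotp_inner_le u1 hx)
  (dotp_inner_le u'1 hx) tauD sq tq.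
have s'Q : s' ^+ 2 <= dotp x x - dotp u' x ^+ 2.
  by rewrite -(sqr_sqrtr (Qge _ u'1)) ler_pXn2r ?nnegrE ?sqrtr_ge0.
have [z' [zz uz xz]] := profile_realization `|dotp u z| u'1 s'0 s'Q.
have hz' : outer z'.
  rewrite zz t2; apply: le_trans hz.
  have : s' ^+ 2 <= s ^+ 2 by rewrite ler_pXn2r ?nnegrE.
  by lra.
have := lagr_sup_ge mu0 u'1 x hz'; rewrite /lagr uz xz t2.
have : 3 * D * `| `|dotp u x| - `|dotp u' x| | <= 3 * D * `|dotp u x - dotp u' x|.
  by rewrite ler_pM2l ?mulr_gt0 //; exact: ler_dist_dist.
by lra.
Qed.

(* Along [u] the function [lagr 1 u x] is affine, so it is maximized on the sphere. *)
Lemma lagr1_sphere u x z : dotp u u = 1 -> outer z ->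
  exists2 z', dotp z' z' = (3 * D / 2) ^+ 2 & lagr 1 u x z <= lagr 1 u x z'.
Proof.
move=> u1 hz; pose s := if 0 <= dotp u x then 1 else -1 : R.
have s2 : s ^+ 2 = 1 by rewrite /s; case: ifP => _; rewrite ?expr1n ?sqrrN ?expr1n.
have st : s * dotp u x = `|dotp u x|.
  by rewrite /s; case: ger0P => [|] _; rewrite ?mul1r // mulN1r.
pose b := s * dotp u z; pose q := b ^+ 2 + ((3 * D / 2) ^+ 2 - dotp z z).
have q0 : 0 <= q by rewrite addr_ge0 ?sqr_ge0 ?subr_ge0.
(* The nonnegative root of [|z + a s u|^2 = (3 D / 2)^2]; moving by [a s u] adds [2 a |<u, x>|] to
   the Lagrangian. *)
pose a := - b + Num.sqrt q.
have a0 : 0 <= a.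
  rewrite /a addrC subr_ge0 (le_trans (ler_norm b)) // -sqrtr_sqr ler_wsqrtr //.
  by rewrite lerDl subr_ge0.
have a2 : a ^+ 2 + 2 * a * b = (3 * D / 2) ^+ 2 - dotp z z.
  transitivity ((a + b) ^+ 2 - b ^+ 2); first by ring.
  by rewrite /a addrAC addNr add0r sqr_sqrtr // /q; ring.
exists (z + (a * s) *: u).
  rewrite !dotpE u1 [dotp z u]dotpC.
  transitivity (dotp z z + (a ^+ 2 * s ^+ 2 + 2 * a * b)); first by rewrite /b; ring.
  by rewrite s2 mulr1 a2; ring.
have xa : 0 <= 2 * a * (s * dotp u x) by rewrite st !mulr_ge0.
rewrite /lagr -subr_ge0 (le_trans xa) // le_eqVlt; apply/orP; left; apply/eqP.
rewrite !mul1r !dotpE u1 [dotp z u]dotpC [dotp x u]dotpC [dotp z x]dotpC.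
by ring.
Qed.

Lemma dotp_sub_close x x' z eta : inner x -> inner x' -> outer z -> 0 <= eta ->
  dotp (x - x') (x - x') <= eta ^+ 2 ->
  `|dotp (x - z) (x - z) - dotp (x' - z) (x' - z)| <= 4 * (D * eta).
Proof.
move=> hx hx' hz eta0 hxx.
have -> : dotp (x - z) (x - z) - dotp (x' - z) (x' - z) = dotp (x - x') ((x - z) + (x' - z)).
  by rewrite !dotpE [dotp z x]dotpC [dotp z x']dotpC [dotp x' x]dotpC; ring.
rewrite (_ : 4 * (D * eta) = eta * (4 * D)); last by ring.
 apply: normr_dotp_le => //; first by rewrite mulr_ge0 // ltW.
have -> : 4 * D = (D / 2 + 3 * D / 2) + (D / 2 + 3 * D / 2) by field.
by apply: dotp_add_le; rewrite ?addr_ge0 //; exact: dotp_sub_le.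
Qed.

Lemma dotp_sqr_close u x x' eta : dotp u u = 1 -> inner x -> inner x' -> 0 <= eta ->
  dotp (x - x') (x - x') <= eta ^+ 2 ->
  `|dotp u x ^+ 2 - dotp u x' ^+ 2| <= D * eta.
Proof.
move=> u1 hx hx' eta0 hxx; rewrite subr_sqr -dotpBr normrM mulrC ler_pM ?normr_ge0 //.
  apply: le_trans (ler_normD _ _) _.
  by rewrite [leRHS](_ : D = D / 2 + D / 2) ?lerD ?dotp_inner_le //; field.
by rewrite -[leRHS]mul1r normr_dotp_le // u1 expr1n.
Qed.

End LagrangianProfile.

(** * Uniform deviations *)

Lemma norm_increment_le (R : realDomainType) (x y z x' y' z' l l' d : R) :
  `|x - y| <= l -> `|x' - y'| <= l' -> `|(y - z) - (y' - z')| <= d ->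
  `|x - x' - (z - z')| <= l + l' + d.
Proof. by rewrite !ler_norml; lra. Qed.

Lemma norm_sub_le (R : realDomainType) (x y d : R) :
  0 <= x <= d -> 0 <= y <= d -> `|x - y| <= d.
Proof. by rewrite ler_norml; lra. Qed.

Section UniformDeviation.
Context {R : realType} {p : nat} {J : finType}.
Local Notation T := ('rV[R]_p * R)%type.
Variables (D : R) (P : J -> R) (pt : J -> T).
Hypotheses (D_gt0 : 0 < D) (P_ge0 : forall j, 0 <= P j) (P_sum1 : \sum_j P j = 1)
  (pt_inner : forall j, dotp (pt j) (pt j) <= (D / 2) ^+ 2).

(** The pairs [(mu, u)], where [mu] stands for the inverse of a multiplier at least 1. *)
Definition profile_param : Type :=
  {a : R * T | [&& 0 <= a.1, a.1 <= 1 & dotp a.2 a.2 == 1]}.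

Definition dotpx (x y : T * R) : R := dotp x.1 y.1 + x.2 * y.2.

Lemma lagr_sup_uniform_tail (n : nat) (L : R) : (0 < n)%N -> 1 <= L ->
  \sum_(t : n.-tuple J | `[< exists a : profile_param,
      Num.sqrt n%:R * (D ^+ 2 * (9 * L + 431)) <
      \sum_(j <- t) (lagr_sup D (val a).1 (val a).2 (pt j) -
         \sum_j' P j' * lagr_sup D (val a).1 (val a).2 (pt j')) >])
     \prod_(i < n) P (tnth t i) <= expR (- (L ^+ 2 / 2)).
Proof.
move=> n0 L1.
have nR : 0 < n%:R :> R by rewrite ltr0n.
(* The factors 9 in [y] are 3 (number of features) times the Lipschitz constant
   [3 D] of [lagr_sup] along [u]; the factor 3/2 in [w] balances the sensitivity
   [9/4 D^2] in [mu] against it, so that the product of the norms of the features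
   and of the weights stays below [9 D^2]. *)
pose w (a : profile_param) : T * R := ((val a).2, 3 / 2 * (val a).1).
pose y (i : 'I_3) (j j' : J) : T * R :=
  if i == 0 :> nat then ((9 * D) *: pt j, 0) else
  if i == 1%N :> nat then ((9 * D) *: pt j', 0) else (0, 9 / 2 * D ^+ 2).
have mu0 (a : profile_param) : 0 <= (val a).1 by case/and3P: (valP a).
have mu1 (a : profile_param) : (val a).1 <= 1 by case/and3P: (valP a).
have u1 (a : profile_param) : dotp (val a).2 (val a).2 = 1.
  by case/and3P: (valP a) => _ _ /eqP.
have sumI (F : 'I_3 -> R) : \sum_i 3^-1 * F i =
    3^-1 * F ord0 + 3^-1 * F (lift ord0 ord0) + 3^-1 * F (lift ord0 (lift ord0 ord0)).
  by rewrite !big_ord_recl big_ord0 addr0 addrA.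
have dxC : forall x y : T * R, dotpx x y = dotpx y x.
  by move=> x x'; rewrite /dotpx dotpC mulrC.
have dxD : forall x y z : T * R, dotpx x (y + z) = dotpx x y + dotpx x z.
  by move=> x x' x''; rewrite /dotpx /= dotpDr mulrDr addrACA.
have dxZ : forall c (x y : T * R), dotpx x (c *: y) = c * dotpx x y.
  by move=> c x x'; rewrite /dotpx /= dotpZr [RHS]mulrDr; congr (_ + _); exact: mulrCA.
have dx0 : forall x : T * R, 0 <= dotpx x x.
  by move=> a; rewrite addr_ge0 ?dotp_ge0 // -expr2 sqr_ge0.
have n1 (r : R) : `|9 * D * r| = 9 * D * `|r|.
  by rewrite normrM ger0_norm // mulr_ge0 // ltW.
have n2 (r : R) : `|3 / 2 * r * (9 / 2 * D ^+ 2)| = 3 / 2 * `|r| * (9 / 2 * D ^+ 2).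
  have -> : 3 / 2 * r * (9 / 2 * D ^+ 2) = 27 / 4 * D ^+ 2 * r by field.
  by rewrite normrM ger0_norm; [field|rewrite mulr_ge0 ?sqr_ge0 ?divr_ge0].
have fE a j j' : \sum_i 3^-1 * `|dotpx (w a) (y i j j')| =
   3 * D * `|dotp (val a).2 (pt j)| + 3 * D * `|dotp (val a).2 (pt j')| +
   9 / 4 * D ^+ 2 * (val a).1.
  rewrite sumI /y /w /dotpx /= !dotpZr !mulr0 !addr0 dotp0r add0r !n1 n2.
  by rewrite (ger0_norm (mu0 a)); field.
have fE2 : forall k k' j j', \sum_i 3^-1 * `|dotpx (w k) (y i j j') - dotpx (w k') (y i j j')| =
   3 * D * `|dotp (val k).2 (pt j) - dotp (val k').2 (pt j)| +
   3 * D * `|dotp (val k).2 (pt j') - dotp (val k').2 (pt j')| +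
   9 / 4 * D ^+ 2 * `|(val k).1 - (val k').1|.
  move=> k k' j j'; rewrite sumI /y /w /dotpx /= !dotpZr !mulr0 !addr0 !dotp0r !add0r -!mulrBr -!mulrBl -!mulrBr !n1 n2.
  by field.
have Db : 0 < 81 / 4 * D ^+ 4 by rewrite mulr_gt0 ?exprn_gt0.
have tail := @iid_tail R profile_param J 'I_3 (T * R)%type P (fun=> 3^-1) P_ge0 P_sum1
  _ _ dotpx dxC dxD dxZ dx0 (psd_cauchy dxC dxD dxZ dx0)
  (fun a j => lagr_sup D (val a).1 (val a).2 (pt j)) w y (13 / 4) (81 / 4 * D ^+ 4)
  _ _ Db _ _ n.
apply: le_trans.
  (* With [B = 13/4] and [b = 81/4 D^4], the choice [U = n b / 5] gives the exponent
     [39/80 L^2 + 5/2 - L^2 - 431/9 L]: the coefficient 39/80 is below 1/2, and [L >= 1] absorbs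
     5/2. *)
  apply: (tail _ _ _ _ _ _ _ (n%:R * (81 / 4 * D ^+ 4) / 5) (L / (9 * Num.sqrt n%:R * D ^+ 2))); clear tail.
  - by move=> _; rewrite invr_ge0.
  - by rewrite !big_ord_recl big_ord0; field.
  - move=> a; rewrite /dotpx /w /= u1.
    have : (val a).1 * (val a).1 <= 1 by rewrite mulr_ile1.
    by lra.
  - move=> i j j'; rewrite /y /dotpx.
    have h (x : T) : dotp x x <= (D / 2) ^+ 2 ->
       dotp ((9 * D) *: x) ((9 * D) *: x) + 0 * 0 <= 81 / 4 * D ^+ 4.
      move=> hx; rewrite dotpZr dotpZl mulr0 addr0 mulrA.
      have -> : 81 / 4 * D ^+ 4 = 9 * D * (9 * D) * (D / 2) ^+ 2 by field.
      by rewrite ler_wpM2l // -expr2 sqr_ge0.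
    case: ifP => _; first exact: h.
    case: ifP => _; first exact: h.
    by rewrite /= dotp0r add0r le_eqVlt; apply/orP; left; apply/eqP; field.
  (* The third feature is enough here: [lagr_sup] lies between 0 and [9/4 D^2 mu]. *)
  - move=> j j' a; rewrite fE.
    have B k : 0 <= lagr_sup D (val a).1 (val a).2 (pt k) <= 9 / 4 * D ^+ 2 * (val a).1.
      rewrite (lagr_sup_ge0 D_gt0 (mu0 a) (u1 a) (pt_inner k)) andTb.
      apply: (lagr_sup_le (mu0 a) (u1 a)) => z hz.
      apply: le_trans (lagr_le _ (mu0 a) (u1 a) hz) _.
      by rewrite le_eqVlt; apply/orP; left; apply/eqP; field.
    have h (x : T) : 0 <= 3 * D * `|dotp (val a).2 x| by rewrite !mulr_ge0 // ltW.
    have := B j; have := B j'; have := h (pt j); have := h (pt j').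
    by rewrite ler_norml; lra.
  (* The change of [u] is paid at each of the two points. For the change of [mu] both differences
     lie in the same interval [[0, 9/4 D^2 |mu - mu'|]], so that a single copy pays for the two of
     them. *)
  - move=> j j' a a'; rewrite fE2.
    have lip k := lagr_sup_lip D_gt0 (mu0 a) (u1 a) (u1 a') (pt_inner k).
    have mul k : 0 <= (val a').1 <= (val a).1 -> 
         lagr_sup D (val a').1 (val a').2 (pt k) <= lagr_sup D (val a).1 (val a').2 (pt k) <=
         lagr_sup D (val a').1 (val a').2 (pt k) + ((val a).1 - (val a').1) * (9 / 4 * D ^+ 2).
      move=> /andP[h1 h2]; have := @lagr_sup_mu R p D _ _ _ (pt k) h1 h2 (u1 a').
      by rewrite (_ : (3 * D / 2) ^+ 2 = 9 / 4 * D ^+ 2) //; field.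
    have mul' k : 0 <= (val a).1 <= (val a').1 -> 
         lagr_sup D (val a).1 (val a').2 (pt k) <= lagr_sup D (val a').1 (val a').2 (pt k) <=
         lagr_sup D (val a).1 (val a').2 (pt k) + ((val a').1 - (val a).1) * (9 / 4 * D ^+ 2).
      move=> /andP[h1 h2]; have := @lagr_sup_mu R p D _ _ _ (pt k) h1 h2 (u1 a').
      by rewrite (_ : (3 * D / 2) ^+ 2 = 9 / 4 * D ^+ 2) //; field.
    apply: (norm_increment_le (lip j) (lip j')).
    have [aa'|aa'] := leP (val a').1 (val a).1.
      rewrite (@ger0_norm _ ((val a).1 - (val a').1)) ?subr_ge0 // mulrC.
      apply: norm_sub_le; have := mul j; have := mul j';
        rewrite mu0 aa' => /(_ isT) /andP[? ?] /(_ isT) /andP[? ?].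
        by rewrite subr_ge0 lerBlDl; apply/andP.
      by rewrite subr_ge0 lerBlDl; apply/andP.
    rewrite distrC [`|(val a).1 - _|]distrC (@ger0_norm _ ((val a').1 - (val a).1)) ?subr_ge0 ?(ltW aa') // mulrC.
    rewrite (_ : _ - _ - _ = (lagr_sup D (val a').1 (val a').2 (pt j) -
       lagr_sup D (val a).1 (val a').2 (pt j)) - (lagr_sup D (val a').1 (val a').2 (pt j') -
       lagr_sup D (val a).1 (val a').2 (pt j'))); last by ring.
    apply: norm_sub_le; have := mul' j; have := mul' j';
      rewrite mu0 (ltW aa') => /(_ isT) /andP[? ?] /(_ isT) /andP[? ?].
      by rewrite subr_ge0 lerBlDl; apply/andP.
    by rewrite subr_ge0 lerBlDl; apply/andP.
  - by rewrite !mulr_gt0.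
  - rewrite divr_ge0 //; first by lra.
    by rewrite !mulr_ge0 ?sqrtr_ge0 ?(ltW D_gt0).
clear tail; have s0 : 0 < Num.sqrt n%:R :> R by rewrite sqrtr_gt0.
rewrite ler_expR.
have -> : (L / (9 * Num.sqrt n%:R * D ^+ 2)) ^+ 2 * (13 / 4) *
    (n%:R * (81 / 4 * D ^+ 4) / 5 + n%:R * (81 / 4 * D ^+ 4)) / 2 = 39 / 80 * L ^+ 2.
  rewrite -{2 3}(sqr_sqrtr (ltW nR)); field.
  by rewrite !gt_eqF.
have -> : n%:R * (81 / 4 * D ^+ 4) / (2 * (n%:R * (81 / 4 * D ^+ 4) / 5)) = 5 / 2.
  by field; rewrite !gt_eqF.
have -> : L / (9 * Num.sqrt n%:R * D ^+ 2) * (Num.sqrt n%:R * (D ^+ 2 * (9 * L + 431))) =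
  L ^+ 2 + 431 / 9 * L by field; rewrite !gt_eqF.
have := sqr_ge0 L; lra.
Qed.

End UniformDeviation.

Section SecondMomentDeviation.
Context {R : realType} {p : nat} {J : finType}.
Local Notation T := ('rV[R]_p * R)%type.
Variables (D : R) (P : J -> R) (pt : J -> T).
Hypotheses (D_gt0 : 0 < D) (P_ge0 : forall j, 0 <= P j) (P_sum1 : \sum_j P j = 1)
  (pt_inner : forall j, dotp (pt j) (pt j) <= (D / 2) ^+ 2).

Definition unit_vector : Type := {u : T | dotp u u == 1}.

(** The minus sign makes this a bound on how far the sample second moments fall short of the true
    ones, the direction used by the lower bound. On the ball the square is [D]-Lipschitz in
    [<u, x>], hence the features [2 D x], averaged over the two points. *)
Lemma second_moment_uniform_tail (n : nat) (L : R) : (0 < n)%N -> 1 <= L ->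
  \sum_(t : n.-tuple J | `[< exists a : unit_vector,
      Num.sqrt n%:R * (D ^+ 2 * (9 * L + 431)) <
      \sum_(j <- t) (- dotp (val a) (pt j) ^+ 2 -
         \sum_j' P j' * - dotp (val a) (pt j') ^+ 2) >])
     \prod_(i < n) P (tnth t i) <= expR (- (L ^+ 2 / 2)).
Proof.
move=> n0 L1.
have nR : 0 < n%:R :> R by rewrite ltr0n.
pose y (i : bool) (j j' : J) : T := (2 * D) *: pt (if i then j else j').
have u1 (a : unit_vector) : dotp (val a) (val a) = 1 by apply/eqP/(valP a).
have Db : 0 < D ^+ 4 by rewrite exprn_gt0.
have d0 : 0 <= D / 2 by rewrite divr_ge0 // ltW.
have le (a : unit_vector) j : `|dotp (val a) (pt j)| <= D / 2.
  exact: (dotp_inner_le D_gt0).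
have n2 (r : R) : `|2 * D * r| = 2 * D * `|r|.
  by rewrite normrM ger0_norm // mulr_ge0 // ltW.
have tail := @iid_tail R unit_vector J bool T P (fun=> 2^-1) P_ge0 P_sum1
  _ _ dotp dotpC dotpDr dotpZr dotp_ge0 dotp_cauchy
  (fun a j => - dotp (val a) (pt j) ^+ 2) val y 1 (D ^+ 4) _ _ Db _ _ n.
apply: le_trans.
  apply: (tail _ _ _ _ _ _ _ (n%:R * D ^+ 4 / 5) (L / (9 * Num.sqrt n%:R * D ^+ 2))); clear tail.
  - by move=> _; rewrite invr_ge0.
  - by rewrite big_bool /=; field.
  - by move=> a; rewrite u1.
  - move=> i j j'; rewrite /y dotpZr dotpZl mulrA.
    have -> : D ^+ 4 = 2 * D * (2 * D) * (D / 2) ^+ 2 by field.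
    by rewrite ler_wpM2l // -expr2 sqr_ge0.
  - move=> j j' a; rewrite big_bool /y !dotpZr !n2.
    have sq k : 0 <= dotp (val a) (pt k) ^+ 2 <= D * `|dotp (val a) (pt k)|.
      rewrite sqr_ge0 /= -[leLHS]real_normK ?num_real // expr2 ler_wpM2r //.
      by rewrite (le_trans (le a k)) // ler_pdivrMr //; lra.
    have := sq j; have := sq j'; rewrite /= ler_norml; lra.
  - move=> j j' a a'; rewrite big_bool /y !dotpZr -!mulrBr !n2.
    have sq k : `|dotp (val a) (pt k) ^+ 2 - dotp (val a') (pt k) ^+ 2| <=
        D * `|dotp (val a) (pt k) - dotp (val a') (pt k)|.
      rewrite subr_sqr normrM mulrC ler_wpM2r //.
      by apply: le_trans (ler_normD _ _) _; have := le a k; have := le a' k; lra.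
    by have := sq j; have := sq j'; rewrite !ler_norml /=; lra.
  - by rewrite !mulr_gt0.
  - rewrite divr_ge0 //; first by lra.
    by rewrite !mulr_ge0 ?sqrtr_ge0 ?(ltW D_gt0).
clear tail; have s0 : 0 < Num.sqrt n%:R :> R by rewrite sqrtr_gt0.
rewrite ler_expR.
have -> : (L / (9 * Num.sqrt n%:R * D ^+ 2)) ^+ 2 * 1 *
    (n%:R * D ^+ 4 / 5 + n%:R * D ^+ 4) / 2 = 1 / 135 * L ^+ 2.
  rewrite -{2 3}(sqr_sqrtr (ltW nR)); field.
  by rewrite !gt_eqF.
have -> : n%:R * D ^+ 4 / (2 * (n%:R * D ^+ 4 / 5)) = 5 / 2.
  by field; rewrite !gt_eqF.
have -> : L / (9 * Num.sqrt n%:R * D ^+ 2) * (Num.sqrt n%:R * (D ^+ 2 * (9 * L + 431))) =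
  L ^+ 2 + 431 / 9 * L by field; rewrite !gt_eqF.
have := sqr_ge0 L; lra.
Qed.

End SecondMomentDeviation.

(** * Measurability and discretization of the data distribution *)

Section BorelData.
Context {R : realType} {p : nat}.
Local Notation T := ('rV[R]_p * R)%type.
Local Notation X := (borel_data R p).

Lemma open_measurable_data (U : set T) : open U -> measurable (U : set X).
Proof. by move=> oU; exact: sub_sigma_algebra. Qed.

Lemma continuous_measurable_data (f : T -> R) :
  continuous f -> measurable_fun [set: X] (f : X -> R).
Proof.
move=> /continuousP cf; apply: (measurability _ (RGenOpens.measurableE R)).
move=> _ [_ [a [b ->] <-]]; rewrite setTI; apply: open_measurable_data.
by apply: cf; exact: interval_open.
Qed.

Lemma measurable_coord1 i : measurable_fun [set: X] (fun x : X => x.1 0 i : R).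
Proof.
apply: (@continuous_measurable_data (fun x => x.1 0 i)) => x.
apply: (@continuous_comp _ _ _ (@fst _ _) (fun M : 'rV[R]_p => M 0 i)).
  exact: cvg_fst.
exact: coord_continuous.
Qed.

Lemma measurable_coord2 : measurable_fun [set: X] (fun x : X => x.2 : R).
Proof. by apply: (@continuous_measurable_data snd) => x; exact: cvg_snd. Qed.

Section Composition.
Context {d : measure_display} {Y : measurableType d}.
Implicit Types f g : Y -> X.

Lemma measurable_dotp f g : measurable_fun [set: Y] f -> measurable_fun [set: Y] g ->
  measurable_fun [set: Y] (fun y => dotp (f y) (g y)).
Proof.
move=> mf mg; apply: measurable_funD.
  apply: measurable_sum => i; apply: measurable_funM;
  exact: (measurableT_comp (measurable_coord1 i)).
by apply: measurable_funM; exact: (measurableT_comp measurable_coord2).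
Qed.

Lemma measurable_dotp_sub f g : measurable_fun [set: Y] f -> measurable_fun [set: Y] g ->
  measurable_fun [set: Y] (fun y => dotp (f y - g y) (f y - g y)).
Proof.
move=> mf mg.
have -> : (fun y => dotp (f y - g y) (f y - g y)) =
   (fun y => dotp (f y) (f y) - 2 * dotp (f y) (g y) + dotp (g y) (g y)).
  by apply/funext => y; rewrite !dotpE [dotp (g y) (f y)]dotpC; ring.
apply: measurable_funD; last exact: measurable_dotp.
apply: measurable_funB; first exact: measurable_dotp.
by apply: measurable_funM => //; exact: measurable_dotp.
Qed.

End Composition.

Lemma measurable_dotp_ball (r : R) : measurable [set x : X | dotp x x <= r].
Proof.
have := @measurable_dotp _ X id id (@measurable_id _ _ setT) (@measurable_id _ _ setT).
move=> /(_ measurableT `]-oo, r]%classic (measurable_itv _)); rewrite setTI.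
by congr measurable; apply/seteqP; split => x /=; rewrite in_itv.
Qed.

(** A point outside the ball has a null neighbourhood, hence lies in a null ball with rational
    centre and radius [1 / (m + 1)]; there are countably many of these. *)
Lemma support_ball (P : probability X R) (D : R) : 0 < D ->
  support_of P `<=` eball_diam D -> P [set x : X | dotp x x <= (D / 2) ^+ 2] = 1%E.
Proof.
move=> D0 hP; set B := [set x | _].
pose ctr (c : 'rV[rat]_p * rat) : T := (map_mx ratr c.1, ratr c.2).
pose bx (k : 'rV[rat]_p * rat * nat) : set X := ball (ctr k.1) (k.2.+1%:R^-1).
have mbx k : measurable (bx k).
  by apply: open_measurable_data; apply: ball_open; rewrite invr_gt0.
pose F (n : nat) : set X :=
  if unpickle n is Some k then (if P (bx k) == 0%E then bx k else set0) else set0.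
have PF : P.-negligible (\bigcup_n F n).
  apply: negligible_bigcup => n; rewrite /F; case: unpickle => [k|].
    case: eqP => [Pk|_]; first by exists (bx k); split.
    exact: negligible_set0.
  exact: negligible_set0.
have sub : ~` B `<=` \bigcup_n F n.
  move=> x nBx; have [U [oU Ux]] : exists U, open_nbhs (x : T) U /\ ~ (0 < P U)%E.
    apply: contrapT => h; apply: nBx; rewrite /B /=; apply/eball_diamE; first exact: ltW.
    apply: hP => U xU; apply: contrapT => h'; apply: h; by exists U.
  have [oU' xU] := oU.
  have : nbhs (x : T) U by exact: open_nbhs_nbhs.
  rewrite -nbhs_ballE => -[e /= e0 eU].
  have [m] : exists m, 0 + m.+1%:R^-1 < e / 2 :> R by apply: ltr_add_invr; rewrite divr_gt0.
  rewrite add0r => me.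
  have m0 : 0 < m.+1%:R^-1 :> R by rewrite invr_gt0.
  have rat_near (y : R) : exists q : rat, `|ratr q - y| < m.+1%:R^-1.
    move: m0; set a := _^-1 => a0.
    have [|q] := @rat_in_itvoo R (y - a) (y + a); first by lra.
    by rewrite in_itv /= => hq; exists q; rewrite ltr_norml; lra.
  have [c1 hc1] := choice (fun i : 'I_p => rat_near (x.1 0 i)).
  have [c2 hc2] := rat_near x.2.
  pose k : 'rV[rat]_p * rat * nat := (\row_i c1 i, c2, m).
  have xk : bx k x.
    rewrite /bx /ctr /=; split => //=.
    by split => // i j; rewrite !mxE (ord1 i); exact: hc1.
  have kU : bx k `<=` U.
    have le2 : m.+1%:R^-1 <= e / 2 by exact: ltW.
    move=> y ky; apply: eU; apply: (@ball_splitr _ _ (ctr k.1)); apply: (le_ball le2) => //.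
  have Pk : P (bx k) = 0%E.
    apply/eqP; rewrite eq_le measure_ge0 andbT.
    apply: (@le_trans _ _ (P U)); last by rewrite leNgt; apply/negP.
    by apply: le_measure => //; rewrite inE //; exact: open_measurable_data.
  by exists (pickle k) => //; rewrite /F pickleK Pk eqxx.
have mB : measurable B by exact: measurable_dotp_ball.
rewrite -[B]setCK probability_setC; last exact: measurableC.
have -> : P (~` B) = 0%E.
  by apply: measure_negligible; [exact: measurableC|exact: negligibleS sub PF].
by rewrite sube0.
Qed.

End BorelData.

Section Cells.
Context {R : realType} {p : nat}.
Local Notation T := ('rV[R]_p * R)%type.
Local Notation X := (borel_data R p).

Definition coordinate (x : T) (i : 'I_p.+1) : R :=
  if unlift ord0 i is Some i' then x.1 0 i' else x.2.

Lemma dotp_coordinate x : dotp x x = \sum_i coordinate x i ^+ 2.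
Proof.
rewrite big_ord_recl /coordinate unlift_none addrC expr2; congr (_ + _).
by apply: eq_bigr => i _; rewrite liftK expr2.
Qed.

Lemma measurable_coordinate i : measurable_fun [set: X] (coordinate^~ i : X -> R).
Proof.
rewrite /coordinate; case: unliftP => [j|] _; last exact: measurable_coord2.
exact: measurable_coord1.
Qed.

(** The cells are the traces on the ball of a grid of cubes of side [eta / (p + 1)], whose diameter
    is at most [eta]; the cubes are half-open, hence disjoint. *)
Lemma finite_cells (D eta : R) : 0 < D -> 0 < eta ->
  exists (J : finType) (C : J -> set X) (pt : J -> T),
  [/\ forall j, measurable (C j),
      forall j j' x, C j x -> C j' x -> j = j',
      \bigcup_j C j = [set x : X | dotp x x <= (D / 2) ^+ 2],
      forall j, dotp (pt j) (pt j) <= (D / 2) ^+ 2 &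
      forall j x, C j x -> dotp ((x : T) - pt j) ((x : T) - pt j) <= eta ^+ 2].
Proof.
move=> D0 eta0; pose h := eta / p.+1%:R.
have h0 : 0 < h by rewrite divr_gt0 // ltr0n.
pose N := Num.truncn (D / h).
pose C (j : {ffun 'I_p.+1 -> 'I_N.+1}) : set X :=
  [set x : X | dotp x x <= (D / 2) ^+ 2 /\
     forall i, (j i)%:R * h <= coordinate x i + D / 2 < (j i).+1%:R * h].
have d20 : 0 <= D / 2 by rewrite divr_ge0 // ltW.
have CC j j' x : C j x -> C j' x -> j = j'.
  move=> [_ h1] [_ h2]; apply/ffunP => i; apply/val_inj.
  have := h1 i; have := h2 i; rewrite -!(ler_pdivlMr _ _ h0) -!(ltr_pdivrMr _ _ h0) => k1 k2.
  exact: (etrans (esym (truncn_def k2)) (truncn_def k1)).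
(* An empty cell receives the centre 0, which keeps every [pt j] in the ball. *)
pose pt j : T := if pselect (exists x, C j x) is left e then projT1 (cid e) else 0.
exists {ffun 'I_p.+1 -> 'I_N.+1}, C, pt; split => //.
- move=> j; suff m2 : measurable [set x : X |
      forall i, (j i)%:R * h <= coordinate x i + D / 2 < (j i).+1%:R * h].
    exact: measurableI (measurable_dotp_ball _) m2.
  have -> : [set x : X | forall i, (j i)%:R * h <= coordinate x i + D / 2 < (j i).+1%:R * h] =
    \bigcap_(i in [set: 'I_p.+1]) ((fun x : X => coordinate x i + D / 2) @^-1`
       `[(j i)%:R * h, (j i).+1%:R * h[%classic).
    apply/seteqP; split => x /= hx i => [_|]; first by rewrite /= in_itv /=; exact: hx.
    by have := hx i I; rewrite /= in_itv.
  apply: fin_bigcap_measurable => // i _; rewrite -[_ @^-1` _]setTI.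
  apply: (measurable_funD (measurable_coordinate i) (measurable_cst _)) => //.
- apply/seteqP; split => [x [j _ [] //]|x /= hx].
  have hc i : 0 <= (coordinate x i + D / 2) / h /\ (Num.truncn ((coordinate x i + D / 2) / h) < N.+1)%N.
    have : `|coordinate x i| <= D / 2.
      rewrite -ler_sqr ?nnegrE // real_normK ?num_real //; apply: le_trans hx.
      by rewrite dotp_coordinate (bigD1 i) //= lerDl sumr_ge0 // => k _; rewrite sqr_ge0.
    rewrite ler_norml => hi; split; first by rewrite divr_ge0 ?(ltW h0) //; lra.
    by rewrite ltnS; apply: le_truncn; rewrite ler_pM2r ?invr_gt0 //; lra.
  exists [ffun i => inord (Num.truncn ((coordinate x i + D / 2) / h))] => //.
  split => // i; rewrite ffunE inordK; last by case: (hc i).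
  rewrite -(ler_pdivlMr _ _ h0) -(ltr_pdivrMr _ _ h0); apply: truncn_itv; by case: (hc i).
- move=> j; rewrite /pt; case: pselect => [e|_]; first by case: (projT2 (cid e)).
  by rewrite dotp0r sqr_ge0.
- move=> j x jx; rewrite /pt; case: pselect => [e|]; last by case; exists x.
  have [_ hy] := projT2 (cid e); move: (projT1 (cid e)) hy => y hy.
  case: jx => _ hx; rewrite dotp_coordinate.
  apply: (@le_trans _ _ (\sum_(i < p.+1) h ^+ 2)).
    apply: ler_sum => i _.
    have -> : coordinate ((x : T) - y) i = coordinate x i - coordinate y i.
      by rewrite /coordinate; case: unliftP => [k|] _ //=; rewrite !mxE.
    rewrite -[leLHS]real_normK ?num_real // ler_pXn2r ?nnegrE ?(ltW h0) //.
    by have := hx i; have := hy i; rewrite -natr1 ler_norml; lra.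
  rewrite sumr_const card_ord -mulr_natl /h exprMn exprVn mulrCA ler_piMr ?sqr_ge0 //.
  by rewrite expr2 invfM mulVKf ?pnatr_eq0 // invf_le1 ?ltr0n // ler1n.
Qed.

End Cells.

Section CellProbabilities.
Context {R : realType} {d : measure_display} {Y : measurableType d} {J : finType}.
Variable C : J -> set Y.
Hypotheses (mC : forall j, measurable (C j)) (disjC : forall j j' x, C j x -> C j' x -> j = j').

Lemma trivIset_cells (S : set J) : trivIset S C.
Proof. by move=> j j' _ _ [x []]; exact: disjC. Qed.

Lemma measure_cells (Q : {measure set Y -> \bar R}) (S : {pred J}) :
  Q (\bigcup_(j in [set` S]) C j) = (\sum_(j in S) Q (C j))%E.
Proof.
rewrite measure_fin_bigcup //; last exact: trivIset_cells.
have -> : [set` S] = [set` enum S] by apply/seteqP; split => j /=; rewrite mem_enum.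
by rewrite -fsbig_seq ?enum_uniq // big_enum.
Qed.

Lemma measurable_cells (S : {pred J}) : measurable (\bigcup_(j in [set` S]) C j).
Proof. by apply: fin_bigcup_measurable => // j _; exact: mC. Qed.

End CellProbabilities.

Section IidCells.
Context {R : realType} {d d' : measure_display} {Y : measurableType d}
  {Omega : measurableType d'} {J : finType}.
Variables (C : J -> set Y) (P : probability Y R) (Pr : probability Omega R).
Hypotheses (mC : forall j, measurable (C j)) (disjC : forall j j' x, C j x -> C j' x -> j = j')
  (PC : P (\bigcup_j C j) = 1%E).

Definition cell_weight j : R := fine (P (C j)).

Lemma cell_weightE j : (cell_weight j)%:E = P (C j).
Proof. by rewrite /cell_weight fineK // fin_num_measure. Qed.

Lemma cell_weight_ge0 j : 0 <= cell_weight j.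
Proof. by rewrite fine_ge0. Qed.

Lemma cell_weight_sum1 : \sum_j cell_weight j = 1.
Proof.
apply: EFin_inj; rewrite -PC.
have -> : \bigcup_j C j = \bigcup_(j in [set` [pred _ : J | true]]) C j.
  by apply/seteqP; split => x [j _ Cjx]; exists j.
rewrite measure_cells // -sumEFin; apply: eq_bigr => j _; exact: cell_weightE.
Qed.

Lemma cell_weight_sumD (F : J -> R) c :
  \sum_j cell_weight j * (F j + c) = \sum_j cell_weight j * F j + c.
Proof.
transitivity (\sum_j cell_weight j * F j + (\sum_j cell_weight j) * c).
  by rewrite mulr_suml -big_split /=; apply: eq_bigr => j _; rewrite [LHS]mulrDr.
by rewrite cell_weight_sum1 mul1r.
Qed.

Lemma sum_cell_weightE (k : J -> R) :
  (\sum_j (k j)%:E * P (C j) = (\sum_j cell_weight j * k j)%:E)%E.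
Proof.
rewrite -sumEFin; apply: eq_bigr => j _.
by rewrite [X in _ = X%:E]mulrC EFinM cell_weightE.
Qed.

Variables (n : nat) (X : 'I_n -> {RV Pr >-> Y}).
Hypothesis iidX : iid_sample P X.

Definition sample_cell (t : n.-tuple J) : set Omega :=
  \bigcap_(i in [set: 'I_n]) (X i @^-1` C (tnth t i)).

Lemma measurable_sample_cell t : measurable (sample_cell t).
Proof.
apply: fin_bigcap_measurable => // i _; rewrite -[_ @^-1` _]setTI.
exact: measurable_funPT.
Qed.

Lemma probability_sample_cell t :
  Pr (sample_cell t) = (\prod_(i < n) cell_weight (tnth t i))%:E.
Proof.
case: iidX => dX /(_ [set: 'I_n]%SET (fun i => C (tnth t i)) (fun i => mC _)).
have -> : [set` [set: 'I_n]%SET] = [set: 'I_n].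
  by apply/seteqP; split => i _ //=; rewrite inE.
rewrite -/(sample_cell t) => ->; rewrite -prodEFin.
apply: eq_big => [i|i _]; first by rewrite inE.
by rewrite cell_weightE -(dX i).
Qed.

(** The event is a finite union of products of cells, hence measurable, even though [bad] will
    quantify over an uncountable family. Samples that leave the cells are discarded at no cost,
    since the weights sum to 1. *)
Lemma good_sample_event (bad : pred (n.-tuple J)) (delta : R) :
  \sum_(t : n.-tuple J | bad t) \prod_(i < n) cell_weight (tnth t i) <= delta ->
  exists A : set Omega, [/\ measurable A, ((1 - delta)%:E <= Pr A)%E &
    forall w, A w -> exists2 t : n.-tuple J, ~~ bad t & forall i, C (tnth t i) (X i w)].
Proof.
move=> hbad; pose S : {pred n.-tuple J} := [pred t | ~~ bad t].
have disjS t t' w : sample_cell t w -> sample_cell t' w -> t = t'.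
  by move=> h h'; apply: eq_from_tnth => i; exact: (disjC (h i I) (h' i I)).
exists (\bigcup_(t in [set` S]) sample_cell t); split.
- by apply: measurable_cells => t; exact: measurable_sample_cell.
- rewrite (measure_cells measurable_sample_cell disjS).
  rewrite (eq_bigr (fun t => (\prod_(i < n) cell_weight (tnth t i))%:E)); last first.
    by move=> t _; exact: probability_sample_cell.
  rewrite sumEFin lee_fin (eq_bigl (fun t => ~~ bad t)) //.
  have := iid_expectation_cst cell_weight_sum1 n 1.
  rewrite iid_expectation_tuple (bigID bad) /=.
  under eq_bigr do rewrite mulr1.
  under [X in _ + X]eq_bigr do rewrite mulr1.
  by move: hbad; lra.
- by move=> w [t /= tS tw]; exists t => // i; exact: tw.
Qed.

End IidCells.

(** * Transport duality *)

Section MeasureAsProbability.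
Context {R : realType} {d : measure_display} {Y : measurableType d}.
Variables (mu : {measure set Y -> \bar R}) (mu1 : mu setT = 1%E).

(** An alias of [mu] that carries the probability structure, for measures obtained by mixing or
    counting. *)
Definition as_probability of mu setT = 1%E : set Y -> \bar R := mu.

HB.instance Definition _ := Measure.copy (as_probability mu1) mu.

HB.instance Definition _ :=
  Measure_isProbability.Build _ _ _ (as_probability mu1) mu1.

End MeasureAsProbability.

Section GeneralMeasure.
Local Open Scope ereal_scope.
Context {R : realType} {d d' : measure_display}
  {Y : measurableType d} {Z : measurableType d'}.

(** Change of variables for a law known only through its values on measurable sets, the form in
    which the marginals of a coupling are given. *)
Lemma integral_image (Q : {measure set Z -> \bar R}) (mu : {measure set Y -> \bar R})
    (h : Y -> Z) (f : Z -> \bar R) :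
  measurable_fun setT h -> (forall A, measurable A -> Q A = mu (h @^-1` A)) ->
  measurable_fun setT f -> (forall z, 0 <= f z) ->
  \int[Q]_z f z = \int[mu]_y f (h y).
Proof.
move=> mh Qh mf f0.
pose mixin := isMeasurableFun.Build _ _ _ _ h mh.
pose h' : {mfun Y >-> Z} := HB.pack h mixin.
rewrite (eq_measure_integral (pushforward mu h')) => [|A mA _]; last exact: Qh.
by rewrite (ge0_integral_pushforward mh) ?preimage_setT.
Qed.

Lemma ae_probability1 (Q : probability Y R) (A : set Y) :
  measurable A -> Q A = 1 -> {ae Q, forall y, A y}.
Proof.
move=> mA QA; exists (~` A); split => //; first exact: measurableC.
by rewrite probability_setC // QA subee.
Qed.

(* Unlike [ge0_le_integral], no measurability is assumed. *)
Lemma nonmeasurable_ge0_le_integral (mu : {measure set Y -> \bar R}) (f g : Y -> \bar R) :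
  (forall y, 0 <= f y) -> (forall y, f y <= g y) ->
  \int[mu]_y f y <= \int[mu]_y g y.
Proof.
move=> f0 fg; have g0 y : 0 <= g y by exact: le_trans (fg y).
rewrite !ge0_integralTE //; apply: le_ereal_sup => _ [h /= hf <-].
by exists h => // y; exact: le_trans (fg y).
Qed.

End GeneralMeasure.

Section CellDuality.
Context {R : realType} {p : nat} {J : finType}.
Local Notation T := ('rV[R]_p * R)%type.
Local Notation X := (borel_data R p).
Variables (D : R) (C : J -> set X).
Hypotheses (mC : forall j, measurable (C j))
  (disjC : forall j j' x, C j x -> C j' x -> j = j').
Local Notation Xi := [set z : X | dotp z z <= (3 * D / 2) ^+ 2].

Definition gain (u : T) (z : X) : \bar R := (dotp u z ^+ 2)%:E.

Definition cost (z : X * X) : \bar R := (dotp ((z.1 : T) - z.2) ((z.1 : T) - z.2))%:E.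

Lemma gain_ge0 u z : (0 <= gain u z)%E.
Proof. by rewrite lee_fin sqr_ge0. Qed.

Lemma cost_ge0 z : (0 <= cost z)%E.
Proof. by rewrite lee_fin dotp_ge0. Qed.

Lemma measurable_gain u : measurable_fun [set: X] (gain u).
Proof.
apply/measurable_EFinP; apply: measurable_funX.
exact: (measurable_dotp (measurable_cst _) (@measurable_id _ _ setT)).
Qed.

Lemma measurable_cost : measurable_fun [set: (X * X)%type] cost.
Proof.
apply/measurable_EFinP.
exact: (measurable_dotp_sub measurable_fst measurable_snd).
Qed.

(** A dual potential reduced to one value per cell, and 0 outside the cells. *)
Definition cell_step (k : J -> R) (x : X) : \bar R := (\sum_j (k j)%:E * (\1_(C j) x)%:E)%E.

Lemma measurable_cell_step k : measurable_fun setT (cell_step k).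
Proof.
apply: emeasurable_sum => j; apply: measurable_funeM.
by apply/measurable_EFinP; exact: measurable_indic.
Qed.

Lemma cell_step_ge0 k x : (forall j, 0 <= k j) -> (0 <= cell_step k x)%E.
Proof. by move=> k0; apply: sume_ge0 => j _; rewrite mule_ge0 ?lee_fin. Qed.

Lemma cell_stepE k j x : C j x -> cell_step k x = (k j)%:E.
Proof.
move=> Cjx; rewrite /cell_step (bigD1 j) //= indicE mem_set // mule1.
rewrite big1 ?adde0 // => j' j'j; rewrite indicE memNset ?mule0 // => Cj'x.
by move: j'j; rewrite (disjC Cj'x Cjx) eqxx.
Qed.

Lemma integral_cell_step (Q : {measure set X -> \bar R}) k : (forall j, 0 <= k j) ->
  (\int[Q]_x cell_step k x = \sum_j (k j)%:E * Q (C j))%E.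
Proof.
move=> k0; rewrite ge0_integral_sum //; last 2 first.
- move=> j; apply: measurable_funeM.
  by apply/measurable_EFinP; exact: measurable_indic.
- by move=> j x _; rewrite mule_ge0 ?lee_fin.
apply: eq_bigr => j _; rewrite ge0_integralZl_EFin //.
- by rewrite integral_indic // setIT.
- by apply/measurable_EFinP; exact: measurable_indic.
Qed.

(** The pointwise inequality is dual feasibility of the multiplier [l] and the potential [k]; it is
    integrated against [pi], and is available almost everywhere because the marginals are carried by
    the cells and by [Xi]. *)
Lemma weak_duality (Q : {measure set X -> \bar R}) (pi : probability (X * X)%type R)
    (u : T) (l : R) (k : J -> R) :
  (forall A, measurable A -> pi (fst @^-1` A) = Q A) ->
  Q (\bigcup_j C j) = 1%E -> pi (snd @^-1` Xi) = 1%E ->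
  0 <= l -> (forall j, 0 <= k j) ->
  (forall j (x z : T), C j x -> Xi z -> dotp u z ^+ 2 <= l * dotp (x - z) (x - z) + k j) ->
  (\int[pi]_z gain u z.2 <= l%:E * \int[pi]_z cost z + \sum_j (k j)%:E * Q (C j))%E.
Proof.
move=> marg QC piXi l0 k0 hk.
have mU : measurable (\bigcup_j C j) by exact: fin_bigcup_measurable.
have mXi : measurable Xi by exact: measurable_dotp_ball.
have mg2 : measurable_fun setT (fun z : X * X => gain u z.2).
  exact: (measurableT_comp (measurable_gain u) measurable_snd).
have ms1 : measurable_fun setT (fun z : X * X => cell_step k z.1).
  exact: (measurableT_comp (measurable_cell_step k) measurable_fst).
have mlc : measurable_fun setT (fun z : X * X => l%:E * cost z)%E.
  by apply: measurable_funeM; exact: measurable_cost.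
have k0' x : (0 <= cell_step k x)%E by exact: cell_step_ge0.
have c0 (z : X * X) : (0 <= cost z)%E by exact: cost_ge0.
have lc0 (z : X * X) : (0 <= l%:E * cost z)%E.
  by apply: mule_ge0; [rewrite lee_fin|exact: c0].
have Qk : (\int[Q]_x cell_step k x = \int[pi]_z cell_step k z.1)%E.
  apply: (integral_image measurable_fst _ (measurable_cell_step k) k0').
  by move=> A mA; exact/esym/marg.
rewrite -integral_cell_step // Qk -ge0_integralZl_EFin //; last exact: measurable_cost.
rewrite -ge0_integralD //.
apply: ae_ge0_le_integral => //.
- by move=> z _; exact: gain_ge0.
- by move=> z _; rewrite adde_ge0.
- exact: emeasurable_funD.
have a1 : {ae pi, forall z : X * X, (\bigcup_j C j) z.1}.
  apply: (@ae_probability1 _ _ _ pi (fst @^-1` \bigcup_j C j)).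
    by rewrite -[_ @^-1` _]setTI; exact: measurable_fst.
  exact: etrans (marg _ mU) QC.
have a2 : {ae pi, forall z : X * X, Xi z.2}.
  apply: (@ae_probability1 _ _ _ pi (snd @^-1` Xi)) => //.
  by rewrite -[_ @^-1` _]setTI; exact: measurable_snd.
apply: filterS2 a1 a2 => z [j _ Cj] z2 _.
by rewrite (cell_stepE k Cj) /cost -EFinM -EFinD lee_fin; exact: hk.
Qed.

End CellDuality.

(** * The value of the transport problem as a concave function of the radius *)

Section Supergradient.
Context {R : realType}.
Variables (A : R -> R -> Prop) (rho M a0 b0 : R).
Hypotheses (A_mono : forall a a' b, A a b -> a <= a' -> A a' b)
  (A_convex : forall a b a' b' s, A a b -> A a' b' -> 0 <= s <= 1 ->
    A (s * a + (1 - s) * a') (s * b + (1 - s) * b'))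
  (A_bounded : forall a b, A a b -> b <= M)
  (A0 : A a0 b0) (a0_lt : a0 < rho).

(** [A a b] reads: the value [b] is reached with budget [a]. The slope [l] is the supremum of the
    slopes of chords to the right of [rho]; by concavity ([key]) these are bounded by the slopes to
    the left, of which [(a0, b0)] provides one. The value [v] at [rho] is a supremum, only
    approached. *)
Lemma concave_supergradient : exists v l : R,
  [/\ forall e, 0 < e -> exists2 b, A rho b & v - e < b &
      forall a b, A a b -> b <= v + l * (a - rho)].
Proof.
pose V := [set b | A rho b].
have hV : has_sup V.
  by split; [exists b0; apply: A_mono A0 (ltW a0_lt)|exists M => b; exact: A_bounded].
pose v := sup V.
have key a1 b1 a2 b2 : A a1 b1 -> A a2 b2 -> a1 < rho -> rho < a2 ->
    (b2 - v) / (a2 - rho) <= (v - b1) / (rho - a1).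
  move=> h1 h2 lt1 lt2.
  have a12 : 0 < a2 - a1 by lra.
  pose s := (a2 - rho) / (a2 - a1).
  have s01 : 0 <= s <= 1.
    by rewrite /s divr_ge0 /= ?ler_pdivrMr //; lra.
  have sa : s * a1 + (1 - s) * a2 = rho by rewrite /s; field; rewrite gt_eqF.
  have := A_convex h1 h2 s01; rewrite sa => hs.
  have : s * b1 + (1 - s) * b2 <= v by apply: sup_upper_bound.
  have -> : s * b1 + (1 - s) * b2 = ((a2 - rho) * b1 + (rho - a1) * b2) / (a2 - a1).
    by rewrite /s; field; rewrite gt_eqF.
  rewrite ler_pdivrMr // => h.
  rewrite ler_pdivrMr ?subr_gt0 // mulrAC ler_pdivlMr ?subr_gt0 //.
  by move: h; lra.
pose S := [set (ab.2 - v) / (ab.1 - rho) | ab in [set ab : R * R | A ab.1 ab.2 /\ rho < ab.1]].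
have hS : has_sup S.
  split.
    exists ((b0 - v) / (rho + 1 - rho)); exists (rho + 1, b0) => //=; split; last by rewrite ltrDl.
    by apply: A_mono A0 _; move: a0_lt; lra.
  by exists ((v - b0) / (rho - a0)) => _ [[a b] /= [h1 h2] <-]; exact: key.
exists v, (sup S); split => [e e0|a b hab].
  by have [b hb h] := sup_adherent e0 hV; exists b.
have [alt|agt|aE] := ltgtP a rho.
- have : sup S <= (v - b) / (rho - a).
    apply: ge_sup; first by case: hS.
    by move=> _ [[a' b'] /= [h1 h2] <-]; exact: key.
  by rewrite ler_pdivlMr ?subr_gt0 //; lra.
- have : (b - v) / (a - rho) <= sup S.
    by apply: sup_upper_bound => //; exists (a, b).
  by rewrite ler_pdivrMr ?subr_gt0 //; lra.
- rewrite aE subrr mulr0 addr0; apply: sup_upper_bound => //.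
  by rewrite /V /= -aE.
Qed.

End Supergradient.

Section Attainable.
Context {R : realType} {p : nat}.
Local Notation T := ('rV[R]_p * R)%type.
Local Notation X := (borel_data R p).
Variables (D : R) (P : probability X R) (u : T).
Hypothesis D_gt0 : 0 < D.
Local Notation Xi := [set z : X | dotp z z <= (3 * D / 2) ^+ 2].

(** The hypograph of the value function, so that nothing rests on the existence of optimal plans.
    Only the first marginal is prescribed; the second just has to be carried by [Xi]. *)
Definition attainable (a b : R) : Prop :=
  exists pi : probability (X * X)%type R,
  [/\ forall A, measurable A -> pi (fst @^-1` A) = P A, pi (snd @^-1` Xi) = 1%E,
      (\int[pi]_z cost z <= a%:E)%E & (b%:E <= \int[pi]_z gain u z.2)%E].

Lemma attainable_mono a a' b : attainable a b -> a <= a' -> attainable a' b.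
Proof.
move=> [pi [h1 h2 h3 h4]] aa'; exists pi; split => //.
by apply: le_trans h3 _; rewrite lee_fin.
Qed.

Let mgain2 : measurable_fun setT (fun z : X * X => gain u z.2).
Proof. exact: (measurableT_comp (measurable_gain u) measurable_snd). Qed.

(** Costs and gains are integrals, hence affine under mixing of plans, and the first marginal is
    preserved. *)
Lemma attainable_convex a b a' b' s :
  attainable a b -> attainable a' b' -> 0 <= s <= 1 ->
  attainable (s * a + (1 - s) * a') (s * b + (1 - s) * b').
Proof.
move=> [pi [h1 h2 h3 h4]] [pi' [h1' h2' h3' h4']] /andP[s0 s1].
have s'0 : 0 <= 1 - s by rewrite subr_ge0.
pose mu := measure_add (mscale (NngNum s0) pi) (mscale (NngNum s'0) pi').
have muE A : mu A = (s%:E * pi A + (1 - s)%:E * pi' A)%E by rewrite /mu measure_addE.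
have avg : forall c : \bar R, c \is a fin_num -> (s%:E * c + (1 - s)%:E * c = c)%E.
  by move=> c cfin; rewrite -(fineK cfin) -!EFinM -EFinD; congr EFin; ring.
have mu1 : mu setT = 1%E.
  have := avg 1%E isT; rewrite muE.
  by rewrite (probability_setT pi) (probability_setT pi').
have muint (f : X * X -> \bar R) : measurable_fun setT f -> (forall z, (0 <= f z)%E) ->
    (\int[mu]_z f z = s%:E * \int[pi]_z f z + (1 - s)%:E * \int[pi']_z f z)%E.
  move=> mf f0; rewrite ge0_integral_measure_add //.
  by rewrite !ge0_integral_mscale.
exists (as_probability mu1); split.
- move=> A mA; have := avg (P A) (fin_num_measure P A mA).
  rewrite -{1}(h1 A mA) -(h1' A mA) => <-; exact: muE.
- have := avg 1%E isT; rewrite -{1}h2 -h2' => <-; exact: muE.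
- have -> : (\int[as_probability mu1]_z cost z = \int[mu]_z cost z)%E by [].
  rewrite muint; [|exact: measurable_cost|exact: cost_ge0].
  by rewrite [leRHS]EFinD !EFinM leeD // lee_wpmul2l ?lee_fin.
- have -> : (\int[as_probability mu1]_z gain u z.2 = \int[mu]_z gain u z.2)%E by [].
  rewrite muint //; last by move=> z; exact: gain_ge0.
  by rewrite [leLHS]EFinD !EFinM leeD // lee_wpmul2l ?lee_fin.
Qed.

End Attainable.

Section RobustRisk.
Context {R : realType} {p : nat}.
Local Notation T := ('rV[R]_p * R)%type.
Local Notation X := (borel_data R p).
Variables (D nu : R) (u : T) (g : X -> R).
Hypotheses (D_gt0 : 0 < D) (nu_ge0 : 0 <= nu)
  (gE : forall z, g z = nu * dotp u z ^+ 2).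
Local Notation Xi := [set z : X | dotp z z <= (3 * D / 2) ^+ 2].
Local Notation c := (@sq_cost R p : X -> X -> R).

Lemma eball_Xi : (eball_diam (3 * D) : set X) = Xi.
Proof. by apply/seteqP; split => z /eball_diamE; apply; rewrite mulr_ge0 // ltW. Qed.

Lemma expectation_gain (Q : probability X R) : ('E_Q[g] = nu%:E * \int[Q]_z gain u z)%E.
Proof.
rewrite unlock -ge0_integralZl_EFin //.
- by apply: eq_integral => z _; rewrite gE EFinM.
- by move=> z _; exact: gain_ge0.
- exact: measurable_gain.
Qed.

Lemma integral_gain_snd (Q : {measure set X -> \bar R}) (pi : probability (X * X)%type R) :
  (forall A, measurable A -> pi (snd @^-1` A) = Q A) ->
  (\int[Q]_z gain u z = \int[pi]_z gain u z.2)%E.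
Proof.
move=> h; apply: (integral_image measurable_snd _ (measurable_gain u) (@gain_ge0 _ _ u)).
by move=> A mA; exact/esym/h.
Qed.

Lemma costE (z : X * X) : (c z.1 z.2)%:E = cost z.
Proof. by rewrite /sq_cost enorm_sqr. Qed.

Lemma integral_costE (pi : probability (X * X)%type R) :
  (\int[pi]_z (c z.1 z.2)%:E = \int[pi]_z cost z)%E.
Proof. by apply: eq_integral => z _; exact: costE. Qed.

Lemma robust_risk_ge (Q : {measure set X -> \bar R}) (pi : probability (X * X)%type R)
    (rho : \bar R) (b : R) :
  (forall A, measurable A -> pi (fst @^-1` A) = Q A) -> pi (snd @^-1` Xi) = 1%E ->
  (\int[pi]_z cost z <= rho)%E -> (b%:E <= \int[pi]_z gain u z.2)%E ->
  ((nu * b)%:E <= robust_risk Xi c rho Q g)%E.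
Proof.
move=> h1 h2 h3 h4.
pose s : {mfun (X * X)%type >-> X} :=
  HB.pack snd (isMeasurableFun.Build _ _ (X * X)%type X snd measurable_snd).
pose Q' : probability X R := distribution pi s.
apply: (@le_trans _ _ ('E_Q'[g])%E).
  rewrite expectation_gain EFinM lee_wpmul2l ?lee_fin //.
  by rewrite (@integral_gain_snd Q' pi).
apply: ereal_sup_ubound; exists Q' => //; split; first exact: h2.
apply: ge_ereal_inf; exists (\int[pi]_z (c z.1 z.2)%:E)%E.
  by exists pi => // A mA; split; [exact: h1|].
by rewrite integral_costE.
Qed.

Lemma robust_risk_le (J : finType) (C : J -> set X) (Q : {measure set X -> \bar R})
    (l rho s : R) (k : J -> R) :
  (forall j, measurable (C j)) -> (forall j j' x, C j x -> C j' x -> j = j') ->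
  Q (\bigcup_j C j) = 1%E -> 0 <= l -> (forall j, 0 <= k j) ->
  (forall j (x z : T), C j x -> Xi z -> dotp u z ^+ 2 <= l * dotp (x - z) (x - z) + k j) ->
  (\sum_j (k j)%:E * Q (C j) = s%:E)%E ->
  (robust_risk Xi c rho%:E Q g <= (nu * (l * rho + s))%:E)%E.
Proof.
move=> mC dC QC l0 k0 hk hs.
apply: ge_ereal_sup => _ [Q' [Q'Xi hcost] <-].
rewrite expectation_gain EFinM lee_wpmul2l ?lee_fin //.
apply/lee_addgt0Pr => e e0.
(* The infimum over couplings may not be attained, so an almost optimal one is taken; its excess is
   [e / (l + 1)] because [l] may vanish. *)
have l1 : 0 < l + 1 by rewrite ltr_wpDl.
have [_ [pi hpi <-] hlt] : exists2 y,
    [set (\int[pi]_z (c z.1 z.2)%:E)%E | pi in [set pi : probability (X * X)%type R | coupling Q Q' pi]] y &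
    (y < (rho + e / (l + 1))%:E)%E.
  apply: ereal_inf_lt; apply: le_lt_trans hcost _.
  by rewrite lte_fin ltrDl divr_gt0.
rewrite (@integral_gain_snd Q' pi); last by move=> A mA; case: (hpi A mA).
have piXi : pi (snd @^-1` Xi) = 1%E.
  have [_ ->] := hpi _ (measurable_dotp_ball ((3 * D / 2) ^+ 2)).
  exact: Q'Xi.
apply: le_trans (weak_duality mC dC (fun A mA => (hpi A mA).1) QC piXi l0 k0 hk) _.
rewrite hs -EFinD; apply: (@le_trans _ _ (l%:E * (rho + e / (l + 1))%:E + s%:E)%E).
  by rewrite leeD2r // lee_wpmul2l ?lee_fin // -integral_costE ltW.
rewrite -EFinM -EFinD lee_fin.
have : l * (e / (l + 1)) <= e.
  by rewrite mulrA ler_pdivrMr // [leRHS]mulrC ler_pM2r // lerDl.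
by lra.
Qed.

End RobustRisk.

Section DeterministicTransport.
Context {R : realType} {p : nat} {J : finType}.
Local Notation T := ('rV[R]_p * R)%type.
Local Notation X := (borel_data R p).
Variables (D eta : R) (P : probability X R) (u : T) (C : J -> set X) (pt zeta : J -> T).
Hypotheses (D_gt0 : 0 < D) (eta_ge0 : 0 <= eta)
  (mC : forall j, measurable (C j)) (disjC : forall j j' x, C j x -> C j' x -> j = j')
  (PC : P (\bigcup_j C j) = 1%E)
  (C_inner : forall j x, C j x -> dotp x x <= (D / 2) ^+ 2)
  (pt_inner : forall j, dotp (pt j) (pt j) <= (D / 2) ^+ 2)
  (C_close : forall j x, C j x -> dotp ((x : T) - pt j) ((x : T) - pt j) <= eta ^+ 2)
  (zeta_outer : forall j, dotp (zeta j) (zeta j) <= (3 * D / 2) ^+ 2).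

Definition transport (x : X) : X :=
  if [pick j | `[< C j x >]] is Some j then zeta j else 0.

Lemma transportE j x : C j x -> transport x = zeta j.
Proof.
move=> Cj; rewrite /transport; case: pickP => [j' /asboolP Cj'|/(_ j)/asboolPn//].
by rewrite (disjC Cj' Cj).
Qed.

Lemma measurable_transport : measurable_fun setT transport.
Proof.
move=> _ A mA; rewrite setTI.
pose S : {pred J} := [pred j | `[< A (zeta j) >]].
have -> : transport @^-1` A = \bigcup_(j in [set` S]) C j `|`
    ((~` \bigcup_j C j) `&` [set _ | A 0]).
  apply/seteqP; split => x /=.
    rewrite /transport; case: pickP => [j /asboolP Cj Aj|h A0].
      by left; exists j => //; apply/asboolP.
    by right; split => // -[j _ Cj]; have := h j; move/asboolP: Cj => ->.
  move=> [[j /asboolP Aj Cj]|[nC A0]]; first by rewrite (transportE Cj).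
  rewrite /transport; case: pickP => [j /asboolP Cj|//].
  by exfalso; apply: nC; exists j.
apply: measurableU; first exact: measurable_cells.
apply: measurableI; first by apply/measurableC/fin_bigcup_measurable.
by have [A0|nA0] := pselect (A 0); [rewrite (_ : [set _ | _] = setT)|rewrite (_ : [set _ | _] = set0)] => //;
  apply/seteqP; split.
Qed.

(** The plan is the law of [(x, transport x)]. Replacing [x] by the point of its cell changes the
    squared distance to a point of the outer ball by at most [4 D eta]. *)
Lemma deterministic_attainable :
  attainable D P u
    (\sum_j cell_weight C P j * dotp (pt j - zeta j) (pt j - zeta j) + 4 * (D * eta))
    (\sum_j cell_weight C P j * dotp u (zeta j) ^+ 2).
Proof.
have mF : measurable_fun setT (fun x : X => (x, transport x)).
  by apply: measurable_fun_pair; [exact: measurable_id|exact: measurable_transport].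
pose F : {mfun X >-> (X * X)%type} :=
  HB.pack (fun x : X => (x, transport x)) (isMeasurableFun.Build _ _ X (X * X)%type _ mF).
pose pi : probability (X * X)%type R := distribution P F.
have piE (f : X * X -> \bar R) : measurable_fun setT f -> (forall z, (0 <= f z)%E) ->
    (\int[pi]_z f z = \int[P]_x f (x, transport x))%E.
  by move=> mf f0; exact: (integral_image mF).
have aeC : {ae P, forall x, (\bigcup_j C j) x}.
  by apply: ae_probability1 => //; exact: fin_bigcup_measurable.
have PE := sum_cell_weightE P mC.
have mtr := measurable_transport.
exists pi; split => //.
- rewrite -(probability_setT P); congr (P _); apply/seteqP; split => x // _ /=.
  rewrite /transport; case: pickP => [j _|_]; first exact: zeta_outer.
  by rewrite dotp0r sqr_ge0.
- rewrite piE; [|exact: measurable_cost|exact: cost_ge0].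
  pose k j := dotp (pt j - zeta j) (pt j - zeta j) + 4 * (D * eta).
  have k0 j : 0 <= k j.
    by rewrite addr_ge0 ?dotp_ge0 // mulr_ge0 // mulr_ge0 // ltW.
  have -> : (\sum_j cell_weight C P j * dotp (pt j - zeta j) (pt j - zeta j) + 4 * (D * eta))%:E =
      (\int[P]_x cell_step C k x)%E.
    rewrite (integral_cell_step mC) // PE; congr EFin.
    by rewrite -(cell_weight_sumD mC disjC PC).
  apply: ae_ge0_le_integral => //.
  + by move=> x _; exact: cost_ge0.
  + apply: (measurableT_comp measurable_cost); exact: mF.
  + by move=> x _; exact: cell_step_ge0.
  + exact: measurable_cell_step.
  + apply: filterS aeC => x [j _ Cj] _; rewrite (cell_stepE disjC k Cj) lee_fin /= (transportE Cj).
    have := dotp_sub_close D_gt0 (C_inner Cj) (pt_inner j) (zeta_outer j) eta_ge0 (C_close Cj).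
    by rewrite ler_norml /k; lra.
- rewrite piE; last 2 first.
  + exact: (measurableT_comp (measurable_gain u) measurable_snd).
  + by move=> z; exact: gain_ge0.
  rewrite -PE -(integral_cell_step mC) => [|j]; last exact: sqr_ge0.
  apply: ae_ge0_le_integral => //.
  + by move=> x _; apply: cell_step_ge0 => j; exact: sqr_ge0.
  + exact: measurable_cell_step.
  + by move=> x _; exact: gain_ge0.
  + apply: (measurableT_comp (measurable_gain u)); exact: mtr.
  + by apply: filterS aeC => x [j _ Cj] _; rewrite (cell_stepE disjC _ Cj) /= (transportE Cj).
Qed.

End DeterministicTransport.

Section CellLagrangian.
Context {R : realType} {p : nat} {J : finType}.
Local Notation T := ('rV[R]_p * R)%type.
Local Notation X := (borel_data R p).
Variables (D eta : R) (P : probability X R) (u : T) (C : J -> set X) (pt : J -> T).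
Hypotheses (D_gt0 : 0 < D) (eta_gt0 : 0 < eta) (u1 : dotp u u = 1)
  (mC : forall j, measurable (C j)) (disjC : forall j j' x, C j x -> C j' x -> j = j')
  (PC : P (\bigcup_j C j) = 1%E)
  (C_inner : forall j x, C j x -> dotp x x <= (D / 2) ^+ 2)
  (pt_inner : forall j, dotp (pt j) (pt j) <= (D / 2) ^+ 2)
  (C_close : forall j x, C j x -> dotp ((x : T) - pt j) ((x : T) - pt j) <= eta ^+ 2).
Local Notation outer z := (dotp z z <= (3 * D / 2) ^+ 2).
Local Notation q := (cell_weight C P).

Lemma attainable_le l (k : J -> R) a b : attainable D P u a b ->
  0 <= l -> (forall j, 0 <= k j) ->
  (forall j (x z : T), C j x -> outer z -> dotp u z ^+ 2 <= l * dotp (x - z) (x - z) + k j) ->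
  b <= l * a + \sum_j q j * k j.
Proof.
move=> [pi [h1 h2 h3 h4]] l0 k0 hk; rewrite -lee_fin; apply: (le_trans h4).
apply: le_trans (weak_duality mC disjC h1 PC h2 l0 k0 hk) _.
by rewrite EFinD EFinM (sum_cell_weightE P mC) leeD ?lee_wpmul2l ?lee_fin.
Qed.

(** The bound given by [lagr_sup] at [pt j], multiplied by [l] and carried to [x] at the price of
    the cell size: the dual feasibility required by [weak_duality]. *)
Lemma cell_lagr_le l j (x z : T) : 0 < l -> C j x -> outer z ->
  dotp u z ^+ 2 <= l * dotp (x - z) (x - z) + l * (lagr_sup D l^-1 u (pt j) + 4 * (D * eta)).
Proof.
move=> l0 Cj hz; have il0 : 0 <= l^-1 by rewrite invr_ge0 ltW.
have := lagr_sup_ge il0 u1 (pt j) hz; rewrite /lagr => h1.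
have := dotp_sub_close D_gt0 (C_inner Cj) (pt_inner j) hz (ltW eta_gt0) (C_close Cj).
rewrite ler_norml => h2.
have : l^-1 * dotp u z ^+ 2 <= dotp (x - z) (x - z) + (lagr_sup D l^-1 u (pt j) + 4 * (D * eta)).
  by lra.
by rewrite -mulrDr -ler_pdivrMl.
Qed.

Lemma cell_lagr_ge0 l j : 0 < l -> 0 <= l * (lagr_sup D l^-1 u (pt j) + 4 * (D * eta)).
Proof.
move=> l0; rewrite mulr_ge0 ?(ltW l0) // addr_ge0 //.
  by rewrite lagr_sup_ge0 // invr_ge0 ltW.
by rewrite !mulr_ge0 // ltW.
Qed.

Lemma attainable_lagr_le l a b : 0 < l -> attainable D P u a b ->
  b <= l * a + l * (\sum_j q j * lagr_sup D l^-1 u (pt j) + 4 * (D * eta)).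
Proof.
move=> l0 hab; rewrite -(cell_weight_sumD mC disjC PC) mulr_sumr.
under eq_bigr do rewrite mulrCA.
apply: attainable_le => //; first exact: ltW.
  by move=> j; exact: cell_lagr_ge0.
by move=> j x z; exact: cell_lagr_le.
Qed.

Lemma attainable_bounded a b : attainable D P u a b -> b <= (3 * D / 2) ^+ 2.
Proof.
move=> hab; have := @attainable_le 0 (fun=> (3 * D / 2) ^+ 2) a b hab (lexx _) (fun=> sqr_ge0 _).
rewrite mul0r add0r -mulr_suml (cell_weight_sum1 mC disjC PC) mul1r; apply.
by move=> j x z _ hz; rewrite mul0r add0r sqr_dotp_le.
Qed.

(** Each cell is collapsed to its point. This cheap plan is the pair with budget below the radius
    from which the supergradient is built. *)
Lemma attainable_diagonal : attainable D P u (4 * (D * eta)) (\sum_j q j * dotp u (pt j) ^+ 2).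
Proof.
have := deterministic_attainable u D_gt0 (ltW eta_gt0) mC disjC PC C_inner pt_inner C_close
  (fun j => inner_outer D_gt0 (pt_inner j)).
by rewrite big1 ?add0r // => j _; rewrite subrr dotp0r mulr0.
Qed.

(** Converse of [attainable_lagr_le]: sending each cell to a near maximizer of the Lagrangian
    reaches the dual value up to [e] and the cell size. *)
Lemma attainable_lagr_ge l (zeta : J -> T) e : 0 < l ->
  (forall j, outer (zeta j)) ->
  (forall j, lagr_sup D l^-1 u (pt j) - e <= lagr l^-1 u (pt j) (zeta j)) ->
  exists a b, [/\ attainable D P u a b,
    a = \sum_j q j * dotp (pt j - zeta j) (pt j - zeta j) + 4 * (D * eta) &
    l * (\sum_j q j * lagr_sup D l^-1 u (pt j) - e - 4 * (D * eta)) <= b - l * a].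
Proof.
move=> l0 hz hlagr.
exists (\sum_j q j * dotp (pt j - zeta j) (pt j - zeta j) + 4 * (D * eta)),
  (\sum_j q j * dotp u (zeta j) ^+ 2); split => //.
  exact: deterministic_attainable (ltW eta_gt0) mC disjC PC C_inner pt_inner C_close hz.
rewrite -ler_pdivlMl // mulrBr mulKf ?gt_eqF // opprD addrA lerD2r.
rewrite mulr_sumr -sumrB.
rewrite -(cell_weight_sumD mC disjC PC).
apply: ler_sum => j _.
have q0 := cell_weight_ge0 C P j.
apply: le_trans (ler_wpM2l q0 (hlagr j)) _.
by rewrite /lagr mulrBr mulrCA.
Qed.

(** Up to the cell size, the supremum of [b - l a] over attainable pairs is [l] times the mean of
    [lagr_sup]; the supergradient inequality bounds it by [v - l rho]. *)
Lemma supergradient_lagr_le l v rho : 0 < l ->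
  (forall a b, attainable D P u a b -> b <= v + l * (a - rho)) ->
  l * (rho + \sum_j q j * lagr_sup D l^-1 u (pt j)) <= v + l * (4 * (D * eta)).
Proof.
move=> l0 hl; have il0 : 0 <= l^-1 by rewrite invr_ge0 ltW.
apply/ler_addgt0Pr => e e0.
have /choice[zeta hzeta] : forall j, exists z, outer z /\
    lagr_sup D l^-1 u (pt j) - e / l <= lagr l^-1 u (pt j) z.
  move=> j; have [z hz h] := @lagr_sup_approx _ _ D _ _ il0 u1 (pt j) _ (divr_gt0 e0 l0).
  by exists z; split => //; exact: ltW.
have [a [b [hab _ h]]] := attainable_lagr_ge l0 (fun j => (hzeta j).1) (fun j => (hzeta j).2).
have := hl a b hab.
have : l * (e / l) = e by rewrite mulrCA mulfV ?mulr1 ?gt_eqF.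
move: h; set S := \sum_j _; set f := e / l; lra.
Qed.

End CellLagrangian.

Section ProbabilityCells.
Context {R : realType} {p : nat}.
Local Notation T := ('rV[R]_p * R)%type.
Local Notation X := (borel_data R p).
Variables (D : R) (P : probability X R).
Hypotheses (D_gt0 : 0 < D)
  (P_inner : P [set x : X | dotp x x <= (D / 2) ^+ 2] = 1%E).

Lemma probability_cells eta : 0 < eta ->
  exists (J : finType) (C : J -> set X) (pt : J -> T),
  [/\ forall j, measurable (C j), forall j j' x, C j x -> C j' x -> j = j',
      P (\bigcup_j C j) = 1%E, forall j x, C j x -> dotp x x <= (D / 2) ^+ 2 &
      (forall j, dotp (pt j) (pt j) <= (D / 2) ^+ 2) /\
      forall j x, C j x -> dotp ((x : T) - pt j) ((x : T) - pt j) <= eta ^+ 2].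
Proof.
move=> eta0; have [J [C [pt [h1 h2 h3 h4 h5]]]] := @finite_cells R p D eta D_gt0 eta0.
exists J, C, pt; split => //; first by rewrite h3.
by move=> j x Cj; have : (\bigcup_j C j) x by [exists j]; rewrite h3.
Qed.

End ProbabilityCells.

Section DualMultiplier.
Context {R : realType} {p : nat}.
Local Notation T := ('rV[R]_p * R)%type.
Local Notation X := (borel_data R p).
Variables (D rho : R) (P : probability X R) (u : T).
Hypotheses (D_gt0 : 0 < D) (u1 : dotp u u = 1)
  (P_inner : P [set x : X | dotp x x <= (D / 2) ^+ 2] = 1%E)
  (rho_gt0 : 0 < rho) (rho_lt : rho < D ^+ 2).

(** Suppose [l < 1] and let [g = (1 - l) (D^2 - rho)]. A near optimal plan for the multiplier 1 has
    cost [a >= D^2], so the supergradient line gives [b - a <= v - rho - g]. Yet, up to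
    discretization, [b - a] is at least [S] by near optimality and [v - rho] at most [S] by weak
    duality. *)
Lemma dual_multiplier : exists v l : R,
  [/\ 1 <= l, forall e, 0 < e -> exists2 b, attainable D P u rho b & v - e < b &
      forall a b, attainable D P u a b -> b <= v + l * (a - rho)].
Proof.
have [v [l [hv hl]]] : exists v l : R,
  [/\ forall e, 0 < e -> exists2 b, attainable D P u rho b & v - e < b &
      forall a b, attainable D P u a b -> b <= v + l * (a - rho)].
  (* With this mesh the diagonal plan has the budget [rho / 2]. *)
  have eta0 : 0 < rho / (8 * D) by rewrite divr_gt0 // mulr_gt0.
  have [J [C [pt [h1 h2 h3 h4 [h5 h6]]]]] := probability_cells D_gt0 P_inner eta0.
  apply: (concave_supergradient (A := attainable D P u) (M := (3 * D / 2) ^+ 2)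
    (a0 := 4 * (D * (rho / (8 * D))))
    (b0 := \sum_j cell_weight C P j * dotp u (pt j) ^+ 2)).
  - by move=> a a' b; exact: attainable_mono.
  - by move=> a b a' b' s; exact: attainable_convex.
  - by move=> a b; exact: (attainable_bounded u1 h1 h2 h3).
  - exact: (attainable_diagonal u D_gt0 eta0 h1 h2 h3 h4 h5 h6).
  - have -> : 4 * (D * (rho / (8 * D))) = rho / 2 by field; rewrite gt_eqF.
    by move: rho_gt0; lra.
exists v, l; split => //; rewrite leNgt; apply/negP => l1.
pose g := (1 - l) * (D ^+ 2 - rho).
have g0 : 0 < g by rewrite mulr_gt0 ?subr_gt0.
(* The errors [8 D eta + eta] then add up to [g / 2], less than [g]. *)
pose eta := g / (2 * (8 * D + 1)).
have D80 : 0 < 8 * D + 1 by rewrite addr_gt0 ?mulr_gt0.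
have eta0 : 0 < eta by rewrite divr_gt0 // mulr_gt0.
have [J [C [pt [h1 h2 h3 h4 [h5 h6]]]]] := probability_cells D_gt0 P_inner eta0.
pose S := \sum_j cell_weight C P j * lagr_sup D 1 u (pt j).
have vS : v <= rho + S + 4 * (D * eta).
  apply/ler_addgt0Pr => e e0; have [b hb] := hv e e0.
  have := attainable_lagr_le D_gt0 eta0 u1 h1 h2 h3 h4 h5 h6 ltr01 hb.
  by rewrite !mul1r invr1 -/S; lra.
have /choice[zeta hzeta] : forall j, exists z, dotp z z = (3 * D / 2) ^+ 2 /\
    lagr_sup D 1^-1 u (pt j) - eta <= lagr 1^-1 u (pt j) z.
  move=> j; rewrite invr1.
  have [z hz h] := @lagr_sup_approx _ _ D _ _ ler01 u1 (pt j) _ eta0.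
  have [z' hz' h'] := lagr1_sphere (pt j) u1 hz.
  by exists z'; split => //; apply: le_trans (ltW h) h'.
have zo j : dotp (zeta j) (zeta j) <= (3 * D / 2) ^+ 2 by rewrite (hzeta j).1.
have [a [b [hab aE h]]] := attainable_lagr_ge D_gt0 eta0 h1 h2 h3 h4 h5 h6 ltr01 zo
  (fun j => (hzeta j).2).
(* The source has norm at most [D / 2] and the target norm [3 D / 2], so they are at distance at
   least [D]. *)
have aD : D ^+ 2 <= a.
  have Dj j : D ^+ 2 <= dotp (pt j - zeta j) (pt j - zeta j).
    have d0 : 0 <= D / 2 by rewrite divr_ge0 // ltW.
    have r0 : 0 <= 3 * D / 2 by rewrite divr_ge0 // mulr_ge0 // ltW.
    have c0 : 0 <= D / 2 - enorm (pt j).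
      by rewrite subr_ge0 enorm_le.
    have := @normr_dotp_le _ _ (pt j) (zeta j) (enorm (pt j)) (3 * D / 2)
      (enorm_ge0 _) r0.
    rewrite enorm_sqr lexx (hzeta j).1 lexx => /(_ isT isT) hn.
    rewrite !dotpE [dotp (zeta j) (pt j)]dotpC (hzeta j).1 -enorm_sqr.
    move: hn; rewrite ler_norml => /andP[_ hn].
    have := enorm_ge0 (pt j); move: c0 hn D_gt0; set m := enorm _; set i := dotp _ _ => *; nra.
  rewrite aE; apply: (@le_trans _ _ (\sum_j cell_weight C P j * D ^+ 2)).
    by rewrite -mulr_suml (cell_weight_sum1 h1 h2 h3) mul1r.
  apply: (@le_trans _ _ (\sum_j cell_weight C P j * dotp (pt j - zeta j) (pt j - zeta j))).
    by apply: ler_sum => j _; rewrite ler_wpM2l // cell_weight_ge0.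
  by rewrite lerDl mulr_ge0 ?(ltW eta0) // mulr_ge0 // ltW.
have := hl a b hab.
have : g <= (1 - l) * (a - rho) by rewrite ler_pM2l ?subr_gt0 // lerD2r.
have : (8 * D + 1) * eta = g / 2 by rewrite /eta; field; rewrite gt_eqF.
move: h; rewrite !mul1r invr1 -/S; move: vS g0; lra.
Qed.

End DualMultiplier.

(** * Empirical measures and the critical radius *)

Section EmpiricalIntegral.
Context {R : realType} {d : measure_display} {Y : measurableType d} {n : nat}.
Variable x : 'I_n -> Y.

Lemma integral_empirical (f : Y -> \bar R) :
  measurable_fun setT f -> (forall y, (0 <= f y)%E) ->
  (\int[empirical x]_y f y = (n%:R^-1)%:E * \sum_(i < n) f (x i))%E.
Proof.
move=> mf f0.
pose m (k : nat) : {measure set Y -> \bar R} :=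
  if insub k is Some i then \d_(x i) else mzero.
have n_ge0 : 0 <= n%:R^-1 :> R by rewrite invr_ge0.
rewrite (eq_measure_integral (mscale (NngNum n_ge0) (msum m n))) => [|A mA _]; last first.
  rewrite /mscale /msum /=; congr (_ * _)%E.
  by apply: eq_bigr => i _; rewrite /m valK.
rewrite ge0_integral_mscale // ge0_integral_measure_sum //=; congr (_ * _)%E.
apply: eq_bigr => i _; rewrite /m valK.
have := @integral_dirac _ _ (x i) R setT measurableT f mf.
by rewrite diracT mul1e.
Qed.

Lemma empirical_setT : (0 < n)%N -> empirical x [set: Y] = 1%E :> \bar R.
Proof.
move=> n0; rewrite /empirical; under eq_bigr do rewrite diracT.
by rewrite sumEFin sumr_const card_ord -EFinM mulVf // pnatr_eq0 -lt0n.
Qed.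

End EmpiricalIntegral.

Section EmpiricalCells.
Context {R : realType} {d : measure_display} {Y : measurableType d} {J : finType} {n : nat}.
Variables (C : J -> set Y) (x : 'I_n -> Y) (t : n.-tuple J).
Hypotheses (disjC : forall j j' x, C j x -> C j' x -> j = j') (xC : forall i, C (tnth t i) (x i)).

Lemma empirical_cells (k : J -> R) :
  (\sum_j (k j)%:E * empirical x (C j) = ((\sum_(j <- t) k j) / n%:R)%:E)%E.
Proof.
have cellE j : empirical x (C j) = (n%:R^-1 * \sum_(i < n) (tnth t i == j)%:R)%:E :> \bar R.
  rewrite /empirical EFinM -sumEFin; congr (_ * _)%E; apply: eq_bigr => i _.
  rewrite diracE; have [tij|tij] := eqVneq (tnth t i) j.
    by rewrite mem_set // -tij.
  rewrite memNset // => Cj; move: tij; by rewrite (disjC Cj (xC i)) eqxx.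
under eq_bigr do rewrite cellE -EFinM.
rewrite sumEFin; congr EFin.
under eq_bigr do rewrite mulrCA mulr_sumr.
rewrite -mulr_sumr exchange_big /= mulrC big_tuple; congr (_ * _).
apply: eq_bigr => i _; rewrite (bigD1 (tnth t i)) //= eqxx mulr1 big1 ?addr0 // => j jt.
by rewrite eq_sym (negbTE jt) mulr0.
Qed.

Lemma empirical_cover : (0 < n)%N -> empirical x (\bigcup_j C j) = 1%E :> \bar R.
Proof.
move=> n0; rewrite -(empirical_setT x n0) /empirical; congr (_ * _)%E.
apply: eq_bigr => i _; rewrite !diracE !mem_set //.
by exists (tnth t i).
Qed.

End EmpiricalCells.

Section CriticalRadius.
Context {R : realType} {p : nat}.
Local Notation T := ('rV[R]_p * R)%type.
Local Notation X := (borel_data R p).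
Variables (D : R) (P : probability X R) (F : set (X -> R)).
Hypotheses (D_gt0 : 0 < D)
  (P_inner : P [set x : X | dotp x x <= (D / 2) ^+ 2] = 1%E)
  (F_sqr : forall g, F g -> exists nu (u : T),
     [/\ 0 < nu, dotp u u = 1 & forall z, g z = nu * dotp u z ^+ 2]).
Local Notation Xi := [set z : X | dotp z z <= (3 * D / 2) ^+ 2].
Local Notation c := (@sq_cost R p : X -> X -> R).

Let r0 : 0 <= 3 * D / 2. Proof. by rewrite divr_ge0 // mulr_ge0 // ltW. Qed.

Let aeP : {ae P, forall x : X, dotp x x <= (D / 2) ^+ 2}.
Proof. by apply: (ae_probability1 _ P_inner); exact: measurable_dotp_ball. Qed.

(** A maximizer does at least as well as [(3 D / 2) u], and Cauchy-Schwarz turns this into a lower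
    bound on its norm. *)
Lemma argmax_sphere g nu (u z : T) : 0 < nu -> dotp u u = 1 ->
  (forall z, g z = nu * dotp u z ^+ 2) ->
  argmax_on Xi g z -> dotp z z = (3 * D / 2) ^+ 2.
Proof.
move=> nu0 u1 gE [zXi zmax]; apply/eqP; rewrite eq_le zXi /=.
have := zmax ((3 * D / 2) *: u).
rewrite /= !dotpE u1 mulr1 -expr2 lexx => /(_ isT).
rewrite !gE dotpZr u1 mulr1 ler_pM2l // => /le_trans; apply.
by have := dotp_cauchy u z; rewrite u1 mul1r.
Qed.

Lemma argmax_pole g nu (u : T) (s : R) : 0 < nu -> dotp u u = 1 ->
  (forall z, g z = nu * dotp u z ^+ 2) -> s ^+ 2 = (3 * D / 2) ^+ 2 ->
  argmax_on Xi g (s *: u).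
Proof.
move=> nu0 u1 gE hs; split; first by rewrite /= dotpZl dotpZr u1 mulr1 -expr2 hs.
by move=> z hz; rewrite !gE dotpZr u1 mulr1 ler_pM2l // hs; exact: sqr_dotp_le.
Qed.

(** Maximizers are at distance at least [3 D / 2 - D / 2] from the data. The inner infimum is not
    known to be measurable, so it is compared everywhere, not almost everywhere, with a multiple of
    the indicator of the data ball. *)
Lemma critical_radius_ge : ((D ^+ 2)%:E <= critical_radius Xi c F P)%E.
Proof.
apply: le_ereal_inf_tmp => _ [g /F_sqr[nu [u [nu0 u1 gE]]] <-].
have -> : (D ^+ 2)%:E = (\int[P]_x ((D ^+ 2)%:E * (\1_[set x : X | dotp x x <= (D / 2) ^+ 2] x)%:E))%E.
  rewrite ge0_integralZl_EFin ?sqr_ge0 //; last first.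
    apply/measurable_EFinP; apply: measurable_indic; exact: measurable_dotp_ball.
  rewrite [X in (_ * X)%E](_ : _ = 1%E) ?mule1 //.
  rewrite (integral_indic _ measurableT (measurable_dotp_ball _)) setIT.
  exact: P_inner.
apply: nonmeasurable_ge0_le_integral => x; first by rewrite mule_ge0 ?lee_fin ?sqr_ge0.
apply: le_ereal_inf_tmp => _ [z hz <-].
rewrite -EFinM lee_fin indicE; case: (boolP (x \in _)) => hx; last first.
  by rewrite mulr0 /sq_cost sqr_ge0.
rewrite mulr1 /sq_cost; move: hx; rewrite inE /= => hx.
have zE := argmax_sphere nu0 u1 gE hz.
have zn : enorm z = 3 * D / 2.
  by apply/eqP; rewrite -(eqrXn2 (n:=2)) ?enorm_ge0 // enorm_sqr zE.
have xn : enorm x <= D / 2 by rewrite enorm_le // divr_ge0 // ltW.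
rewrite ler_pXn2r ?nnegrE ?enorm_ge0 ?(ltW D_gt0) //.
have : enorm z <= enorm x + enorm (x - z).
  rewrite enorm_le ?addr_ge0 ?enorm_ge0 //.
  have := @dotp_sub_le _ _ (x : T) (x - z) (enorm x) (enorm (x - z)) (enorm_ge0 _) (enorm_ge0 _).
  by rewrite !enorm_sqr !lexx opprB addrC subrK; exact.
by rewrite zn; lra.
Qed.

(** Of the two poles [(3 D / 2) u] and [- (3 D / 2) u], the one on the side of [x] is at squared
    distance at most [|x|^2 + (3 D / 2)^2]. This makes the critical radius finite and a quarter of
    it less than [D^2], as the dual multiplier and the displaced sample points require. *)
Lemma critical_radius_le g : F g -> (critical_radius Xi c F P <= (5 / 2 * D ^+ 2)%:E)%E.
Proof.
move=> Fg; have [nu [u [nu0 u1 gE]]] := F_sqr Fg.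
apply: le_trans (ereal_inf_lbound _) _; first by exists g.
have N0 (x : X) : 0 <= dotp x x + (3 * D / 2) ^+ 2 by rewrite addr_ge0 ?dotp_ge0 ?sqr_ge0.
apply: (@le_trans _ _ (\int[P]_x (dotp x x + (3 * D / 2) ^+ 2)%:E)%E).
  apply: nonmeasurable_ge0_le_integral => x.
    by apply: le_ereal_inf_tmp => _ [z _ <-]; rewrite lee_fin /sq_cost sqr_ge0.
  have pole s : s ^+ 2 = (3 * D / 2) ^+ 2 ->
      (ereal_inf [set (c x z)%:E | z in argmax_on Xi g] <= (dotp (x - s *: u) (x - s *: u))%:E)%E.
    move=> hs; apply: ereal_inf_lbound; exists (s *: u); first exact: (argmax_pole nu0 u1 gE hs).
    by rewrite /sq_cost enorm_sqr.
  have [xu|xu] := leP 0 (dotp u x).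
    apply: le_trans (pole (3 * D / 2) erefl) _.
    rewrite lee_fin !dotpE u1 [dotp x u]dotpC.
    have : 0 <= 3 * D / 2 * dotp u x by rewrite mulr_ge0.
    by lra.
  apply: le_trans (pole (- (3 * D / 2)) (sqrrN _)) _.
  rewrite lee_fin !dotpE u1 [dotp x u]dotpC.
  have : 3 * D / 2 * dotp u x <= 0 by rewrite mulr_ge0_le0 // ltW.
  by lra.
have -> : (5 / 2 * D ^+ 2)%:E = (\int[P]_x (5 / 2 * D ^+ 2)%:E)%E.
  rewrite integral_cst // -[LHS]mule1; congr (_ * _)%E.
  exact/esym/(probability_setT P).
apply: ae_ge0_le_integral => //.
- by move=> x _; rewrite lee_fin N0.
- apply/measurable_EFinP; apply: measurable_funD => //.
  exact: (measurable_dotp (@measurable_id _ _ setT) (@measurable_id _ _ setT)).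
- by move=> x _; rewrite lee_fin mulr_ge0 ?sqr_ge0.
- apply: filterS aeP => x hx _; rewrite lee_fin.
  have -> : 5 / 2 * D ^+ 2 = (D / 2) ^+ 2 + (3 * D / 2) ^+ 2 by field.
  by rewrite lerD2r.
Qed.

End CriticalRadius.

(** * Generalization bounds *)

Section CellIntegral.
Context {R : realType} {p : nat} {J : finType}.
Local Notation T := ('rV[R]_p * R)%type.
Local Notation X := (borel_data R p).
Variables (D eta : R) (P : probability X R) (u : T) (C : J -> set X) (pt : J -> T).
Hypotheses (D_gt0 : 0 < D) (eta_gt0 : 0 < eta) (u1 : dotp u u = 1)
  (mC : forall j, measurable (C j)) (disjC : forall j j' x, C j x -> C j' x -> j = j')
  (PC : P (\bigcup_j C j) = 1%E)
  (C_inner : forall j x, C j x -> dotp x x <= (D / 2) ^+ 2)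
  (pt_inner : forall j, dotp (pt j) (pt j) <= (D / 2) ^+ 2)
  (C_close : forall j x, C j x -> dotp ((x : T) - pt j) ((x : T) - pt j) <= eta ^+ 2).
Local Notation q := (cell_weight C P).

Lemma gain_close j x : C j x -> `|dotp u x ^+ 2 - dotp u (pt j) ^+ 2| <= D * eta.
Proof.
move=> Cj; exact: (dotp_sqr_close D_gt0 u1 (C_inner Cj) (pt_inner j) (ltW eta_gt0) (C_close Cj)).
Qed.

Lemma integral_gain_cells : exists2 m : R, (\int[P]_x gain u x = m%:E)%E &
  `|m - \sum_j q j * dotp u (pt j) ^+ 2| <= D * eta.
Proof.
have aeC : {ae P, forall x, (\bigcup_j C j) x}.
  by apply: ae_probability1 => //; exact: fin_bigcup_measurable.
have sumE (k : J -> R) : (forall j, 0 <= k j) ->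
    (\int[P]_x cell_step C k x = (\sum_j q j * k j)%:E)%E.
  by move=> k0; rewrite (integral_cell_step mC) // (sum_cell_weightE P mC).
have De0 : 0 <= D * eta by rewrite mulr_ge0 // ltW.
have up : (\int[P]_x gain u x <= (\sum_j q j * dotp u (pt j) ^+ 2 + D * eta)%:E)%E.
  rewrite -(cell_weight_sumD mC disjC PC) -sumE => [|j]; last by rewrite addr_ge0 ?sqr_ge0.
  apply: ae_ge0_le_integral => //.
  - by move=> x _; exact: gain_ge0.
  - exact: measurable_gain.
  - by move=> x _; apply: cell_step_ge0 => j; rewrite addr_ge0 ?sqr_ge0.
  - exact: measurable_cell_step.
  - apply: filterS aeC => x [j _ Cj] _; rewrite (cell_stepE disjC _ Cj) lee_fin.
    by rewrite -lerBlDl (le_trans (ler_norm _)) ?gain_close.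
have low : ((\sum_j q j * dotp u (pt j) ^+ 2)%:E <= \int[P]_x (gain u x + (D * eta)%:E))%E.
  rewrite -sumE => [|j]; last by rewrite sqr_ge0.
  apply: ae_ge0_le_integral => //.
  - by move=> x _; apply: cell_step_ge0 => j; rewrite sqr_ge0.
  - exact: measurable_cell_step.
  - by move=> x _; rewrite adde_ge0 ?gain_ge0 ?lee_fin.
  - by apply: emeasurable_funD => //; exact: measurable_gain.
  - apply: filterS aeC => x [j _ Cj] _; rewrite (cell_stepE disjC _ Cj) /gain -EFinD lee_fin.
    by rewrite -lerBlDl (le_trans (ler_norm _)) // distrC gain_close.
have I0 : (0 <= \int[P]_x gain u x)%E by apply: integral_ge0 => x _; exact: gain_ge0.
have Ifin : (\int[P]_x gain u x)%E \is a fin_num.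
  by rewrite ge0_fin_numE // (le_lt_trans up) ?ltry.
exists (fine (\int[P]_x gain u x)%E); first by rewrite fineK.
move: up; rewrite -{1}(fineK Ifin) lee_fin => up.
have E : (\int[P]_x (gain u x + (D * eta)%:E) = \int[P]_x gain u x + (D * eta)%:E)%E.
  rewrite ge0_integralD; [|by []|by move=> x _; exact: gain_ge0|exact: measurable_gain|
    by move=> x _; rewrite lee_fin|by []].
  rewrite integral_cst //; congr (_ + _)%E; rewrite -[RHS]mule1; congr (_ * _)%E.
  exact: (probability_setT P).
move: low; rewrite E -{1}(fineK Ifin) -EFinD lee_fin => low.
rewrite ler_norml lerBlDl up andbT.
by rewrite lerBrDr addrC lerBlDr.
Qed.

End CellIntegral.

(** The accounting of the upper bound: the extra radius [a], multiplied by [l], pays for the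
    deviation [th] and for both discretizations, of the sample and of the data distribution. *)
Lemma multiplier_budget (R : realDomainType) (l rho a S K v th De : R) :
  K <= l * (S + th + 4 * De) -> l * (rho + a + S) <= v + l * (4 * De) ->
  l * (th + 8 * De) <= l * a -> l * rho + K <= v.
Proof. by lra. Qed.
Section Generalization.
Context {R : realType} {p : nat} {d : measure_display} {Omega : measurableType d}.
Local Notation T := ('rV[R]_p * R)%type.
Local Notation X := (borel_data R p).
Variables (D : R) (P : probability X R) (F : set (X -> R)).
Hypotheses (D_gt0 : 0 < D)
  (P_inner : P [set x : X | dotp x x <= (D / 2) ^+ 2] = 1%E)
  (F_sqr : forall g, F g -> exists nu (u : T),
     [/\ 0 < nu, dotp u u = 1 & forall z, g z = nu * dotp u z ^+ 2]).
Local Notation Xi := [set z : X | dotp z z <= (3 * D / 2) ^+ 2].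
Local Notation c := (@sq_cost R p : X -> X -> R).

Variables (Pr : probability Omega R) (n : nat) (xi : 'I_n -> {RV Pr >-> X}).
Hypotheses (iid_xi : iid_sample P xi) (n_gt0 : (0 < n)%N).
Variables (L delta a rho : R).
Hypotheses (L_ge1 : 1 <= L) (L_delta : expR (- (L ^+ 2 / 2)) <= delta)
  (a_ge : D ^+ 2 * (9 * L + 432) / Num.sqrt n%:R <= a).

Let sn0 : 0 < Num.sqrt n%:R :> R. Proof. by rewrite sqrtr_gt0 ltr0n. Qed.

(** The mesh for which the total discretization error [8 D eta] is [D^2 / sqrt n], the gap between
    the constants 432 and 431. *)
Let eta : R := D / (8 * Num.sqrt n%:R).

Let eta0 : 0 < eta. Proof. by rewrite divr_gt0 // mulr_gt0. Qed.

Let thr : R := Num.sqrt n%:R * (D ^+ 2 * (9 * L + 431)).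

Let thr_a : thr / n%:R + 8 * (D * eta) <= a.
Proof.
apply: le_trans a_ge; rewrite /thr /eta -{2}(sqr_sqrtr (ler0n R n)) le_eqVlt.
by apply/orP; left; apply/eqP; field; rewrite gt_eqF.
Qed.

Let a0 : 0 <= a.
Proof.
apply: le_trans a_ge; apply: divr_ge0; last exact: sqrtr_ge0.
by apply: mulr_ge0; [exact: sqr_ge0|move: L_ge1; lra].
Qed.

Theorem robust_risk_upper : 0 < rho -> rho + a < D ^+ 2 ->
  with_probability_at_least Pr (1 - delta)
    [set w | forall g, F g -> (robust_risk Xi c rho%:E (empirical (fun i => xi i w)) g
       <= robust_risk Xi c (rho + a)%:E P g)%E].
Proof.
move=> rho0 rhoa.
have [J [C [pt [mC dC PC Cin [ptin Ccl]]]]] := probability_cells D_gt0 P_inner eta0.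
have tail := @lagr_sup_uniform_tail R p J D (cell_weight C P) pt D_gt0
  (cell_weight_ge0 C P) (cell_weight_sum1 mC dC PC) ptin n L n_gt0 L_ge1.
have [A [mA PA hA]] := good_sample_event mC dC PC iid_xi (le_trans tail L_delta).
exists A; split => // w Aw g Fg.
have [t /asboolPn good tC] := hA w Aw.
have [nu [u [nu0 u1 gE]]] := F_sqr Fg.
have rhoa0 : 0 < rho + a by rewrite ltr_wpDr.
(* The multiplier belongs to [P] at the enlarged radius: it varies with [g] but not with the sample,
   and the event covers all inverses in [[0, 1]] at once. *)
have [v [l [l1 hv hl]]] := dual_multiplier D_gt0 u1 P_inner rhoa0 rhoa.
have l0 : 0 < l by exact: lt_le_trans l1.
have par : [&& 0 <= (l^-1, u).1, (l^-1, u).1 <= 1 & dotp (l^-1, u).2 (l^-1, u).2 == 1].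
  by rewrite /= invr_ge0 (ltW l0) invf_le1 // l1 u1 eqxx.
set S := \sum_j cell_weight C P j * lagr_sup D l^-1 u (pt j).
have hS : \sum_(j <- t) (lagr_sup D l^-1 u (pt j) - S) <= thr.
  rewrite leNgt; apply/negP => h; apply: good.
  by exists (Sub (l^-1, u) par : profile_param).
have nR : 0 < n%:R :> R by rewrite ltr0n.
pose k j := l * (lagr_sup D l^-1 u (pt j) + 4 * (D * eta)).
have k0 j : 0 <= k j by exact: (cell_lagr_ge0 D_gt0 eta0 u1 ptin).
have hk := fun j x z => @cell_lagr_le R p J D eta u C pt D_gt0 eta0 u1 Cin ptin Ccl l j x z l0.
apply: le_trans (robust_risk_le (ltW nu0) gE rho mC dC (empirical_cover tC n_gt0) (ltW l0) k0 hk
  (empirical_cells dC tC k)) _.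
have ks : (\sum_(j <- t) k j) / n%:R <= l * (S + thr / n%:R + 4 * (D * eta)).
  rewrite /k -mulr_sumr -mulrA ler_pM2l // ler_pdivrMr //.
  have -> : \sum_(j <- t) (lagr_sup D l^-1 u (pt j) + 4 * (D * eta)) =
     \sum_(j <- t) (lagr_sup D l^-1 u (pt j) - S) + n%:R * (S + 4 * (D * eta)).
    have -> : n%:R * (S + 4 * (D * eta)) = \sum_(j <- t) (S + 4 * (D * eta)).
      by rewrite big_const_seq count_predT size_tuple iter_addr_0 mulr_natl.
    by rewrite -big_split /=; apply: eq_bigr => j _; ring.
  have -> : (S + thr / n%:R + 4 * (D * eta)) * n%:R = thr + n%:R * (S + 4 * (D * eta)).
    by field; rewrite gt_eqF.
  by rewrite lerD2r.
have sg := supergradient_lagr_le D_gt0 eta0 u1 mC dC PC Cin ptin Ccl l0 hl.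
have lv : l * rho + (\sum_(j <- t) k j) / n%:R <= v.
  have th_a : l * (thr / n%:R + 8 * (D * eta)) <= l * a by rewrite ler_pM2l.
  exact: (multiplier_budget ks sg th_a).
apply: (@le_trans _ _ (nu * v)%:E); first by rewrite lee_fin ler_pM2l.
(* [v] is only approached, by plans of cost at most [rho + a]. *)
apply/lee_addgt0Pr => e e0.
have [b [pi [h1 h2 h3 h4]] vb] := hv (e / nu) (divr_gt0 e0 nu0).
apply: (@le_trans _ _ ((nu * b)%:E + e%:E)%E).
  have : nu * (v - e / nu) <= nu * b by rewrite ler_pM2l // ltW.
  by rewrite mulrBr mulrCA mulfV ?gt_eqF // mulr1 -EFinD lee_fin lerBlDr.
rewrite leeD2r //; exact: (robust_risk_ge (ltW nu0) gE h1 h2 h3 h4).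
Qed.

Theorem robust_risk_lower : a <= D ^+ 2 -> a <= rho ->
  with_probability_at_least Pr (1 - delta)
    [set w | forall g, F g ->
       ('E_P[g] <= robust_risk Xi c rho%:E (empirical (fun i => xi i w)) g)%E].
Proof.
move=> aD arho.
have [J [C [pt [mC dC PC Cin [ptin Ccl]]]]] := probability_cells D_gt0 P_inner eta0.
have tail := @second_moment_uniform_tail R p J D (cell_weight C P) pt D_gt0
  (cell_weight_ge0 C P) (cell_weight_sum1 mC dC PC) ptin n L n_gt0 L_ge1.
have [A [mA PA hA]] := good_sample_event mC dC PC iid_xi (le_trans tail L_delta).
exists A; split => // w Aw g Fg.
have [t /asboolPn good tC] := hA w Aw.
have [nu [u [nu0 u1 gE]]] := F_sqr Fg.
have par : dotp u u == 1 by rewrite u1.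
set G := \sum_j cell_weight C P j * dotp u (pt j) ^+ 2.
have nR : 0 < n%:R :> R by rewrite ltr0n.
have hG : n%:R * G - \sum_(j <- t) dotp u (pt j) ^+ 2 <= thr.
  rewrite leNgt; apply/negP => h; apply: good.
  exists (Sub u par : unit_vector); apply: (lt_le_trans h).
  have GE : \sum_j cell_weight C P j * - dotp u (pt j) ^+ 2 = - G.
    by rewrite /G -sumrN; apply: eq_bigr => j _; rewrite mulrN.
  rewrite /= GE opprK big_split /= sumrN big_const_seq count_predT size_tuple iter_addr_0.
  by rewrite addrC mulr_natl.
have [m IE hm] := integral_gain_cells D_gt0 eta0 u1 mC dC PC Cin ptin Ccl.
pose x i := xi i w.
pose s := Num.sqrt a.
have s0 : 0 <= s by exact: sqrtr_ge0.
have s2 : s ^+ 2 = a by rewrite sqr_sqrtr.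
(* The displacement [s] then keeps the points within radius [D / 2 + D]. *)
have sD : s <= D by rewrite -ler_sqr ?nnegrE ?(ltW D_gt0) // s2.
pose sg i : R := if 0 <= dotp u (x i) then 1 else -1.
have sg2 i : sg i * sg i = 1 by rewrite /sg; case: ifP => _; rewrite ?mulr1 // mulrNN mulr1.
have sgu i : sg i * dotp u (x i) = `|dotp u (x i)|.
  by rewrite /sg; case: ger0P => _; rewrite ?mul1r // mulN1r.
pose z i : X := (x i : T) + (s * sg i) *: u.
have xin i : dotp (x i) (x i) <= (D / 2) ^+ 2 by exact: Cin (tC i).
have zout i : dotp (z i) (z i) <= (3 * D / 2) ^+ 2.
  apply: (@le_trans _ _ ((D / 2 + s) ^+ 2)).
    apply: dotp_add_le => //; first by rewrite divr_ge0 // ltW.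
    by rewrite dotpZl dotpZr u1 mulr1 mulrACA sg2 mulr1 expr2.
  by rewrite ler_pXn2r ?nnegrE ?addr_ge0 ?divr_ge0 ?mulr_ge0 ?(ltW D_gt0) //; lra.
(* The plan is the empirical measure of the pairs of original and displaced points. *)
pose xz i : X * X := (x i, z i).
pose pi : probability (X * X)%type R := as_probability (empirical_setT xz n_gt0).
have piE (f : X * X -> \bar R) : measurable_fun setT f -> (forall y, (0 <= f y)%E) ->
    (\int[pi]_y f y = (n%:R^-1)%:E * \sum_(i < n) f (xz i))%E.
  by move=> mf f0; exact: integral_empirical.
pose b := (\sum_(i < n) dotp u (z i) ^+ 2) / n%:R.
apply: (@le_trans _ _ (nu * b)%:E); last first.
  apply: (robust_risk_ge (ltW nu0) gE (pi := pi)).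
  - by [].
  - apply: etrans (empirical_setT xz n_gt0).
    rewrite /pi /= /as_probability /empirical; congr (_ * _)%E.
    apply: eq_bigr => i _; rewrite !diracE !mem_set //; exact: zout.
  - rewrite piE; [|exact: measurable_cost|exact: cost_ge0].
    have -> : (\sum_(i < n) cost (xz i) = (n%:R * a)%:E)%E.
      rewrite /cost sumEFin -[n in n%:R * _]card_ord mulr_natl -sumr_const; congr EFin.
      apply: eq_bigr => i _; rewrite /= /z opprD addrA subrr add0r !dotpE u1.
      transitivity (s ^+ 2 * (sg i * sg i)); first by ring.
      by rewrite sg2 mulr1.
    by rewrite -EFinM mulKf ?gt_eqF // lee_fin.
  - rewrite piE; last 2 first.
    + exact: (measurableT_comp (measurable_gain u) measurable_snd).
    + by move=> y; exact: gain_ge0.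
    by rewrite sumEFin -EFinM /b mulrC.
rewrite (expectation_gain (ltW nu0) gE) // IE -EFinM lee_fin ler_pM2l // /b ler_pdivlMr //.
(* The displaced point has second moment [(|<u, x>| + s)^2], at least [<u, x>^2 + a]; [D eta]
   accounts for the cell. *)
have zi i : dotp u (pt (tnth t i)) ^+ 2 + (a - D * eta) <= dotp u (z i) ^+ 2.
  have := gain_close D_gt0 eta0 u1 Cin ptin Ccl (tC i); rewrite ler_norml.
  have -> : dotp u (z i) ^+ 2 = dotp u (x i) ^+ 2 + 2 * s * (sg i * dotp u (x i)) + s ^+ 2 * (sg i * sg i).
    by rewrite /z !dotpE u1; ring.
  rewrite sgu sg2 s2 -/(x i); have : 0 <= 2 * s * `|dotp u (x i)| by rewrite !mulr_ge0.
  by lra.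
have : \sum_(j <- t) dotp u (pt j) ^+ 2 + n%:R * (a - D * eta) <= \sum_(i < n) dotp u (z i) ^+ 2.
  rewrite big_tuple -[n in n%:R * _]card_ord mulr_natl -sumr_const -big_split /=.
  by apply: ler_sum => i _; exact: zi.
have : m * n%:R <= (G + D * eta) * n%:R.
  by rewrite ler_pM2r //; move: hm; rewrite ler_norml -/G; lra.
have : thr + n%:R * (8 * (D * eta)) <= n%:R * a.
  have := thr_a; rewrite -(ler_pM2l nR) mulrDr mulrCA mulfV ?mulr1 // gt_eqF //.
have : 0 <= n%:R * (D * eta) by rewrite !mulr_ge0 // ltW.
move: hG; lra.
Qed.

End Generalization.

(** * Lipschitz losses *)

Section LipschitzRisk.
Context {R : realType} {p : nat}.
Local Notation T := ('rV[R]_p * R)%type.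
Local Notation X := (borel_data R p).
Variables (D : R) (P : probability X R) (nu rho Lip : R) (u : T) (g : X -> R).
Hypotheses (D_gt0 : 0 < D)
  (P_inner : P [set x : X | dotp x x <= (D / 2) ^+ 2] = 1%E)
  (nu_gt0 : 0 < nu) (u1 : dotp u u = 1) (gE : forall z, g z = nu * dotp u z ^+ 2).
Local Notation Xi := [set z : X | dotp z z <= (3 * D / 2) ^+ 2].
Local Notation c := (@sq_cost R p : X -> X -> R).

(** Young's inequality bounds [|x - z|] by [kap / 2 + |x - z|^2 / (2 kap)] with [kap = sqrt rho].
    Weak duality with the multiplier [Lip / (2 kap)], divided by [nu] because the gain is
    normalized, then adds [Lip kap / 2 + Lip rho / (2 kap) = Lip sqrt rho]. *)
Theorem robust_risk_lipschitz : 0 < rho -> elipschitz_on Xi Lip g ->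
  (robust_risk Xi c rho%:E P g <= 'E_P[g] + (Lip * Num.sqrt rho)%:E)%E.
Proof.
move=> rho0 gLip.
have r0 : 0 < 3 * D / 2 by rewrite divr_gt0 // mulr_gt0.
(* Forced by two distinct points of [Xi], the centre and a pole. *)
have Lip0 : 0 <= Lip.
  have h0 : Xi 0 by rewrite /= dotp0r sqr_ge0.
  have h2 : Xi ((3 * D / 2) *: u) by rewrite /= dotpZl dotpZr u1 mulr1 -expr2.
  have := le_trans (normr_ge0 _) (gLip _ _ h2 h0).
  rewrite subr0 pmulr_lge0 // lt_neqAle enorm_ge0 andbT eq_sym.
  by rewrite -sqrf_eq0 enorm_sqr dotpZl dotpZr u1 mulr1 -expr2 sqrf_eq0 gt_eqF.
apply/lee_addgt0Pr => e e0.
(* Two errors [nu D eta], one in the potential and one in the mean, add up to [e]. *)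
pose eta := e / (2 * D * nu).
have eta0 : 0 < eta by rewrite divr_gt0 // !mulr_gt0.
have [J [C [pt [mC dC PC Cin [ptin Ccl]]]]] := probability_cells D_gt0 P_inner eta0.
have [m IE hm] := integral_gain_cells D_gt0 eta0 u1 mC dC PC Cin ptin Ccl.
pose kap := Num.sqrt rho.
have kap0 : 0 < kap by rewrite sqrtr_gt0.
have kap2 : kap ^+ 2 = rho by rewrite sqr_sqrtr // ltW.
pose l := Lip / (2 * kap * nu).
have l0 : 0 <= l.
  by rewrite divr_ge0 // mulr_ge0 ?(ltW nu_gt0) // mulr_ge0 // ltW.
pose h := D * eta + Lip * kap / (2 * nu).
have h0 : 0 <= h.
  apply: addr_ge0; first by rewrite mulr_ge0 ?(ltW eta0) // ltW.
  by apply: divr_ge0; rewrite mulr_ge0 // ltW.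
pose k j := dotp u (pt j) ^+ 2 + h.
have k0 j : 0 <= k j by rewrite addr_ge0 ?sqr_ge0.
have hk j (x z : T) : C j x -> Xi z -> dotp u z ^+ 2 <= l * dotp (x - z) (x - z) + k j.
  move=> Cj hz; have hx := inner_outer D_gt0 (Cin _ _ Cj).
  have := gLip _ _ hx hz; rewrite !gE ler_norml => /andP[h1 _].
  have := gain_close D_gt0 eta0 u1 Cin ptin Ccl Cj; rewrite ler_norml => /andP[_ h2].
  have am : enorm (x - z) <= kap / 2 + dotp (x - z) (x - z) / (2 * kap).
    have -> : kap / 2 + dotp (x - z) (x - z) / (2 * kap) =
        (kap ^+ 2 + enorm (x - z) ^+ 2) / (2 * kap).
      by rewrite enorm_sqr; field; rewrite gt_eqF.
    rewrite ler_pdivlMr ?mulr_gt0 //; have := sqr_ge0 (enorm (x - z) - kap).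
    by rewrite sqrrB mulr2n; lra.
  rewrite -(ler_pM2l nu_gt0).
  have -> : nu * (l * dotp (x - z) (x - z) + k j) = nu * dotp u (pt j) ^+ 2 +
      nu * (D * eta) + Lip * (kap / 2 + dotp (x - z) (x - z) / (2 * kap)).
    by rewrite /k /h /l; field; rewrite !gt_eqF.
  have h3 := ler_wpM2l Lip0 am; have h4 := ler_wpM2l (ltW nu_gt0) h2.
  move: h1 h3 h4; rewrite mulrBr; lra.
have hm' : \sum_j cell_weight C P j * k j <= m + D * eta + h.
  rewrite (cell_weight_sumD mC dC PC) lerD2r -lerBlDl.
  by rewrite (le_trans (ler_norm _)) // distrC.
apply: le_trans (robust_risk_le (ltW nu_gt0) gE rho mC dC PC l0 k0 hk (sum_cell_weightE P mC k)) _.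
rewrite (expectation_gain (ltW nu_gt0) gE) IE -EFinM -!EFinD lee_fin.
apply: (@le_trans _ _ (nu * (l * rho + (m + D * eta + h)))).
  by rewrite ler_pM2l // lerD2l.
rewrite le_eqVlt; apply/orP; left; apply/eqP.
by rewrite /h /l -{1}kap2 -/kap /eta; field; rewrite !gt_eqF.
Qed.

End LipschitzRisk.

(** * Constants of the statement *)

Section SampleSize.
Local Open Scope ereal_scope.
Context {R : realType}.

(** An infinite [alpha] would make the left-hand side infinite, so the condition on the sample size
    itself makes [alpha] a real number. *)
Lemma sample_size_bound (alpha : \bar R) (rc : R) (n : nat) :
  (0 < rc)%R -> 0 <= alpha ->
  16%:E * alpha ^+ 2 / (rc%:E) ^+ 2 < n%:R%:E ->
  exists a : R, [/\ alpha = a%:E, (0 < n)%N & (a / Num.sqrt n%:R < rc / 4)%R].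
Proof.
move=> rc0 alpha0.
have rc2 : (0 < rc ^+ 2)%R by rewrite exprn_gt0.
have -> : (rc%:E ^+ 2)^-1 = ((rc ^+ 2)^-1)%:E by rewrite expe2 -EFinM inver -expr2 gt_eqF.
case: alpha alpha0 => [a|_|//]; last first.
  by rewrite expe2 mulyy gt0_muley ?lte_fin // gt0_mulye ?lte_fin ?invr_gt0.
rewrite lee_fin expe2 -!EFinM lte_fin => a0 h; exists a.
have h0 : (0 <= 16 * (a * a) / rc ^+ 2)%R by rewrite divr_ge0 ?mulr_ge0 // ltW.
have nR : (0 < n%:R :> R)%R by exact: le_lt_trans h.
have n0 : (0 < n)%N by rewrite ltr0n in nR.
have s0 : (0 < Num.sqrt n%:R :> R)%R by rewrite sqrtr_gt0.
split => //; rewrite ltr_pdivrMr //.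
rewrite -(ltr_pXn2r (n := 2)) ?nnegrE // ?mulr_ge0 ?divr_ge0 ?(ltW rc0) ?(ltW s0) //.
rewrite exprMn sqr_sqrtr ?(ltW nR) //.
move: h; rewrite ltr_pdivrMr // expr_div_n expr2; lra.
Qed.

(** [exp (1 / 2) <= 2] follows from [exp (- 1 / 2) >= 1 / 2] and gives [ln (2 / delta) >= 1 / 2];
    moreover [exp (- L^2 / 2)] equals [delta / 2]. *)
Lemma log_confidence (delta : R) : (0 < delta)%R -> (delta < 1)%R ->
  let L := Num.sqrt (2 * ln (2 / delta)) in
  (1 <= L)%R /\ (expR (- (L ^+ 2 / 2)) <= delta)%R.
Proof.
move=> d0 d1 L.
have ln2 : (1 / 2 <= ln (2 / delta))%R.
  rewrite -[leLHS]expRK ler_ln ?posrE ?expR_gt0 ?divr_gt0 //.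
  apply: (@le_trans _ _ 2%R); last by rewrite ler_pdivlMr //; lra.
  rewrite -[leLHS]invrK -expRN invf_ple ?posrE ?expR_gt0 //.
  by apply: le_trans (expR_ge1Dx _); lra.
have L2 : (L ^+ 2 = 2 * ln (2 / delta))%R by rewrite sqr_sqrtr //; lra.
split.
  rewrite -(ler_pXn2r (n := 2)) ?nnegrE ?sqrtr_ge0 // L2 expr1n; lra.
have -> : (- (L ^+ 2 / 2) = ln (delta / 2))%R.
  have -> : (delta / 2 = (2 / delta)^-1)%R by rewrite invf_div.
  by rewrite L2 lnV ?posrE ?divr_gt0 //; field.
by rewrite lnK ?posrE ?divr_gt0 //; lra.
Qed.

End SampleSize.

Section LinearRegressionFamily.
Local Open Scope ereal_scope.
Context {R : realType} {p : nat}.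
Local Notation T := ('rV[R]_p * R)%type.
Local Notation X := (borel_data R p).

Lemma sq_lossE (theta : 'rV[R]_p) (z : X) :
  sq_loss theta z = (dotp (theta, -1)%R (z : T) ^+ 2)%R.
Proof. by rewrite /sq_loss /dotp /= mulN1r. Qed.

Lemma sq_loss_unit (omega : R) (theta : 'rV[R]_p) : (0 < omega)%R ->
  (omega <= enorm (theta, (-1)%R) ^+ 2)%R ->
  exists nu (u : T), [/\ (omega <= nu)%R, dotp u u = 1%R &
    forall z : X, sq_loss theta z = (nu * dotp u (z : T) ^+ 2)%R].
Proof.
rewrite enorm_sqr; set v : T := (theta, _); set nu := dotp v v => om nuom.
have nu0 : (0 < nu)%R by exact: lt_le_trans nuom.
have s0 : (0 < Num.sqrt nu)%R by rewrite sqrtr_gt0.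
exists nu, ((Num.sqrt nu)^-1 *: v); split => //.
  rewrite dotpZl dotpZr -/nu mulrA -invfM -expr2 sqr_sqrtr ?(ltW nu0) //.
  by rewrite mulVf // gt_eqF.
move=> z; rewrite sq_lossE -/v dotpZl exprMn exprVn sqr_sqrtr ?(ltW nu0) //.
by rewrite mulrA mulfV ?gt_eqF // mul1r.
Qed.

(** Evaluation at the pole [(3 D / 2) u]. *)
Lemma family_norm_ge (D omega nu : R) (u : T) (F : set (X -> R)) (g : X -> R) :
  (0 < D)%R -> (0 <= omega)%R -> (omega <= nu)%R -> dotp u u = 1%R -> F g ->
  (forall z, g z = nu * dotp u (z : T) ^+ 2)%R ->
  (9 / 4 * D ^+ 2 * omega)%:E <=
  family_norm [set z : X | (dotp z z <= (3 * D / 2) ^+ 2)%R] F.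
Proof.
move=> D0 om0 onu u1 Fg gE.
apply: (@le_trans _ _ (sup_norm [set z : X | (dotp z z <= (3 * D / 2) ^+ 2)%R] g)); last first.
  by apply: ereal_sup_ubound; exists g.
apply: (@le_trans _ _ `|g ((3 * D / 2) *: u)%R|%:E); last first.
  apply: ereal_sup_ubound; exists ((3 * D / 2) *: u)%R => //=.
  by rewrite dotpZl dotpZr u1 mulr1 -expr2.
rewrite lee_fin gE dotpZr u1 mulr1; apply: le_trans (ler_norm _).
have -> : (9 / 4 * D ^+ 2 * omega = omega * (3 * D / 2) ^+ 2)%R by field.
by rewrite ler_wpM2r // sqr_ge0.
Qed.

Lemma dudley_integral_ge0 (Xi : set X) (F : set (X -> R)) : 0 <= dudley_integral Xi F.
Proof. by apply: integral_ge0 => t _; exact: sqrte_ge0. Qed.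

(** Each factor is bounded below by the summand that survives: with [2 / lambda = 4 / omega], the
    first product gives [48 (9/4) 4 = 432] and the last term [2 (9/4) 2 = 9]. *)
Lemma radius_alpha_ge (D omega L : R) (N I : \bar R) :
  (0 < omega)%R -> (0 <= L)%R -> (9 / 4 * D ^+ 2 * omega)%:E <= N -> 0 <= I ->
  (D ^+ 2 * (9 * L + 432))%:E <=
  48%:E * (N + (1 / (omega / 2))%:E) * (I + (2 / (omega / 2))%:E)
    + 2%:E * N / (omega / 2)%:E * L%:E.
Proof.
move=> om0 L0 hN I0.
have l0 : (0 < omega / 2)%R by rewrite divr_gt0.
have N00 : (0 <= 9 / 4 * D ^+ 2 * omega)%R by rewrite mulr_ge0 ?(ltW om0) // mulr_ge0 ?sqr_ge0 // divr_ge0.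
have -> : ((omega / 2)%:E)^-1 = ((omega / 2)^-1)%:E by rewrite inver gt_eqF.
have -> : (D ^+ 2 * (9 * L + 432))%:E =
   48%:E * (9 / 4 * D ^+ 2 * omega)%:E * (2 / (omega / 2))%:E +
   2%:E * (9 / 4 * D ^+ 2 * omega)%:E * ((omega / 2)^-1)%:E * L%:E.
  by rewrite -!EFinM -EFinD; congr EFin; field; rewrite gt_eqF.
have i0 : (0 <= 1 / (omega / 2))%R by rewrite divr_ge0 // ltW.
have i0' : (0 <= 2 / (omega / 2))%R by rewrite divr_ge0 // ltW.
apply: leeD.
  apply: lee_pmul; rewrite ?mule_ge0 ?lee_fin //.
    apply: lee_wpmul2l; first by rewrite lee_fin.
    by rewrite (le_trans hN) // leeDl.
  by rewrite leeDr.
apply: lee_wpmul2r; first by rewrite lee_fin.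
apply: lee_wpmul2r; first by rewrite lee_fin invr_ge0 ltW.
by apply: lee_wpmul2l.
Qed.

End LinearRegressionFamily.

Local Open Scope ereal_scope.

Theorem propositionE4 (R : realType) (p : nat) (D omega : R)
    (P : probability (borel_data R p) R) (Theta : set 'rV[R]_p)
    (D_gt0 : (0 < D)%R)
    (P_supp : support_of P `<=` eball_diam D)
    (Theta_compact : compact Theta)
    (omega_gt0 : (0 < omega)%R)
    (Theta_omega : omega%:E <=
       ereal_inf [set (enorm (theta, (-1)%R) ^+ 2)%:E | theta in Theta]) :
  let Xi : set (borel_data R p) := eball_diam (3 * D)%R in
  let c : borel_data R p -> borel_data R p -> R := @sq_cost R p in
  let F : set (borel_data R p -> R) := [set sq_loss theta | theta in Theta] in
  let normF := family_norm Xi F in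
  let I_F := dudley_integral Xi F in
  let rho_crit := critical_radius Xi c F P in
  (D ^+ 2)%:E <= rho_crit /\
  exists lambda_low : R, (omega / 2 <= lambda_low)%R /\
  forall delta : R, (0 < delta)%R -> (delta < 1)%R ->
  let alpha :=
    48%:E * (normF + (1 / lambda_low)%:E) * (I_F + (2 / lambda_low)%:E)
    + 2%:E * normF / lambda_low%:E * (Num.sqrt (2 * ln (2 / delta)))%:E in
  let beta :=
    96%:E * I_F / lambda_low%:E
    + 4%:E * normF / lambda_low%:E * (Num.sqrt (2 * ln (4 / delta)))%:E in
  forall (d : measure_display) (Omega : measurableType d)
    (Pr : probability Omega R) (n : nat)
    (X : 'I_n -> {RV Pr >-> borel_data R p}),
  iid_sample P X ->
  let P_hat (w : Omega) : {measure set (borel_data R p) -> \bar R} :=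
    empirical (fun i => X i w) in
  let alpha_n := alpha / (Num.sqrt n%:R)%:E in
  (forall rho : R,
     16%:E * (alpha + beta) ^+ 2 / rho_crit ^+ 2 < n%:R%:E ->
     alpha_n < rho%:E ->
     with_probability_at_least Pr (1 - delta)%R
       [set w | forall g, F g ->
          'E_P[g] <= robust_risk Xi c rho%:E (P_hat w) g]) /\
  (forall rho : R,
     16%:E * alpha ^+ 2 / rho_crit ^+ 2 < n%:R%:E ->
     (0 < rho)%R ->
     rho%:E <= rho_crit / 4%:E - alpha_n ->
     with_probability_at_least Pr (1 - delta)%R
       [set w |
          (forall g, F g ->
             robust_risk Xi c rho%:E (P_hat w) g
             <= robust_risk Xi c (rho%:E + alpha_n) P g) /\
          (forall Lip : R, (forall g, F g -> elipschitz_on Xi Lip g) ->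
             forall g, F g ->
               robust_risk Xi c rho%:E (P_hat w) g
               <= 'E_P[g] + Lip%:E * sqrte (rho%:E + alpha_n))]).
Proof.
set Xi0 : set (borel_data R p) := [set z | (dotp z z <= (3 * D / 2) ^+ 2)%R].
have XiE : (eball_diam (3 * D) : set (borel_data R p)) = Xi0 by exact: eball_Xi.
have P_inner : P [set x : borel_data R p | (dotp x x <= (D / 2) ^+ 2)%R] = 1.
  exact: support_ball D_gt0 P_supp.
move=> Xi c F normF I_F rho_crit.
have F_unit g : F g -> exists nu u, [/\ (omega <= nu)%R, dotp u u = 1%R &
    forall z, g z = (nu * dotp u z ^+ 2)%R].
  move=> [theta Ttheta <-]; apply: sq_loss_unit => //.
  rewrite -lee_fin (le_trans Theta_omega) //; apply: ereal_inf_lbound.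
  by exists theta.
have F_sqr g : F g -> exists nu u, [/\ (0 < nu)%R, dotp u u = 1%R &
    forall z, g z = (nu * dotp u z ^+ 2)%R].
  move=> /F_unit[nu [u [onu u1 gE]]]; exists nu, u; split => //.
  exact: lt_le_trans onu.
have rho_ge : (D ^+ 2)%:E <= rho_crit.
  by rewrite /rho_crit /Xi XiE; exact: critical_radius_ge.
split => //; exists (omega / 2)%R; split => // delta delta0 delta1 alpha beta.
move=> d Omega Pr n X iidX P_hat alpha_n.
(* With [Theta] empty the claims on [g] are vacuous, while the norm of the family and the critical
   radius are infinite; this case is set aside. *)
have [[g0 Fg0]|F0] := pselect (exists g, F g); last first.
  have vacuous (A : set Omega) : setT `<=` A ->
      with_probability_at_least Pr (1 - delta)%R A.
    move=> TA; exists setT; split => //.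
    by rewrite (probability_setT Pr) lee_fin lerBlDr lerDl ltW.
  split=> rho *; apply: vacuous => w _ /=; first by move=> g Fg; case: F0; exists g.
  by split=> [|Lip _] g Fg; case: F0; exists g.
have rho_le : rho_crit <= (5 / 2 * D ^+ 2)%:E.
  by rewrite /rho_crit /Xi XiE; exact: (critical_radius_le D_gt0 P_inner F_sqr Fg0).
have [rc rcE] : exists rc, rho_crit = rc%:E.
  exists (fine rho_crit); rewrite fineK // fin_numE; apply/andP; split.
    by rewrite gt_eqF // (lt_le_trans _ rho_ge) // ltNyr.
  by rewrite lt_eqF // (le_lt_trans rho_le) // ltry.
rewrite rcE !lee_fin in rho_ge rho_le.
have D20 : (0 < D ^+ 2)%R by rewrite exprn_gt0.
have rc0 : (0 < rc)%R by exact: lt_le_trans rho_ge.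
have I0 : 0 <= I_F by exact: dudley_integral_ge0.
have normF_ge : (9 / 4 * D ^+ 2 * omega)%:E <= normF.
  have [nu [u [onu u1 gE]]] := F_unit _ Fg0.
  by rewrite /normF /Xi XiE; exact: (family_norm_ge D_gt0 (ltW omega_gt0) onu u1 Fg0 gE).
have [L1 Ldelta] := log_confidence delta0 delta1.
set L := Num.sqrt (2 * ln (2 / delta)) in L1 Ldelta.
have L0 : (0 <= L)%R by exact: sqrtr_ge0.
have alpha_ge : (D ^+ 2 * (9 * L + 432))%:E <= alpha.
  exact: (radius_alpha_ge omega_gt0 L0 normF_ge I0).
have alpha0 : 0 <= alpha.
  apply: le_trans alpha_ge; rewrite lee_fin; apply: mulr_ge0; first exact: ltW.
  by lra.
have normF0 : 0 <= normF.
  by apply: le_trans normF_ge; rewrite lee_fin mulr_ge0 ?(ltW omega_gt0) // mulr_ge0 ?(ltW D20) // divr_ge0.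
have il0 : 0 <= ((omega / 2)%:E)^-1.
  by rewrite inver gt_eqF ?divr_gt0 // lee_fin invr_ge0 divr_ge0 // ltW.
have beta0 : 0 <= beta.
  by apply: adde_ge0; repeat (apply: mule_ge0 => //); rewrite lee_fin sqrtr_ge0.
have real_radius : 16%:E * alpha ^+ 2 / rho_crit ^+ 2 < n%:R%:E ->
    exists a, [/\ (0 < n)%N, alpha_n = a%:E,
      (D ^+ 2 * (9 * L + 432) / Num.sqrt n%:R <= a)%R & (a < rc / 4)%R].
  rewrite rcE => /(sample_size_bound rc0 alpha0)[a [aE n0 a_lt]].
  have s0 : (0 < Num.sqrt n%:R :> R)%R by rewrite sqrtr_gt0 ltr0n.
  exists (a / Num.sqrt n%:R)%R; split => //.
    by rewrite /alpha_n aE inver gt_eqF.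
  by rewrite ler_pM2r ?invr_gt0 // -lee_fin -aE.
split=> rho hn.
  move=> alpha_rho.
  have [|a [n0 anE a_ge a_lt]] := real_radius.
    (* Since [beta >= 0], the condition of (a) on [n] implies that of (b). *)
    apply: le_lt_trans hn; apply: lee_wpmul2r.
      by rewrite rcE expe2 -EFinM inver gt_eqF ?mulr_gt0 // lee_fin invr_ge0 mulr_ge0 // ltW.
    apply: lee_wpmul2l; first by rewrite lee_fin.
    by rewrite !expe2 lee_pmul // leeDl.
  rewrite /Xi XiE; apply: (robust_risk_lower D_gt0 P_inner F_sqr iidX n0 L1 Ldelta a_ge).
    by lra.
  by move: alpha_rho; rewrite anE lte_fin => /ltW.
move=> rho0 rho_small.
have [a [n0 anE a_ge a_lt]] := real_radius hn.
have a0 : (0 <= a)%R.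
  apply: le_trans a_ge; apply: divr_ge0; last exact: sqrtr_ge0.
  by apply: mulr_ge0; [exact: ltW|lra].
(* [rho + a <= rc / 4], which is at most [5/8 D^2]. *)
have rhoa : (rho + a < D ^+ 2)%R.
  move: rho_small; rewrite anE rcE inver gt_eqF // -EFinM -EFinB lee_fin; lra.
have [A [mA A_sub PA]] :=
  robust_risk_upper D_gt0 P_inner F_sqr iidX n0 L1 Ldelta a_ge rho0 rhoa.
(* One event serves both claims: the second applies the Lipschitz bound to [P] at radius
   [rho + a]. *)
exists A; split => // w Aw; rewrite /Xi XiE anE -EFinD.
split=> [g Fg|Lip LipF g Fg]; first exact: A_sub.
apply: le_trans (A_sub w Aw g Fg) _.
have [nu [u [nu0 u1 gE]]] := F_sqr g Fg.
have := robust_risk_lipschitz D_gt0 P_inner nu0 u1 gE (rho := (rho + a)%R) (Lip := Lip).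
by rewrite /= -EFinM; apply; [rewrite ltr_wpDr|exact: LipF].
Qed.
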